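(* Let $\mathbb{G}$ be a second countable compact group, let $\gamma:\mathbb{G}\to[0,1]$ be a Cayley function, and let $w:\mathbb{G}\times\mathbb{G}\to[0,1]$, $w(x,y)=\gamma(xy^{-1})$, be the Cayley graphon defined by $\gamma$. (i) The set of eigenvalues of $T_w$ is $\bigcup_{\pi\in\widehat{\mathbb{G}}}\{\text{eigenvalues of }\pi(\gamma)\}$. (ii) For every nonzero eigenvalue $\lambda$ of $T_w$, there are only finitely many $\pi\in\widehat{\mathbb{G}}$ such that $\lambda\in\mathrm{Spec}(\pi(\gamma))$. Denote this finite set by $\widehat{\mathbb{G}}_{\lambda,\gamma}$. (iii) Let $\lambda\neq0$ be an eigenvalue of $T_w$. The $\lambda$-eigenvectors $\phi\in L^2(\mathbb{G})$ of $T_w$ are characterized as the functions $$\phi(x)=\sum_{\pi\in\widehat{\mathbb{G}}_{\lambda,\gamma}}d_\pi\,\overline{\mathrm{Tr}[A_\pi\pi(x)^*]},$$ where each $A_\pi$ is a $d_\pi\times d_\pi$ complex matrix every column of which is either zero or a $\lambda$-eigenvector of $\pi(\gamma)$, and at least one of the $A_\pi$ is nonzero. (iv) The multiplicity of every nonzero eigenvalue $\lambda$ of $T_w$ is $\sum_{\pi\in\widehat{\mathbb{G}}_{\lambda,\gamma}}d_\pi m_{\lambda,\pi}$, where $m_{\lambda,\pi}$ is the multiplicity of the eigenvalue $\lambda$ of $\pi(\gamma)$.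
   Context: Compact groups are compact Hausdorff topological groups, equipped with their normalized (probability) Haar measure $dx$. A Cayley function is a measurable function $\gamma:\mathbb{G}\to[0,1]$ with $\gamma(x)=\gamma(x^{-1})$ for all $x\in\mathbb{G}$. $T_w:L^2(\mathbb{G})\to L^2(\mathbb{G})$ is the integral operator $T_w(f)(x)=\int_{\mathbb{G}}w(x,y)f(y)\,dy$. $\widehat{\mathbb{G}}$ is the set of equivalence classes of irreducible (continuous) unitary representations of $\mathbb{G}$; for each class one fixes a representative $\pi:\mathbb{G}\to U(\mathbb{C}^{d_\pi})$, where $d_\pi$ is its (finite) dimension, written as matrices in the standard basis. For $f\in L^1(\mathbb{G})$, $\pi(f)=\int_{\mathbb{G}}f(y)\pi(y)\,dy$ (entry-wise), a $d_\pi\times d_\pi$ matrix. $\mathrm{Spec}$ denotes the set of eigenvalues of a matrix. Eigenvectors are nonzero by definition. *)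

(* Defs.v *)
From HB Require Import structures.
From mathcomp Require Import all_boot all_order all_algebra.
From mathcomp Require Import sesquilinear spectral.
From mathcomp Require Import all_classical all_reals all_analysis.
From mathcomp Require Import complex.

Set Implicit Arguments.
Unset Strict Implicit.
Unset Printing Implicit Defensive.

Import Order.TTheory GRing.Theory Num.Theory.
Import numFieldNormedType.Exports.

Local Open Scope classical_set_scope.
Local Open Scope ring_scope.
Local Open Scope sesquilinear_scope.

(* The library has no topology on R[i]; this is the one of the modulus. *)
HB.instance Definition _ (R : rcfType) :=
  PseudoPointedMetric.copy R[i] (R[i] : numFieldType)^o.

HB.mixin Record isTopologicalGroup G of Topological G & Group G := {
  mulg_continuous : continuous (fun xy : G * G => (xy.1 * xy.2)%g);
  invg_continuous : continuous (fun x : G => (x^-1)%g)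
}.

(* Pointedness carries no content here (a group is inhabited by its unit); the *)
(* library asks for it to put a sigma-algebra on a type.                       *)
#[short(type="topologicalGroupType")]
HB.structure Definition TopologicalGroup :=
  {G of PointedTopological G & Group G & isTopologicalGroup G}.

(* Compact groups are Hausdorff by convention. *)
Definition compact_group (G : topologicalGroupType) : Prop :=
  compact [set: G] /\ hausdorff_space G.

Notation borel G := (g_sigma_algebraType (@open G)).

(* Normalised Haar measure: a left-invariant Borel probability measure. On a  *)
(* second countable compact group such a measure is automatically regular, is *)
(* unique, and is also right- and inversion-invariant.                        *)
Definition is_haar (R : realType) (G : topologicalGroupType)
    (mu : probability (borel G) R) : Prop :=
  forall (x : G) (A : set G), measurable (A : set (borel G)) ->
    mu [set (x * y)%g | y in A] = mu A.

Definition cintegral d (T : measurableType d) (R : realType)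
    (mu : {measure set T -> \bar R}) (f : T -> R[i]) : R[i] :=
  Complex (Rintegral mu setT (fun x => complex.Re (f x)))
          (Rintegral mu setT (fun x => complex.Im (f x))).

(* Complex-valued square-integrable functions; elements of L^2 are such       *)
(* functions up to equality almost everywhere.                                *)
Definition square_integrable d (T : measurableType d) (R : realType)
    (mu : {measure set T -> \bar R}) (f : T -> R[i]) : Prop :=
  [/\ measurable_fun setT (fun x => complex.Re (f x)),
      measurable_fun setT (fun x => complex.Im (f x)) &
      (\int[mu]_x (complex.Re (f x) ^+ 2 + complex.Im (f x) ^+ 2)%:E < +oo)%E].

Definition integral_op d (T : measurableType d) (R : realType)
    (mu : {measure set T -> \bar R}) (w : T -> T -> R) (f : T -> R[i]) :
    T -> R[i] :=
  fun x => cintegral mu (fun y => (w x y)%:C%C * f y).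

(* The lambda-eigenspace of an operator on L^2, as a set of functions that is *)
(* closed under almost everywhere equality (of square-integrable functions).  *)
Definition op_eigenspace d (T : measurableType d) (R : realType)
    (mu : {measure set T -> \bar R}) (K : (T -> R[i]) -> T -> R[i])
    (lambda : R[i]) : set (T -> R[i]) :=
  [set f | square_integrable mu f /\ K f = (fun x => lambda * f x) %[ae mu]].

Definition op_eigenvector d (T : measurableType d) (R : realType)
    (mu : {measure set T -> \bar R}) (K : (T -> R[i]) -> T -> R[i])
    (lambda : R[i]) : set (T -> R[i]) :=
  [set f | op_eigenspace mu K lambda f /\ ~ (f = (fun=> 0) %[ae mu])].

Definition op_eigenvalue d (T : measurableType d) (R : realType)
    (mu : {measure set T -> \bar R}) (K : (T -> R[i]) -> T -> R[i]) :
    set R[i] :=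
  [set lambda | exists f, op_eigenvector mu K lambda f].

(* The multiplicity of lambda is n: the lambda-eigenspace, modulo almost      *)
(* everywhere equality, has a basis with n elements.                          *)
Definition op_multiplicity d (T : measurableType d) (R : realType)
    (mu : {measure set T -> \bar R}) (K : (T -> R[i]) -> T -> R[i])
    (lambda : R[i]) (n : nat) : Prop :=
  exists b : 'I_n -> T -> R[i],
    [/\ forall i, op_eigenspace mu K lambda (b i),
        forall c : 'I_n -> R[i],
          (fun x => \sum_i c i * b i x) = (fun=> 0) %[ae mu] ->
          forall i, c i = 0 &
        forall f, op_eigenspace mu K lambda f ->
          exists c : 'I_n -> R[i],
            f = (fun x => \sum_i c i * b i x) %[ae mu]].

(* Matrices act on column vectors, whereas eigenspace and stablemx are about  *)
(* row vectors: hence the transpositions below.                               *)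
Definition mx_eigenvector (F : fieldType) n (A : 'M[F]_n) (a : F)
    (v : 'cV[F]_n) : Prop := v != 0 /\ A *m v = a *: v.

Definition mx_spec (F : fieldType) n (A : 'M[F]_n) : set F :=
  [set a | exists v, mx_eigenvector A a v].

Definition mx_multiplicity (F : fieldType) n (A : 'M[F]_n) (a : F) : nat :=
  \rank (eigenspace A^T a).

Definition mx_irreducible (F : fieldType) (T : Type) n (pi : T -> 'M[F]_n) :
    Prop :=
  (0 < n)%N /\
  forall U : 'M[F]_n, (forall x, stablemx U (pi x)^T) -> U = 0 \/ row_full U.

Record unirrep (R : realType) (G : topologicalGroupType) := Unirrep {
  udim : nat;
  umx :> G -> 'M[R[i]]_udim;
  umx_continuous : continuous umx;
  umx_unitary : forall x, umx x \is unitarymx;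
  umxM : forall x y, umx (x * y)%g = umx x *m umx y;
  umx_irr : mx_irreducible umx
}.

HB.instance Definition _ (R : realType) (G : topologicalGroupType) :=
  gen_eqMixin (unirrep R G).
HB.instance Definition _ (R : realType) (G : topologicalGroupType) :=
  gen_choiceMixin (unirrep R G).

(* The intertwiner is rectangular so that no cast between dimensions is       *)
(* needed; being unitary on both sides it forces them to be equal.            *)
Definition urep_equiv (R : realType) (G : topologicalGroupType)
    (pi rho : unirrep R G) : Prop :=
  exists U : 'M[R[i]]_(udim rho, udim pi),
    [/\ U \is unitarymx, U ^t* \is unitarymx &
        forall x, U *m pi x = rho x *m U].

(* Ghat consists of one representative of each equivalence class. *)
Definition unitary_dual (R : realType) (G : topologicalGroupType)
    (Ghat : set (unirrep R G)) : Prop :=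
  forall rho : unirrep R G, exists! pi, Ghat pi /\ urep_equiv pi rho.

Definition urep_fun (R : realType) (G : topologicalGroupType)
    (mu : probability (borel G) R) (pi : unirrep R G) (f : G -> R[i]) :
    'M[R[i]]_(udim pi) :=
  \matrix_(i, j) cintegral mu (fun y : borel G => f y * pi y i j).

Definition cayley_function (R : realType) (G : topologicalGroupType)
    (gamma : G -> R) : Prop :=
  [/\ measurable_fun setT (gamma : borel G -> R),
      forall x, 0 <= gamma x <= 1 &
      forall x, gamma x = gamma (x^-1)%g].

Definition cayley_graphon (R : realType) (G : topologicalGroupType)
    (gamma : G -> R) (x y : borel G) : R :=
  gamma ((x : G) * (y : G)^-1)%g.

Definition dual_at (R : realType) (G : topologicalGroupType)
    (mu : probability (borel G) R) (Ghat : set (unirrep R G))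
    (gamma : G -> R) (lambda : R[i]) : set (unirrep R G) :=
  [set pi | Ghat pi /\
            mx_spec (urep_fun mu pi (fun x => (gamma x)%:C%C)) lambda].

(* phi(x) = sum_(pi in P) d_pi * conj (Tr [A_pi pi(x)^*]); meaningful for     *)
(* finite P only.                                                             *)
Definition fourier_sum (R : realType) (G : topologicalGroupType)
    (P : set (unirrep R G)) (A : forall pi : unirrep R G, 'M[R[i]]_(udim pi))
    (x : borel G) : R[i] :=
  \sum_(pi \in P) (udim pi)%:R * (\tr (A pi *m (pi x) ^t* ))^*.

(* Main.v *)
Require Import Defs.
From HB Require Import structures.
From mathcomp Require Import all_boot all_order all_algebra.
From mathcomp Require Import sesquilinear spectral.
From mathcomp Require Import finmap.
From mathcomp Require Import all_classical all_reals all_analysis.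
From mathcomp Require Import complex.
From mathcomp Require Import measurable_realfun ring lra.

Set Implicit Arguments.
Unset Strict Implicit.
Unset Printing Implicit Defensive.

Import Order.TTheory GRing.Theory Num.Theory.
Import numFieldNormedType.Exports.

Local Open Scope classical_set_scope.
Local Open Scope ring_scope.

(** The operator T_w is the convolution by gamma. It maps the matrix
    coefficients pi_ij of a representation to combinations of themselves, through
    the matrix pi(gamma); as Schur orthogonality isolates the Fourier
    coefficients of each class, everything reduces to the completeness part of
    the Peter-Weyl theorem: a square-integrable f that is orthogonal to all the
    coefficients of the irreducible representations vanishes a.e.

    If such an f is not null, some average g(x) = \int f 1_{xU} over the
    translates of an open set U is continuous, nonzero and still orthogonal to
    all the coefficients, and so is the hermitian function F = g * g~. The
    spectral theorem for compact operators is replaced by a power iteration: the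
    squared norms c_n of the convolution powers F^n are log-convex and
    submultiplicative, hence c_(n+1) / c_n increases to some l with c_n >= l^n,
    and F^(2n) / l^n is uniformly Cauchy with a nonzero limit, an eigenfunction
    of the convolution by F * F. By Bessel's inequality its eigenspace is finite
    dimensional; it is invariant under right translations, and an orthonormal
    family spanning a minimal invariant subspace yields an irreducible
    representation whose coefficients span this subspace. But the functions in
    the eigenspace are orthogonal to all such coefficients. *)

(** Elements of L^2 are plain functions here, so every evaluation at a point needs a continuous
    representative. Convolution supplies it: it turns L^2 estimates into uniform ones and, with a
    continuous factor, yields continuous functions. As Haar measure charges every nonempty open set,
    almost everywhere equalities between continuous functions hold everywhere. Hence the power
    iteration converges uniformly, and the functions of an eigenspace can be evaluated at 1. Second
    countability makes (x, y) |-> x y^-1 measurable for the product sigma-algebra, so that Fubini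
    applies to convolutions; it also gives the countable neighbourhood bases that replace regularity
    of the measure. On combinations of the coefficients of pi with matrix B, T_w acts by B |->
    pi(gamma)^T B. Since gamma is real and invariant under inversion, pi(gamma) is hermitian: its
    eigenvalues are real and its transpose is its conjugate, which explains the conjugate in the
    formula for the eigenvectors. The d_pi columns of B are transformed independently, which
    explains the factor d_pi in the multiplicity. *)

Local Notation Re := complex.Re.
Local Notation Im := complex.Im.

(** * Complex-valued integrals *)

Section ComplexParts.
Context {R : realType}.
Implicit Types z w : R[i].

Lemma ReD z w : Re (z + w) = Re z + Re w. Proof. by case: z; case: w. Qed.
Lemma ImD z w : Im (z + w) = Im z + Im w. Proof. by case: z; case: w. Qed.
Lemma ReN z : Re (- z) = - Re z. Proof. by case: z. Qed.
Lemma ImN z : Im (- z) = - Im z. Proof. by case: z. Qed.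
Lemma ReM z w : Re (z * w) = Re z * Re w - Im z * Im w.
Proof. by case: z; case: w. Qed.
Lemma ImM z w : Im (z * w) = Re z * Im w + Im z * Re w.
Proof. by case: z; case: w. Qed.
Lemma ReJ z : Re z^* = Re z. Proof. by case: z. Qed.
Lemma ImJ z : Im z^* = - Im z. Proof. by case: z. Qed.
Lemma Re_sum (I : Type) (s : seq I) (F : I -> R[i]) :
  Re (\sum_(i <- s) F i) = \sum_(i <- s) Re (F i).
Proof. by elim/big_ind2: _ => //= *; subst; rewrite ReD. Qed.
Lemma complex_eqP z w : Re z = Re w -> Im z = Im w -> z = w.
Proof. by case: z => a b; case: w => c d /= -> ->. Qed.
Lemma mulcJE z : z * z^* = (Re z ^+ 2 + Im z ^+ 2)%:C%C.
Proof.
apply: complex_eqP; rewrite ?ReM ?ImM ReJ ImJ /=; first by rewrite mulrN opprK.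
by rewrite mulrN mulrC addNr.
Qed.
Lemma complexR_ge0 z : 0 <= z -> z = (Re z)%:C%C.
Proof. by rewrite lecE /= => /andP[/eqP h _]; apply: complex_eqP. Qed.
End ComplexParts.

Section ComplexIntegral.
Context d (T : measurableType d) (R : realType)
  (mu : {measure set T -> \bar R}).
Implicit Types (f g : T -> R[i]).

Definition cmeasurable f :=
  measurable_fun setT (fun x => Re (f x)) /\
  measurable_fun setT (fun x => Im (f x)).

Definition cintegrable f :=
  mu.-integrable setT (EFin \o (fun x => Re (f x))) /\
  mu.-integrable setT (EFin \o (fun x => Im (f x))).

Definition cbounded (U : Type) (f : U -> R[i]) :=
  exists M : R, forall x, `|Re (f x)| <= M /\ `|Im (f x)| <= M.

Lemma cmeasurable_cst (c : R[i]) : cmeasurable (fun=> c).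
Proof. by split; apply: measurable_cst. Qed.

Lemma cmeasurableD f g :
  cmeasurable f -> cmeasurable g -> cmeasurable (fun x => f x + g x).
Proof.
move=> [fr fi] [gr gi]; split.
- by under eq_fun do rewrite ReD; apply: measurable_funD.
- by under eq_fun do rewrite ImD; apply: measurable_funD.
Qed.

Lemma cmeasurableM f g :
  cmeasurable f -> cmeasurable g -> cmeasurable (fun x => f x * g x).
Proof.
move=> [fr fi] [gr gi]; split.
- under eq_fun do rewrite ReM.
  by apply: measurable_funB; apply: measurable_funM.
- under eq_fun do rewrite ImM.
  by apply: measurable_funD; apply: measurable_funM.
Qed.

Lemma cmeasurableJ f : cmeasurable f -> cmeasurable (fun x => (f x)^*).
Proof.
move=> [fr fi]; split; first by under eq_fun do rewrite ReJ.
by under eq_fun do rewrite ImJ; apply: measurableT_comp.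
Qed.

Lemma cmeasurable_real (f : T -> R) :
  measurable_fun setT f -> cmeasurable (fun x => (f x)%:C%C).
Proof. by move=> mf; split => //=; apply: measurable_cst. Qed.

Lemma cintegrable_measurable f : cintegrable f -> cmeasurable f.
Proof.
by move=> [/integrableP[fr _] /integrableP[fi _]]; split;
  apply/measurable_EFinP.
Qed.

Lemma cintegrable_dom f (g : T -> R) : cmeasurable f ->
  mu.-integrable setT (EFin \o g) ->
  (forall x, `|Re (f x)| <= g x /\ `|Im (f x)| <= g x) -> cintegrable f.
Proof.
move=> [fr fi] ig fg; split; apply: le_integrable ig => //;
  try exact/measurable_EFinP;
  move=> x _ /=; rewrite lee_fin (le_trans _ (ler_norm _))//;
  by have [] := fg x.
Qed.

Lemma cintegrable_normR f : cintegrable f ->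
  mu.-integrable setT (EFin \o (fun x => `|Re (f x)| + `|Im (f x)|)).
Proof.
move=> [/integrable_norm fr /integrable_norm fi].
have := integrableD measurableT fr fi.
by apply: eq_integrable => // x _ /=; rewrite EFinD.
Qed.

Lemma cintegrableMb f g : cintegrable f -> cmeasurable g -> cbounded g ->
  cintegrable (fun x => g x * f x).
Proof.
move=> If mg [M gM]; have mf := cintegrable_measurable If.
apply: (@cintegrable_dom _ (fun x => M * (`|Re (f x)| + `|Im (f x)|))).
- exact: cmeasurableM.
- have := integrableZl measurableT M (cintegrable_normR If).
  by apply: eq_integrable => // x _ /=; rewrite EFinM.
move=> x; have [gr gi] := gM x; rewrite ReM ImM; split.
  rewrite (le_trans (ler_normB _ _))// !normrM mulrDr.
  by apply: lerD; apply: ler_wpM2r.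
rewrite (le_trans (ler_normD _ _))// !normrM mulrDr addrC.
by apply: lerD; apply: ler_wpM2r.
Qed.

Lemma cintegrableD f g :
  cintegrable f -> cintegrable g -> cintegrable (fun x => f x + g x).
Proof.
move=> [fr fi] [gr gi]; split.
- have := integrableD measurableT fr gr.
  by apply: eq_integrable => // x _ /=; rewrite ReD EFinD.
- have := integrableD measurableT fi gi.
  by apply: eq_integrable => // x _ /=; rewrite ImD EFinD.
Qed.

Lemma cbounded_cst (U : Type) (c : R[i]) : cbounded (fun _ : U => c).
Proof.
by exists (`|Re c| + `|Im c|) => x; rewrite lerDl lerDr !normr_ge0.
Qed.

Lemma cintegrableZ c f : cintegrable f -> cintegrable (fun x => c * f x).
Proof.
move=> If; apply: (@cintegrableMb f (fun=> c)) => //.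
exact: cbounded_cst.
Qed.

Lemma cintegrableJ f : cintegrable f -> cintegrable (fun x => (f x)^*).
Proof.
move=> [fr fi]; split.
- by apply: eq_integrable fr => // x _ /=; rewrite ReJ.
- have := integrableZl measurableT (-1) fi.
  by apply: eq_integrable => // x _ /=; rewrite ImJ -EFinM mulN1r.
Qed.

Lemma cintegral_ext f g : f =1 g -> cintegral mu f = cintegral mu g.
Proof. by move=> /funext ->. Qed.

Lemma cintegralD f g : cintegrable f -> cintegrable g ->
  cintegral mu (fun x => f x + g x) = cintegral mu f + cintegral mu g.
Proof.
move=> [fr fi] [gr gi]; apply: complex_eqP; rewrite ?ReD ?ImD /=.
- by under eq_Rintegral do rewrite ReD; rewrite RintegralD.
- by under eq_Rintegral do rewrite ImD; rewrite RintegralD.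
Qed.

Lemma cintegralZ c f : cintegrable f ->
  cintegral mu (fun x => c * f x) = c * cintegral mu f.
Proof.
move=> [fr fi].
have Z (a : R) (u : T -> R) : mu.-integrable setT (EFin \o u) ->
    mu.-integrable setT (EFin \o (fun x => a * u x)).
  move=> iu; have := integrableZl measurableT a iu.
  by apply: eq_integrable => // x _ /=; rewrite EFinM.
apply: complex_eqP; rewrite ?ReM ?ImM /=.
- under eq_Rintegral do rewrite ReM.
  by rewrite RintegralB ?RintegralZl//; apply: Z.
- under eq_Rintegral do rewrite ImM.
  by rewrite RintegralD ?RintegralZl//; apply: Z.
Qed.

Lemma cintegralZr c f : cintegrable f ->
  cintegral mu (fun x => f x * c) = cintegral mu f * c.
Proof.
move=> If; rewrite mulrC -cintegralZ//; apply: cintegral_ext => x.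
by rewrite mulrC.
Qed.

Lemma cintegralJ f : cintegrable f ->
  cintegral mu (fun x => (f x)^*) = (cintegral mu f)^*.
Proof.
move=> [fr fi]; apply: complex_eqP; rewrite ?ReJ ?ImJ /=.
- by under eq_Rintegral do rewrite ReJ.
- under eq_Rintegral do rewrite ImJ -mulN1r.
  by rewrite RintegralZl// mulN1r.
Qed.

Lemma cintegralB f g : cintegrable f -> cintegrable g ->
  cintegral mu (fun x => f x - g x) = cintegral mu f - cintegral mu g.
Proof.
move=> If Ig; rewrite -mulN1r -cintegralZ// -cintegralD//.
  by apply: cintegral_ext => x; rewrite mulN1r.
exact: cintegrableZ.
Qed.

Lemma ae_eq_Re f g : f = g %[ae mu] ->
  (fun x => Re (f x)) = (fun x => Re (g x)) %[ae mu].
Proof. by apply: filterS => x /= h /h ->. Qed.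

Lemma ae_eq_Im f g : f = g %[ae mu] ->
  (fun x => Im (f x)) = (fun x => Im (g x)) %[ae mu].
Proof. by apply: filterS => x /= h /h ->. Qed.

Lemma ae_eq_cintegral f g : cmeasurable f -> cmeasurable g ->
  f = g %[ae mu] -> cintegral mu f = cintegral mu g.
Proof.
move=> [fr fi] [gr gi] fg; apply: complex_eqP => /=; congr fine.
- apply: ae_eq_integral => //; try exact/measurable_EFinP.
  by apply: filterS (ae_eq_Re fg) => x /= h /h ->.
- apply: ae_eq_integral => //; try exact/measurable_EFinP.
  by apply: filterS (ae_eq_Im fg) => x /= h /h ->.
Qed.

Lemma ae_eq_cM f g h : f = g %[ae mu] ->
  (fun x => h x * f x) = (fun x => h x * g x) %[ae mu].
Proof. by apply: filterS => x /= fg /fg ->. Qed.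

End ComplexIntegral.

Section ComplexIntegralProbability.
Context d (T : measurableType d) (R : realType) (mu : probability T R).
Implicit Types (f g : T -> R[i]).

Lemma cintegrable_bounded f : cmeasurable f -> cbounded f -> cintegrable mu f.
Proof.
move=> mf [M fM]; apply: (@cintegrable_dom _ _ _ _ _ (fun=> M)) => //.
exact: finite_measure_integrable_cst.
Qed.

Lemma cintegrable_cst (c : R[i]) : cintegrable mu (fun=> c).
Proof.
apply: cintegrable_bounded; first exact: cmeasurable_cst.
by exists (`|Re c| + `|Im c|) => x; rewrite lerDl lerDr !normr_ge0.
Qed.

Lemma cintegrable_sum (I : Type) (s : seq I) (F : I -> T -> R[i]) :
  (forall i, cintegrable mu (F i)) -> cintegrable mu (fun x => \sum_(i <- s) F i x).
Proof.
move=> mF; elim: s => [|i s IH].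
  by under eq_fun do rewrite big_nil; apply: cintegrable_cst.
by under eq_fun do rewrite big_cons; apply: cintegrableD.
Qed.

Lemma cintegral_sum (I : Type) (s : seq I) (F : I -> T -> R[i]) :
  (forall i, cintegrable mu (F i)) ->
  cintegral mu (fun x => \sum_(i <- s) F i x) = \sum_(i <- s) cintegral mu (F i).
Proof.
move=> mF; elim: s => [|i s IH].
  rewrite big_nil; under [X in cintegral mu X]eq_fun do rewrite big_nil.
  by rewrite /cintegral /= Rintegral_cst// mul0r.
rewrite big_cons -IH -cintegralD//; last exact: cintegrable_sum.
by apply: cintegral_ext => x; rewrite big_cons.
Qed.

Lemma cintegral_cst c : cintegral mu (fun=> c) = c.
Proof.
have mu1 : fine (mu setT) = 1 by rewrite probability_setT.
by apply: complex_eqP => /=; rewrite Rintegral_cst// mu1 mulr1.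
Qed.

End ComplexIntegralProbability.

(** * The inner product of L^2 and Bessel's inequality *)

Section SquareIntegrable.
Context d (T : measurableType d) (R : realType) (mu : probability T R).
Implicit Types (f g h : T -> R[i]).
Local Notation L2 := (square_integrable mu).

Lemma square_integrableP f : L2 f <-> cmeasurable f /\
  mu.-integrable setT (EFin \o (fun x => Re (f x) ^+ 2 + Im (f x) ^+ 2)).
Proof.
have nE x : `|Re (f x) ^+ 2 + Im (f x) ^+ 2| = Re (f x) ^+ 2 + Im (f x) ^+ 2.
  by rewrite ger0_norm// addr_ge0// sqr_ge0.
split=> [[fr fi foo]|[[fr fi] /integrableP[_ foo]]]; split => //.
- apply/integrableP; split.
    apply/measurable_EFinP; apply: measurable_funD; exact: measurable_funX.
  by under eq_integral do rewrite /= nE.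
- by move: foo; under [X in (X < _)%E -> _]eq_integral do rewrite /= nE.
Qed.

Lemma square_integrable_dom f (g : T -> R) : cmeasurable f ->
  mu.-integrable setT (EFin \o g) ->
  (forall x, Re (f x) ^+ 2 + Im (f x) ^+ 2 <= g x) -> L2 f.
Proof.
move=> mf ig fg; apply/square_integrableP; split => //.
apply: le_integrable ig => //.
  by case: mf => fr fi; apply/measurable_EFinP; apply: measurable_funD;
    exact: measurable_funX.
move=> x _ /=; rewrite lee_fin ger0_norm ?addr_ge0 ?sqr_ge0//.
exact: le_trans (ler_norm _).
Qed.

Lemma integrable_lin (a b : R) (u v : T -> R) :
  mu.-integrable setT (EFin \o u) -> mu.-integrable setT (EFin \o v) ->
  mu.-integrable setT (EFin \o (fun x => a * u x + b * v x)).
Proof.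
move=> iu iv.
have := integrableD measurableT (integrableZl measurableT a iu)
  (integrableZl measurableT b iv).
by apply: eq_integrable => // x _ /=; rewrite EFinD !EFinM.
Qed.

Lemma square_integrableM f g : L2 f -> L2 g -> cintegrable mu (fun x => f x * g x).
Proof.
move=> /square_integrableP[mf If] /square_integrableP[mg Ig].
apply: cintegrable_dom (integrable_lin 1 1 If Ig) _; first exact: cmeasurableM.
move=> x; rewrite !mul1r ReM ImM.
set a := Re _; set b := Re _; set c := Im _; set e := Im _.
(* These squares give 2 |u v| <= u^2 + v^2 for each part u of f and each part v of g. *)
have := sqr_ge0 (a - b); have := sqr_ge0 (a + b).
have := sqr_ge0 (c - e); have := sqr_ge0 (c + e).
have := sqr_ge0 (a - e); have := sqr_ge0 (a + e).
have := sqr_ge0 (c - b); have := sqr_ge0 (c + b).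
by move=> *; rewrite !ler_norml; split; apply/andP; split; nra.
Qed.

Lemma square_integrable_bounded f : cmeasurable f -> cbounded f -> L2 f.
Proof.
move=> mf [M fM]; apply: (@square_integrable_dom _ (fun=> M ^+ 2 + M ^+ 2)) => //.
  exact: finite_measure_integrable_cst.
by move=> x; have [r i] := fM x; rewrite lerD// -[leLHS]real_normK ?num_real//;
  rewrite ler_sqr// nnegrE ?(le_trans _ r).
Qed.

Lemma square_integrable_integrable f : L2 f -> cintegrable mu f.
Proof.
move=> f2; have := square_integrableM f2 (square_integrable_bounded
  (cmeasurable_cst _ 1) (cbounded_cst _ 1)).
by under eq_fun do rewrite mulr1.
Qed.

Lemma square_integrableD f g : L2 f -> L2 g -> L2 (fun x => f x + g x).
Proof.
move=> /square_integrableP[mf If] /square_integrableP[mg Ig].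
apply: square_integrable_dom (integrable_lin 2 2 If Ig) _.
  exact: cmeasurableD.
move=> x; rewrite ReD ImD.
have := sqr_ge0 (Re (f x) - Re (g x)); have := sqr_ge0 (Im (f x) - Im (g x)).
nra.
Qed.

Lemma square_integrableMb f g : cmeasurable g -> cbounded g -> L2 f ->
  L2 (fun x => g x * f x).
Proof.
move=> mg [M gM] /square_integrableP[mf If].
apply: square_integrable_dom (integrable_lin (2 * M ^+ 2) 0 If If) _.
  exact: cmeasurableM.
move=> x; rewrite mul0r addr0 ReM ImM; have [r i] := gM x.
have M0 : 0 <= M by rewrite (le_trans _ r).
have r2 : Re (g x) ^+ 2 <= M ^+ 2.
  by rewrite -[leLHS]real_normK ?num_real// ler_sqr.
have i2 : Im (g x) ^+ 2 <= M ^+ 2.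
  by rewrite -[leLHS]real_normK ?num_real// ler_sqr.
have -> : (Re (g x) * Re (f x) - Im (g x) * Im (f x)) ^+ 2 +
   (Re (g x) * Im (f x) + Im (g x) * Re (f x)) ^+ 2 =
   (Re (g x) ^+ 2 + Im (g x) ^+ 2) * (Re (f x) ^+ 2 + Im (f x) ^+ 2) by ring.
by apply: ler_wpM2r; [rewrite addr_ge0 ?sqr_ge0|rewrite mulrDl mul1r lerD].
Qed.

Lemma square_integrable_cst c : L2 (fun=> c).
Proof.
by apply: square_integrable_bounded; [apply: cmeasurable_cst|apply: cbounded_cst].
Qed.

Lemma square_integrableZ c f : L2 f -> L2 (fun x => c * f x).
Proof.
move=> f2; apply: (@square_integrableMb f (fun=> c)) => //.
exact: cbounded_cst.
Qed.

Lemma square_integrableB f g : L2 f -> L2 g -> L2 (fun x => f x - g x).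
Proof.
move=> f2 g2; have := square_integrableD f2 (square_integrableZ (-1) g2).
by under eq_fun do rewrite mulN1r.
Qed.

Lemma square_integrable_sum (I : Type) (s : seq I) (F : I -> T -> R[i]) :
  (forall i, L2 (F i)) -> L2 (fun x => \sum_(i <- s) F i x).
Proof.
move=> mF; elim: s => [|i s IH].
  by under eq_fun do rewrite big_nil; apply: square_integrable_cst.
by under eq_fun do rewrite big_cons; apply: square_integrableD.
Qed.

Lemma square_integrableJ f : L2 f -> L2 (fun x => (f x)^*).
Proof.
move=> /square_integrableP[mf If].
apply: square_integrable_dom If _; first exact: cmeasurableJ.
by move=> x; rewrite ReJ ImJ sqrrN.
Qed.

Definition ip f g := cintegral mu (fun x => f x * (g x)^*).

Lemma ip_integrable f g : L2 f -> L2 g -> cintegrable mu (fun x => f x * (g x)^*).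
Proof. by move=> f2 g2; apply: square_integrableM => //; apply: square_integrableJ. Qed.

Lemma ip_conj f g : L2 f -> L2 g -> (ip f g)^* = ip g f.
Proof.
move=> f2 g2; rewrite -cintegralJ; last exact: ip_integrable.
by apply: cintegral_ext => x; rewrite rmorphM /= conjCK mulrC.
Qed.

Lemma ipDl f g h : L2 f -> L2 g -> L2 h ->
  ip (fun x => f x + g x) h = ip f h + ip g h.
Proof.
move=> f2 g2 h2; rewrite -cintegralD; try exact: ip_integrable.
by apply: cintegral_ext => x; rewrite mulrDl.
Qed.

Lemma ipZl c f h : L2 f -> L2 h -> ip (fun x => c * f x) h = c * ip f h.
Proof.
move=> f2 h2; rewrite -cintegralZ; last exact: ip_integrable.
by apply: cintegral_ext => x; rewrite mulrA.
Qed.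

Lemma ipBl f g h : L2 f -> L2 g -> L2 h ->
  ip (fun x => f x - g x) h = ip f h - ip g h.
Proof.
move=> f2 g2 h2; rewrite -cintegralB; try exact: ip_integrable.
by apply: cintegral_ext => x; rewrite mulrBl.
Qed.

Lemma ipZr c f h : L2 f -> L2 h -> ip f (fun x => c * h x) = c^* * ip f h.
Proof.
move=> f2 h2; rewrite -ip_conj ?ipZl ?rmorphM /= ?ip_conj//.
exact: square_integrableZ.
Qed.

Lemma ipBr f g h : L2 f -> L2 g -> L2 h ->
  ip h (fun x => f x - g x) = ip h f - ip h g.
Proof.
move=> f2 g2 h2; rewrite -ip_conj ?ipBl ?rmorphB /= ?ip_conj//.
exact: square_integrableB.
Qed.

Lemma ip_suml (I : Type) (s : seq I) (F : I -> T -> R[i]) h :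
  (forall i, L2 (F i)) -> L2 h ->
  ip (fun x => \sum_(i <- s) F i x) h = \sum_(i <- s) ip (F i) h.
Proof.
move=> F2 h2; rewrite -cintegral_sum => [|i]; last exact: ip_integrable.
by apply: cintegral_ext => x; rewrite mulr_suml.
Qed.

Lemma ip_sumr (I : Type) (s : seq I) (F : I -> T -> R[i]) h :
  (forall i, L2 (F i)) -> L2 h ->
  ip h (fun x => \sum_(i <- s) F i x) = \sum_(i <- s) ip h (F i).
Proof.
move=> F2 h2; rewrite -ip_conj ?ip_suml ?rmorph_sum /=//.
  by apply: eq_bigr => i _; rewrite ip_conj.
exact: square_integrable_sum.
Qed.

Lemma ipE f :
  ip f f = (\int[mu]_x (Re (f x) ^+ 2 + Im (f x) ^+ 2))%:C%C.
Proof.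
rewrite /ip; under cintegral_ext do rewrite mulcJE.
by apply: complex_eqP => //=; rewrite Rintegral_cst ?mul0r.
Qed.

Lemma ip_ge0 f : 0 <= ip f f.
Proof.
by rewrite ipE ler0c; apply: Rintegral_ge0 => x _; rewrite addr_ge0 ?sqr_ge0.
Qed.

Lemma ip_eq0 f : L2 f -> ip f f = 0 -> f = (fun=> 0) %[ae mu].
Proof.
move=> /square_integrableP[mf If]; rewrite ipE => -[] I0.
have : (\int[mu]_x `|(EFin \o (fun x => Re (f x) ^+ 2 + Im (f x) ^+ 2)%R) x| = 0)%E.
  under eq_integral => x _.
    rewrite /= ger0_norm ?addr_ge0 ?sqr_ge0//; over.
  rewrite -[LHS]fineK; first by rewrite [fine _]I0.
  by apply: integrable_fin_num.
move/(ae_eq_integral_abs mu measurableT (measurable_int mu If)).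
apply: filterS => x /= /(_ I) [] /eqP.
rewrite paddr_eq0 ?sqr_ge0// !sqrf_eq0 => /andP[/eqP fr /eqP fi] _.
exact: complex_eqP.
Qed.

Lemma ip_ae f g f' g' : L2 f -> L2 g -> L2 f' -> L2 g' ->
  f = f' %[ae mu] -> g = g' %[ae mu] -> ip f g = ip f' g'.
Proof.
move=> f2 g2 f2' g2' ff' gg'; apply: ae_eq_cintegral.
- by apply: (@cintegrable_measurable _ _ _ mu); apply: ip_integrable.
- by apply: (@cintegrable_measurable _ _ _ mu); apply: ip_integrable.
by apply: filterS2 ff' gg' => x /= h1 h2 t; rewrite (h1 t) (h2 t).
Qed.

(* Bessel, from the norm of f - \sum_i <f, u_i> u_i *)
Lemma bessel (I : finType) (u : I -> T -> R[i]) f : (forall i, L2 (u i)) ->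
  L2 f -> (forall i j, ip (u i) (u j) = (i == j)%:R) ->
  \sum_i `|ip f (u i)| ^+ 2 <= ip f f.
Proof.
move=> u2 f2 uu.
pose p x := \sum_i ip f (u i) * u i x.
have pu2 i : L2 (fun x => ip f (u i) * u i x) by apply: square_integrableZ.
have p2 : L2 p by apply: square_integrable_sum.
have fp : ip f p = \sum_i `|ip f (u i)| ^+ 2.
  rewrite /p ip_sumr//; apply: eq_bigr => i _.
  by rewrite ipZr// mulrC normCK.
have pp : ip p p = \sum_i `|ip f (u i)| ^+ 2.
  rewrite {1}/p ip_suml//; apply: eq_bigr => i _.
  rewrite ipZl// /p ip_sumr// (bigD1 i)//= big1 ?addr0 => [|j ji].
    by rewrite ipZr// uu eqxx mulr1 normCK.
  by rewrite ipZr// uu eq_sym (negbTE ji) mulr0.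
have pf : ip p f = \sum_i `|ip f (u i)| ^+ 2.
  rewrite -ip_conj// fp rmorph_sum; apply: eq_bigr => i _.
  by rewrite /= conj_Creal// realE exprn_ge0.
have := ip_ge0 (fun x => f x - p x).
rewrite ipBl//; last exact: square_integrableB.
by rewrite !ipBr// fp pf pp subrr subr0 subr_ge0.
Qed.

(** Bessel's inequality for the one-element family g / |g|. If g has norm 0 it is null, and both
    sides vanish. *)
Lemma cauchy_schwarz f g : L2 f -> L2 g ->
  `|ip f g| ^+ 2 <= ip f f * ip g g.
Proof.
move=> f2 g2.
have [g0|gn0] := eqVneq (ip g g) 0.
  have -> : ip f g = 0.
    rewrite /ip -[RHS](cintegral_cst mu); apply: ae_eq_cintegral.
    - by apply: (@cintegrable_measurable _ _ _ mu); apply: ip_integrable.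
    - exact: cmeasurable_cst.
    by apply: filterS (ip_eq0 g2 g0) => x /= h t; rewrite h// conjC0 mulr0.
  by rewrite normr0 expr0n /= mulr_ge0 ?ip_ge0.
pose c := sqrtC (ip g g).
have c2 : c ^+ 2 = ip g g by rewrite sqrtCK.
have cn0 : c != 0 by rewrite sqrtC_eq0.
have c0 : 0 <= c by rewrite sqrtC_ge0 ip_ge0.
have cJ : (c^-1)^* = c^-1 by rewrite conj_Creal// realE invr_ge0 c0.
pose u (i : 'I_1) x := c^-1 * g x.
have u2 i : L2 (u i) by apply: square_integrableZ.
have uu i j : ip (u i) (u j) = (i == j)%:R.
  rewrite !ord1 /u ipZl ?ipZr//; last exact: square_integrableZ.
  by rewrite cJ mulrA -invfM -expr2 c2 mulVf.
have := bessel u2 f2 uu.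
rewrite big_ord1 /u ipZr// cJ normrM exprMn ger0_norm ?invr_ge0//.
by rewrite exprVn c2 ler_pdivrMl ?lt_def ?gn0 ?ip_ge0// mulrC.
Qed.

End SquareIntegrable.

(** * Fubini's theorem for finite-valued integrals and measure-preserving maps *)

Section Fubini.
Context d (T : measurableType d) (R : realType) (mu : probability T R).

(** The inner extended integrals are finite only almost everywhere; elsewhere [fine] replaces them
    by 0, which affects neither integrability nor the outer integral. *)
Lemma Rintegral_fubini (k : T * T -> R) :
  (mu \x mu)%E.-integrable setT (EFin \o k) ->
  [/\ mu.-integrable setT (EFin \o (fun x => \int[mu]_y k (x, y))),
      mu.-integrable setT (EFin \o (fun y => \int[mu]_x k (x, y))) &
      \int[mu]_x \int[mu]_y k (x, y) = \int[mu]_y \int[mu]_x k (x, y)].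
Proof.
move=> ik.
have fin (F : T -> \bar R) : mu.-integrable setT F ->
    mu.-integrable setT (EFin \o fine \o F) /\
    (\int[mu]_x (fine (F x))%:E = \int[mu]_x F x)%E.
  move=> iF; have mF := measurable_int mu iF.
  have mfF : measurable_fun setT (EFin \o fine \o F).
    by apply/measurable_EFinP/measurableT_comp => //; exact: measurable_fine.
  split.
    apply: le_integrable iF => //= x _; case: (F x) => //= *; exact: leey.
  apply: ae_eq_integral => //.
  by apply: filterS (integrable_ae measurableT iF) => x /= h t; rewrite fineK ?h.
have [i1 e1] := fin _ (integrable_fubini_F ik).
(* Integrability of the other inner integral comes from exchanging the two coordinates. *)
have /fin[i2 e2] : mu.-integrable setT (fubini_G mu (EFin \o k)).
  have ik' : (mu \x mu)%E.-integrable setT (EFin \o (k \o (fun z : T * T => (z.2, z.1)))).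
    have mk : measurable_fun setT (EFin \o (k \o (fun z : T * T => (z.2, z.1)))).
      have /measurable_EFinP mk := measurable_int _ ik.
      apply/measurable_EFinP; apply: measurableT_comp => //.
      by apply: measurable_fun_pair => /=.
    by apply/(integrable12ltyP _ _ mk); apply/(integrable21ltyP _ _ (measurable_int _ ik)).
  exact: integrable_fubini_F ik'.
split => //; congr fine.
by rewrite [LHS]e1 [RHS]e2; exact: Fubini.
Qed.

Lemma cfubini (k : T * T -> R[i]) : cintegrable (mu \x mu)%E k ->
  [/\ cintegrable mu (fun x => cintegral mu (fun y => k (x, y))),
      cintegrable mu (fun y => cintegral mu (fun x => k (x, y))) &
  cintegral mu (fun x => cintegral mu (fun y => k (x, y))) =
  cintegral mu (fun y => cintegral mu (fun x => k (x, y)))].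
Proof.
move=> [/Rintegral_fubini[r1 r2 r3] /Rintegral_fubini[i1 i2 i3]].
by split => //; apply: complex_eqP.
Qed.

Lemma cintegrable_prod_dom (k : T * T -> R[i]) (u : T * T -> R) :
  cmeasurable k -> measurable_fun setT u ->
  (forall z, `|Re (k z)| <= u z /\ `|Im (k z)| <= u z) ->
  (\int[mu]_y \int[mu]_x (u (x, y))%:E < +oo)%E -> cintegrable (mu \x mu)%E k.
Proof.
move=> mk mu' ku uoo; apply: (cintegrable_dom mk _ ku).
apply/integrable21ltyP; first exact/measurable_EFinP.
apply: le_lt_trans uoo.
rewrite le_eqVlt; apply/orP; left; apply/eqP.
apply: eq_integral => y _; apply: eq_integral => x _ /=.
by rewrite ger0_norm// (le_trans _ (ku (x, y)).1).
Qed.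

Definition preserving (phi : T -> T) := measurable_fun setT phi /\
  forall A, measurable A -> mu (phi @^-1` A) = mu A.

Lemma preserving_comp (phi psi : T -> T) :
  preserving phi -> preserving psi -> preserving (phi \o psi).
Proof.
move=> [mp pp] [mq pq]; split; first exact: measurableT_comp.
move=> A mA; rewrite comp_preimage pq ?pp//.
by rewrite -[_ @^-1` _]setTI; apply: mp.
Qed.

Lemma preserving_ge0_integral phi (f : T -> \bar R) : preserving phi ->
  measurable_fun setT f -> (forall x, 0 <= f x)%E ->
  (\int[mu]_x f (phi x) = \int[mu]_x f x)%E.
Proof.
move=> [mp pp] mf f0.
have := @ge0_integral_pushforward _ _ _ _ _ phi mp mu setT f measurableT mf
  (fun x _ => f0 x).
rewrite preimage_setT => <-; apply: eq_measure_integral => A mA _.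
exact: pp.
Qed.

Lemma preserving_integrable phi (f : T -> \bar R) : preserving phi ->
  mu.-integrable setT f -> mu.-integrable setT (f \o phi).
Proof.
move=> pphi /integrableP[mf foo]; apply/integrableP; split.
  by apply: measurableT_comp => //; case: pphi.
rewrite (preserving_ge0_integral (f := abse \o f) pphi)//.
  exact: measurableT_comp.
by move=> x /=.
Qed.

Lemma preserving_integral phi (f : T -> \bar R) : preserving phi ->
  mu.-integrable setT f -> (\int[mu]_x f (phi x) = \int[mu]_x f x)%E.
Proof.
move=> pphi /integrableP[mf _]; rewrite integralE [RHS]integralE.
have -> : ((fun x => f (phi x))^\+ = f^\+ \o phi)%E by apply/funext => x; rewrite -funepos_comp.
have -> : ((fun x => f (phi x))^\- = f^\- \o phi)%E by apply/funext => x; rewrite -funeneg_comp.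
rewrite (preserving_ge0_integral (f := f^\+%E) pphi)//; last exact: measurable_funepos.
by rewrite (preserving_ge0_integral (f := f^\-%E) pphi)//; exact: measurable_funeneg.
Qed.

Lemma cmeasurable_comp d' (T' : measurableType d') (phi : T' -> T)
    (f : T -> R[i]) : measurable_fun setT phi ->
  cmeasurable f -> cmeasurable (fun x => f (phi x)).
Proof.
by move=> mp [fr fi]; split; [apply: (measurableT_comp fr)|apply: (measurableT_comp fi)].
Qed.

Lemma preserving_cintegrable phi (f : T -> R[i]) : preserving phi ->
  cintegrable mu f -> cintegrable mu (fun x => f (phi x)).
Proof.
by move=> pphi [fr fi]; split;
  [exact: (preserving_integrable pphi fr)|exact: (preserving_integrable pphi fi)].
Qed.

Lemma preserving_cintegral phi (f : T -> R[i]) : preserving phi ->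
  cintegrable mu f -> cintegral mu (fun x => f (phi x)) = cintegral mu f.
Proof.
move=> pphi [fr fi]; apply: complex_eqP; congr fine.
- exact: (preserving_integral pphi fr).
- exact: (preserving_integral pphi fi).
Qed.

Lemma preserving_square_integrable phi (f : T -> R[i]) : preserving phi ->
  square_integrable mu f -> square_integrable mu (fun x => f (phi x)).
Proof.
move=> pphi /square_integrableP[mf If]; apply/square_integrableP; split.
  by apply: cmeasurable_comp => //; case: pphi.
exact: (preserving_integrable pphi If).
Qed.

End Fubini.

(** * Haar measure *)

(** An injection of D into nat has fibres of at most one element, so the union becomes one over nat
    of sets that are empty or some F i. *)
Lemma countable_bigcup_measurable d (T : measurableType d) (I : Type)
    (D : set I) (F : I -> set T) : countable D ->
  (forall i, D i -> measurable (F i)) -> measurable (\bigcup_(i in D) F i).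
Proof.
move=> /pcard_leP[f] mF.
pose E n := \bigcup_(i in [set i | D i /\ f i = n]) F i.
have -> : \bigcup_(i in D) F i = \bigcup_n E n.
  apply/seteqP; split=> [x [i Di Fix]|x [n _ [i [Di _] Fix]]]; last by exists i.
  by exists (f i) => //; exists i.
apply: bigcupT_measurable => n.
have [[i [Di fin]]|nE] := pselect (exists i, D i /\ f i = n); last first.
  rewrite (_ : E n = set0)//; apply/seteqP; split=> // x [i Di _].
  by apply: nE; exists i.
rewrite (_ : E n = F i); first exact: mF.
apply/seteqP; split=> [x [j [Dj fj]]|x Fx]; last by exists i.
rewrite (_ : j = i)//; apply: (@inj _ _ _ f); [exact/mem_set|exact/mem_set|].
exact: (etrans fj (esym fin)).
Qed.

Section BorelTopology.
Context {R : realType} {G : topologicalGroupType}.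

Lemma open_borel_measurable (A : set G) :
  open A -> measurable (A : set (borel G)).
Proof. by move=> oA; apply: sub_sigma_algebra. Qed.

Lemma continuous_borel_measurable d (T : measurableType d) (phi : T -> G) :
  (forall A, open A -> measurable (phi @^-1` A)) ->
  measurable_fun setT (phi : T -> borel G).
Proof.
move=> op; apply: (@measurability _ _ T (borel G) setT phi (@open G) erefl).
by move=> _ [A oA <-]; rewrite setTI; apply: op.
Qed.

Lemma continuous_mulg_comp (T : topologicalType) (f g : T -> G) :
  continuous f -> continuous g -> continuous (fun x => (f x * g x)%g).
Proof.
move=> cf cg x.
have h : (fun x => (f x, g x)) @ x --> (f x, g x) by apply: cvg_pair; [exact: cf|exact: cg].
exact: (continuous_comp h (mulg_continuous _)).
Qed.

Lemma continuous_invg_comp (T : topologicalType) (f : T -> G) :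
  continuous f -> continuous (fun x => (f x)^-1%g).
Proof. by move=> cf x; apply: continuous_comp (cf x) (invg_continuous _). Qed.

Lemma continuous_measurable_borel (phi : G -> G) : continuous phi ->
  measurable_fun setT (phi : borel G -> borel G).
Proof.
move=> cphi; apply: continuous_borel_measurable => A oA.
by apply: open_borel_measurable; apply: open_comp => // x _; exact: cphi.
Qed.

Lemma continuous_measurable_real (f : G -> R) : continuous f ->
  measurable_fun setT (f : borel G -> R).
Proof.
move=> cf; apply: (@measurability _ _ (borel G) _ setT f _ (RGenOpens.measurableE R)).
move=> _ [A [a [b ->]] <-]; rewrite setTI.
apply: open_borel_measurable; apply: open_comp; last exact: interval_open.
by move=> x _; exact: cf.
Qed.

(** An open set of the product is a union of rectangles of basic open sets, and a countable base
    allows only countably many of these. Without such a base the product sigma-algebra can miss open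
    sets. *)
Lemma open_prod_measurable (W : set (G * G)) : @second_countable G -> open W ->
  measurable (W : set (borel G * borel G)%type).
Proof.
move=> [B cB [Bo Bb]] oW.
have -> : W = \bigcup_(UV in [set UV : set G * set G | [/\ B UV.1, B UV.2 &
    UV.1 `*` UV.2 `<=` W]]) (UV.1 `*` UV.2).
  apply/seteqP; split=> [[x y] Wxy|z [UV /= [_ _ UVW] /UVW]//].
  have : nbhs (x, y) W by apply: open_nbhs_nbhs.
  move=> [[U V]] /= [/Bb[U' [BU' U'x] U'U] /Bb[V' [BV' V'y] V'V]] UVW.
  by exists (U', V') => //; split => //= -[a b] /= [/U'U ? /V'V ?]; apply: UVW.
apply: countable_bigcup_measurable => [|[U V] /= [BU BV _]].
  apply: (@sub_countable _ _ _ (B `*` B)); last exact: countableX.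
  by apply: subset_card_le => -[U V] /= [].
by apply: measurableX; apply: open_borel_measurable; apply: Bo.
Qed.

Lemma continuous_measurable_prod (phi : G * G -> G) : @second_countable G ->
  continuous phi ->
  measurable_fun setT (phi : (borel G * borel G)%type -> borel G).
Proof.
move=> sndG cphi; apply: continuous_borel_measurable => A oA.
by apply: open_prod_measurable => //; apply: open_comp => // x _; exact: cphi.
Qed.

End BorelTopology.

Section Haar.
Context (R : realType) (G : topologicalGroupType) (mu : probability (borel G) R).
Hypotheses (sndG : @second_countable G) (haar_mu : is_haar mu).

Lemma preserving_mulgl (x : G) : preserving mu (fun y => (x * y)%g).
Proof.
have m z : measurable_fun setT ((fun y => (z * y)%g) : borel G -> borel G).
  by apply: continuous_measurable_borel; apply: continuous_mulg_comp => // y;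
    [exact: cvg_cst|exact: cvg_id].
split=> // A mA; rewrite -[RHS](haar_mu (x^-1)%g mA); congr (mu _).
apply/seteqP; split=> [y Axy|_ [y Ay <-]] /=.
  by exists (x * y)%g => //; rewrite mulKg.
by rewrite mulVKg.
Qed.

Lemma measurable_invg : measurable_fun setT ((fun y => y^-1%g) : borel G -> borel G).
Proof. by apply: continuous_measurable_borel; exact: invg_continuous. Qed.

(* Tonelli for 1_A(x^-1 y): integrating over y first gives mu A, integrating   *)
(* over x first gives mu (A^-1).                                              *)
Lemma preserving_invg : preserving mu (fun y => y^-1%g).
Proof.
split; first exact: measurable_invg.
move=> A mA.
pose phi (z : G * G) := (z.1^-1 * z.2)%g.
have mphi : measurable_fun setT (phi : (borel G * borel G)%type -> borel G).
  apply: continuous_measurable_prod => //; apply: continuous_mulg_comp.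
    by apply: continuous_invg_comp => z; exact: cvg_fst.
  by move=> z; exact: cvg_snd.
pose k (z : borel G * borel G) := (\1_A (phi z : borel G))%:E : \bar R.
have mk : measurable_fun setT k.
  apply/measurable_EFinP.
  by apply: (measurableT_comp (f := \1_A : borel G -> R) _ mphi); exact: measurable_indic.
have k0 z : (0 <= k z)%E by rewrite lee_fin.
have := fubini_tonelli (m1 := mu) (m2 := mu) k mk k0.
have -> : (\int[mu]_x \int[mu]_y k (x, y) = mu A)%E.
  under eq_integral => x _.
    rewrite /k /phi /= (preserving_ge0_integral (preserving_mulgl (x^-1)%g)
       (f := fun y => (\1_A y)%:E))//; last first.
      by apply/measurable_EFinP; exact: measurable_indic.
    rewrite integral_indic// setIT; over.
  by rewrite integral_cst// [X in (_ * X)%E]probability_setT mule1.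
pose B : set (borel G) := (fun y : G => (y^-1)%g) @^-1` A.
have mB : measurable B by rewrite -[B]setTI; apply: measurable_invg.
have inner (y : borel G) : (\int[mu]_x k (x, y) = mu B)%E.
  transitivity (\int[mu]_x (\1_B x)%:E)%E; last by rewrite integral_indic ?setIT.
  rewrite -(preserving_ge0_integral (preserving_mulgl (y^-1)%g)
     (f := fun u => (\1_B u)%:E))//; last first.
    by apply/measurable_EFinP; exact: measurable_indic.
  apply: eq_integral => x _; rewrite /k /phi /= !indicE; congr (_%:R%:E).
  apply: congr1; rewrite -[RHS]asboolb -[LHS]asboolb; apply: asbool_equiv_eq.
  by rewrite !in_setE /B /= invgM invgK.
under [X in _ = X -> _]eq_integral do rewrite inner.
by rewrite integral_cst// [X in (_ * X)%E]probability_setT mule1.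
Qed.

(** Inversion conjugates left translations into right ones. *)
Lemma preserving_mulgr (x : G) : preserving mu (fun y => (y * x)%g).
Proof.
have := preserving_comp preserving_invg
  (preserving_comp (preserving_mulgl (x^-1)%g) preserving_invg).
by congr preserving; apply/funext => y /=; rewrite invgM !invgK.
Qed.

End Haar.

(** * Continuity of integrals that depend on a parameter *)

Section ParametricIntegral.
Context (R : realType) (G : topologicalGroupType) (mu : probability (borel G) R).
Hypothesis compactG : compact [set: G].

(** Tube lemma: by compactness in y, the neighbourhoods of x0 given by continuity at each (x0, y)
    can be replaced by a single one. *)
Lemma compact_near_uniform (k : G * G -> R) (x0 : G) (e : R) :
  continuous k -> 0 < e ->
  \forall x \near x0, forall y, `|k (x, y) - k (x0, y)| <= e.
Proof.
move=> ck e0.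
have e2 : 0 < e / 2 by rewrite divr_gt0.
have := (compact_near_coveringP [set: G]).1 compactG _ _
  (fun x y => `|k (x, y) - k (x0, y)| <= e) (nbhs_filter x0) _.
have hy : forall y : G, [set: G] y -> \forall y' \near y & x \near x0,
    `|k (x, y') - k (x0, y')| <= e.
  move=> y _.
  have /cvgrPdist_lt /(_ _ e2) [[A B] /= [x0A yB] AB] := ck (x0, y).
  exists (B, A) => // -[y' x] /= [By' Ax].
  have := AB (x, y') (conj Ax By'); have := AB (x0, y') (conj (nbhs_singleton x0A) By').
  move=> /= h1 h2; rewrite -(subrKA (k (x0, y))).
  rewrite (le_trans (ler_normD _ _))// [e]splitr lerD// ?(ltW h1)//.
  by rewrite distrC ltW.
by move=> /(_ hy); apply: filterS => x h y; apply: h.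
Qed.

Lemma integrable_continuousM (h : G -> R) (b : borel G -> R) : continuous h ->
  mu.-integrable setT (EFin \o b) ->
  mu.-integrable setT (EFin \o (fun y : borel G => h y * b y)).
Proof.
move=> ch ib; have nb := integrable_norm ib.
have /compact_bounded[N [_ hN]] : compact (h @` [set: G]).
  by apply: continuous_compact => //; apply: continuous_subspaceT.
have iz := integrableZl measurableT (`|N| + 1) nb.
apply: le_integrable iz => //.
  apply/measurable_EFinP; apply: measurable_funM.
    exact: continuous_measurable_real.
  by apply/measurable_EFinP; exact: measurable_int ib.
move=> y _ /=; rewrite lee_fin !normrM normr_id ler_wpM2r//.
rewrite [leRHS]ger0_norm ?addr_ge0//; apply: hN; last by exists y.
by rewrite (le_lt_trans (ler_norm _))// ltrDl.
Qed.

Lemma continuous_Rintegral (k : G * G -> R) (b : borel G -> R) : continuous k ->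
  mu.-integrable setT (EFin \o b) ->
  continuous (fun x : G => \int[mu]_y (k (x, y) * b y)).
Proof.
move=> ck ib x0; apply/cvgrPdist_le => e e0.
(* The added 1 keeps M positive when b is null. *)
pose M := \int[mu]_y `|b y| + 1.
have nb : mu.-integrable setT (EFin \o (fun y => `|b y|)).
  exact: integrable_norm.
have M0 : 0 < M by rewrite ltr_pwDr//; apply: Rintegral_ge0.
have eM : 0 < e / M by rewrite divr_gt0.
have iz c : mu.-integrable setT (EFin \o (fun y => c * `|b y|)).
  by have := integrableZl measurableT c nb;
     apply: eq_integrable => // y _ /=; rewrite EFinM.
have ckx x : continuous (fun y => k (x, y)).
  move=> y; apply: (continuous_comp (f := fun y => (x, y)) _ (ck _)).
  by apply: cvg_pair; [exact: cvg_cst|exact: cvg_id].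
have ik x := integrable_continuousM (ckx x) ib.
have ikB x : mu.-integrable setT
    (EFin \o (fun y => k (x0, y) * b y - k (x, y) * b y)).
  have := integrableB measurableT (ik x0) (ik x).
  by apply: eq_integrable => // y _ /=; rewrite EFinB.
apply: filterS (compact_near_uniform x0 ck eM) => x hx.
rewrite -RintegralB// (le_trans (le_normr_Rintegral _ _))//.
apply: (@le_trans _ _ (\int[mu]_y (e / M * `|b y|))).
  apply: le_Rintegral => //.
    exact: (integrable_norm (ikB x)).
  by move=> y _; rewrite -mulrBl normrM ler_wpM2r// distrC.
rewrite RintegralZl//; apply: (@le_trans _ _ (e / M * M)).
  by rewrite ler_wpM2l ?(ltW eM)// lerDl.
by rewrite divfK ?gt_eqF.
Qed.

End ParametricIntegral.

Section Continuity.
Context (R : realType) (G : topologicalGroupType).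

(** Stated on the parts because the integrals are computed on them; [ccontinuous_mxP] relates it to
    the topology of the modulus. *)
Definition ccontinuous (T : topologicalType) (f : T -> R[i]) :=
  continuous (fun x => Re (f x)) /\ continuous (fun x => Im (f x)).

Lemma ccontinuous_measurable (f : G -> R[i]) : ccontinuous f ->
  cmeasurable (f : borel G -> R[i]).
Proof. by move=> [fr fi]; split; apply: continuous_measurable_real. Qed.

Lemma ccontinuous_bounded (f : G -> R[i]) : compact [set: G] ->
  ccontinuous f -> cbounded f.
Proof.
move=> cG [fr fi].
have bd (g : G -> R) : continuous g -> exists M, forall x, `|g x| <= M.
  move=> cg; have /compact_bounded[N [_ hN]] : compact (g @` [set: G]).
    by apply: continuous_compact => //; apply: continuous_subspaceT.
  exists (`|N| + 1) => x; apply: hN; last by exists x.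
  by rewrite (le_lt_trans (ler_norm _))// ltrDl.
have [M hM] := bd _ fr; have [N hN] := bd _ fi.
exists (Num.max M N) => x; rewrite !le_max hM hN; split => //.
by rewrite orbT.
Qed.

Lemma ccontinuous_cst (T : topologicalType) (c : R[i]) :
  ccontinuous (fun _ : T => c).
Proof. by split=> x; exact: cvg_cst. Qed.

Lemma ccontinuousD (T : topologicalType) (f g : T -> R[i]) :
  ccontinuous f -> ccontinuous g -> ccontinuous (fun x => f x + g x).
Proof.
move=> [fr fi] [gr gi]; split=> x.
- by under eq_fun do rewrite ReD; apply: cvgD; [exact: fr|exact: gr].
- by under eq_fun do rewrite ImD; apply: cvgD; [exact: fi|exact: gi].
Qed.

Lemma ccontinuousM (T : topologicalType) (f g : T -> R[i]) :
  ccontinuous f -> ccontinuous g -> ccontinuous (fun x => f x * g x).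
Proof.
move=> [fr fi] [gr gi]; split=> x.
- under eq_fun do rewrite ReM.
  by apply: cvgB; apply: cvgM; [exact: fr|exact: gr|exact: fi|exact: gi].
- under eq_fun do rewrite ImM.
  by apply: cvgD; apply: cvgM; [exact: fr|exact: gi|exact: fi|exact: gr].
Qed.

Lemma ccontinuousZ (T : topologicalType) c (f : T -> R[i]) :
  ccontinuous f -> ccontinuous (fun x => c * f x).
Proof. by apply: ccontinuousM; apply: ccontinuous_cst. Qed.

Lemma ccontinuous_sum (T : topologicalType) (I : Type) (s : seq I)
    (F : I -> T -> R[i]) :
  (forall i, ccontinuous (F i)) -> ccontinuous (fun x => \sum_(i <- s) F i x).
Proof.
move=> cF; elim: s => [|i s IH].
  by under eq_fun do rewrite big_nil; apply: ccontinuous_cst.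
by under eq_fun do rewrite big_cons; apply: ccontinuousD.
Qed.

Lemma ccontinuous_comp (S T : topologicalType) (phi : S -> T) (f : T -> R[i]) :
  continuous phi -> ccontinuous f -> ccontinuous (fun x => f (phi x)).
Proof.
by move=> cphi [fr fi]; split=> x;
  [exact: (continuous_comp (cphi x) (fr _))|exact: (continuous_comp (cphi x) (fi _))].
Qed.

Lemma ccontinuous_integral (mu : probability (borel G) R) (k : G * G -> R[i])
    (b : borel G -> R[i]) : compact [set: G] ->
  ccontinuous k -> cintegrable mu b ->
  ccontinuous (fun x : G => cintegral mu (fun y => k (x, y) * b y)).
Proof.
move=> cG [kr ki] [br bi].
have sec (u : G * G -> R) x : continuous u -> continuous (fun y => u (x, y)).
  move=> cu y; apply: (continuous_comp (f := fun y => (x, y)) _ (cu _)).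
  by apply: cvg_pair; [exact: cvg_cst|exact: cvg_id].
have int (u : G * G -> R) p x : continuous u -> mu.-integrable setT (EFin \o p) ->
    mu.-integrable setT (EFin \o (fun y => u (x, y) * p y)).
  by move=> cu ip; apply: integrable_continuousM => //; apply: sec.
split=> x /=.
- rewrite (_ : (fun x => _) = (fun x => \int[mu]_y (Re (k (x, y)) * Re (b y)) -
      \int[mu]_y (Im (k (x, y)) * Im (b y)))).
    apply: (@cvgB _ _ _ _ _ (fun x => \int[mu]_y (Re (k (x, y)) * Re (b y)))
      (fun x => \int[mu]_y (Im (k (x, y)) * Im (b y)))).
      exact: (continuous_Rintegral cG kr br).
    exact: (continuous_Rintegral cG ki bi).
  apply/funext => z /=; under [LHS]eq_Rintegral do rewrite ReM.
  by rewrite RintegralB//; [exact: (int _ _ _ kr)|exact: (int _ _ _ ki)].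
- rewrite (_ : (fun x => _) = (fun x => \int[mu]_y (Re (k (x, y)) * Im (b y)) +
      \int[mu]_y (Im (k (x, y)) * Re (b y)))).
    apply: (@cvgD _ _ _ _ _ (fun x => \int[mu]_y (Re (k (x, y)) * Im (b y)))
      (fun x => \int[mu]_y (Im (k (x, y)) * Re (b y)))).
      exact: (continuous_Rintegral cG kr bi).
    exact: (continuous_Rintegral cG ki br).
  apply/funext => z /=; under [LHS]eq_Rintegral do rewrite ImM.
  by rewrite RintegralD//; [exact: (int _ _ _ kr)|exact: (int _ _ _ ki)].
Qed.

End Continuity.

(** * Convolution *)

Section Convolution.
Context (R : realType) (G : topologicalGroupType) (mu : probability (borel G) R).
Hypotheses (compactG : compact [set: G]) (sndG : @second_countable G)
  (haar_mu : is_haar mu).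
Implicit Types (f g h b : borel G -> R[i]).

Definition conv f g (x : borel G) : R[i] :=
  cintegral mu (fun y => f ((x : G) * (y : G)^-1)%g * g y).

(** Convolution by [adj f] is the Hilbert space adjoint of convolution by f: the kernel f(x y^-1)
    becomes the conjugate of f(y x^-1). *)
Definition adj f (x : borel G) : R[i] := (f ((x : G)^-1)%g)^*.

Definition bmeasurable f := cmeasurable f /\ cbounded f.

Lemma preserving_divg (x : G) : preserving mu (fun y => (x * y^-1)%g).
Proof.
exact: (preserving_comp (preserving_mulgl haar_mu x) (preserving_invg sndG haar_mu)).
Qed.

Lemma bmeasurable_comp (phi : G -> G) f :
  measurable_fun setT (phi : borel G -> borel G) ->
  bmeasurable f -> bmeasurable (fun x => f (phi x)).
Proof.
by move=> mp [mf [M fM]]; split; [exact: (cmeasurable_comp mp)|exists M => x].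
Qed.

Lemma bmeasurable_integrable f : bmeasurable f -> cintegrable mu f.
Proof. by move=> [mf bf]; apply: cintegrable_bounded. Qed.

Lemma bmeasurable_square_integrable f : bmeasurable f -> square_integrable mu f.
Proof. by move=> [mf bf]; apply: square_integrable_bounded. Qed.

Lemma ccontinuous_bmeasurable f : ccontinuous (f : G -> R[i]) -> bmeasurable f.
Proof.
by move=> cf; split; [exact: ccontinuous_measurable|exact: ccontinuous_bounded].
Qed.

Lemma bmeasurable_adj f : bmeasurable f -> bmeasurable (adj f).
Proof.
move=> [mf [M fM]]; split.
  by apply: cmeasurableJ; apply: (cmeasurable_comp (measurable_invg (G := G))).
by exists M => x; rewrite /adj ReJ ImJ normrN.
Qed.

Lemma adjK f : adj (adj f) = f.
Proof. by apply/funext => x; rewrite /adj invgK conjCK. Qed.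

Lemma ip_adj f : square_integrable mu f -> ip mu (adj f) (adj f) = ip mu f f.
Proof.
move=> f2; have f2f := ip_integrable f2 f2.
rewrite -[RHS](preserving_cintegral (preserving_invg sndG haar_mu) f2f).
by apply: cintegral_ext => x; rewrite /adj conjCK mulrC.
Qed.

(** Cauchy-Schwarz, since y |-> x y^-1 preserves the measure. The bound does not depend on x, so
    convolution turns L^2 convergence into uniform convergence. *)
Lemma conv_bound f g (x : G) : square_integrable mu f -> square_integrable mu g ->
  `|conv f g x| ^+ 2 <= ip mu f f * ip mu g g.
Proof.
move=> f2 g2; pose h (y : borel G) := (f (x * (y : G)^-1)%g)^*.
have fx2 := preserving_square_integrable (preserving_divg x) f2.
have h2 : square_integrable mu h by apply: square_integrableJ.
have -> : conv f g x = ip mu g h.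
  by apply: cintegral_ext => y; rewrite /h conjCK mulrC.
rewrite mulrC; have <- : ip mu h h = ip mu f f; last exact: cauchy_schwarz.
rewrite -[RHS](preserving_cintegral (preserving_divg x) (ip_integrable f2 f2)).
by apply: cintegral_ext => y; rewrite /h conjCK mulrC.
Qed.

Lemma conv_integrand_bl f g (x : G) : bmeasurable f -> cintegrable mu g ->
  cintegrable mu (fun y => f (x * (y : G)^-1)%g * g y).
Proof.
move=> bf ig; have [mfx bfx] := bmeasurable_comp (preserving_divg x).1 bf.
exact: cintegrableMb ig mfx bfx.
Qed.

Lemma conv_integrand_br f g (x : G) : cintegrable mu f -> bmeasurable g ->
  cintegrable mu (fun y => f (x * (y : G)^-1)%g * g y).
Proof.
move=> If [mg bg]; have ifx := preserving_cintegrable (preserving_divg x) If.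
have := cintegrableMb ifx mg bg.
by under eq_fun do rewrite mulrC.
Qed.

Lemma measurable_div_prod : measurable_fun setT
  ((fun z : G * G => (z.1 * z.2^-1)%g) : (borel G * borel G)%type -> borel G).
Proof.
apply: continuous_measurable_prod => //; apply: continuous_mulg_comp.
  by move=> z; exact: cvg_fst.
by apply: continuous_invg_comp => z; exact: cvg_snd.
Qed.

(** Integrating over x first, right invariance separates the two factors. The modulus is replaced by
    n z = |Re z| + |Im z|, which is submultiplicative and dominates both parts. *)
Lemma cintegrable_conv2 f g : cintegrable mu f -> cintegrable mu g ->
  cintegrable (mu \x mu)%E
    (fun z : borel G * borel G => f ((z.1 : G) * (z.2 : G)^-1)%g * g z.2).
Proof.
move=> If Ig; have mf := cintegrable_measurable If.
have mg := cintegrable_measurable Ig.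
have mfd := cmeasurable_comp measurable_div_prod mf.
have mg2 := cmeasurable_comp (measurable_snd (T1 := borel G)) mg.
pose n (u : R[i]) := `|Re u| + `|Im u|.
have n0 u : 0 <= n u by rewrite addr_ge0.
have mn d (T : measurableType d) (u : T -> R[i]) : cmeasurable u ->
    measurable_fun setT (fun t => n (u t)).
  by move=> [ur ui]; apply: measurable_funD; apply: measurableT_comp.
have mnf : measurable_fun setT (fun x => (n (f x))%:E).
  by apply/measurable_EFinP; exact: mn.
pose u (z : borel G * borel G) := n (f ((z.1 : G) * (z.2 : G)^-1)%g) * n (g z.2).
apply: (@cintegrable_prod_dom _ _ _ _ _ u).
- exact: cmeasurableM.
- by apply: measurable_funM; apply: mn.
- move=> z; rewrite ReM ImM /u /n.
  set a := Re _; set b := Re _; set c := Im _; set e := Im _.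
  have ae := mulr_ge0 (normr_ge0 a) (normr_ge0 e).
  have cb := mulr_ge0 (normr_ge0 c) (normr_ge0 b).
  have ab := mulr_ge0 (normr_ge0 a) (normr_ge0 b).
  have ce := mulr_ge0 (normr_ge0 c) (normr_ge0 e).
  rewrite mulrDl !mulrDr; split.
    by rewrite (le_trans (ler_normB _ _))// !normrM; lra.
  by rewrite (le_trans (ler_normD _ _))// !normrM; lra.
have nf : (\int[mu]_x (n (f x))%:E < +oo)%E.
  have /integrableP[_] := cintegrable_normR If.
  by under eq_integral => x _ do rewrite /= ger0_norm//.
have inner (y : borel G) : (\int[mu]_x (u (x, y))%:E =
    (\int[mu]_x (n (f x))%:E) * (n (g y))%:E)%E.
  under eq_integral do rewrite /u /= mulrC EFinM.
  rewrite ge0_integralZl//; first last.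
  - by rewrite lee_fin.
  - by move=> *; rewrite lee_fin.
  - apply/measurable_EFinP/mn.
    exact: (cmeasurable_comp (preserving_mulgr sndG haar_mu _).1).
  rewrite muleC (preserving_ge0_integral (preserving_mulgr sndG haar_mu ((y : G)^-1)%g)
    (f := fun x => (n (f x))%:E))//.
  by move=> *; rewrite lee_fin.
under eq_integral do rewrite inner.
have fin : (\int[mu]_x (n (f x))%:E)%E \is a fin_num.
  by rewrite ge0_fin_numE// integral_ge0// => x _; rewrite lee_fin.
rewrite -(fineK fin) ge0_integralZl//.
- rewrite lte_mul_pinfty//.
    by rewrite fineK// integral_ge0// => x _; rewrite lee_fin.
  have /integrableP[_] := cintegrable_normR Ig.
  by under eq_integral => x _ do rewrite /= ger0_norm//.
- by apply/measurable_EFinP; exact: mn.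
- by move=> x _; rewrite lee_fin.
- by rewrite fineK// integral_ge0// => x _; rewrite lee_fin.
Qed.

(* Associativity of the convolution and multiplicativity of the Fourier       *)
(* coefficients are both instances of this identity.                          *)
Lemma conv_fubini f g b : cintegrable mu f -> cintegrable mu g -> bmeasurable b ->
  (forall x : G, cintegrable mu (fun y => f (x * (y : G)^-1)%g * g y)) ->
  cintegral mu (fun x => b x * conv f g x) =
  cintegral mu (fun y => cintegral mu (fun x => b ((x : G) * (y : G))%g * f x) * g y).
Proof.
move=> If Ig [mb [M bM]] fg.
have Ik := cintegrable_conv2 If Ig.
have mb1 := cmeasurable_comp (measurable_fst (T2 := borel G)) mb.
have bb1 : cbounded (fun z : borel G * borel G => b z.1) by exists M => z.
have [_ _] := cfubini (cintegrableMb Ik mb1 bb1).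
have -> : (fun x => cintegral mu (fun y : borel G =>
    b (x, y).1 * (f (((x, y).1 : G) * ((x, y).2 : G)^-1)%g * g (x, y).2))) =
    (fun x => b x * conv f g x).
  by apply/funext => x /=; rewrite cintegralZ.
move=> ->; apply: cintegral_ext => y /=.
have Ib : cintegrable mu (fun x : borel G => b ((x : G) * y)%g * f x).
  have [m1 m2] := bmeasurable_comp (preserving_mulgr sndG haar_mu y).1
    (conj mb (ex_intro _ M bM)).
  exact: cintegrableMb If m1 m2.
rewrite -cintegralZr//.
have := preserving_cintegral (preserving_mulgr sndG haar_mu ((y : G)^-1)%g)
  (cintegrableZ (g y) Ib).
under [X in _ = X -> _]cintegral_ext do rewrite mulrC.
move=> <-; apply: cintegral_ext => x.
by rewrite mulgVK; ring.
Qed.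

Lemma cintegrable_conv f g : cintegrable mu f -> cintegrable mu g ->
  cintegrable mu (conv f g).
Proof. by move=> If Ig; have [] := cfubini (cintegrable_conv2 If Ig). Qed.

Lemma bmeasurable_conv f g : bmeasurable f -> square_integrable mu g ->
  bmeasurable (conv f g).
Proof.
move=> bf g2; split.
  apply: cintegrable_measurable; apply: cintegrable_conv.
    exact: bmeasurable_integrable.
  exact: square_integrable_integrable.
have f2 := bmeasurable_square_integrable bf.
(* This avoids a square root: a^2 <= c implies |a| <= c + 1. *)
exists (Re (ip mu f f * ip mu g g) + 1) => x.
have := conv_bound x f2 g2; move: (ip mu f f * ip mu g g) => [c c'].
rewrite -add_Re2_Im2 lecE /= => /andP[_].
move: (conv f g x) => [a b] /= h.
have c0 : 0 <= c by rewrite (le_trans _ h)// addr_ge0 ?sqr_ge0.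
have := sqr_ge0 a; have := sqr_ge0 b; rewrite !ler_norml => ? ?.
by split; apply/andP; split; nra.
Qed.

Lemma conv_assoc f g h : bmeasurable f -> bmeasurable g -> cintegrable mu h ->
  conv f (conv g h) = conv (conv f g) h.
Proof.
move=> bf bg ih; apply/funext => x; rewrite /conv -/(conv g h).
have bfx := bmeasurable_comp (preserving_divg x).1 bf.
have := conv_fubini (bmeasurable_integrable bg) ih bfx
  (fun x => conv_integrand_bl x bg ih).
move=> ->; apply: cintegral_ext => y; congr (_ * _).
by apply: cintegral_ext => z; rewrite invgM mulgA.
Qed.

Lemma adj_conv f g : bmeasurable f -> bmeasurable g ->
  adj (conv f g) = conv (adj g) (adj f).
Proof.
move=> bf bg; apply/funext => x; rewrite {1}/adj /conv.
rewrite -cintegralJ; last first.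
  exact: conv_integrand_bl bf (bmeasurable_integrable bg).
pose k (y : borel G) := (f ((x : G)^-1 * (y : G)^-1)%g * g y)^*.
have ik : cintegrable mu k.
  by apply: cintegrableJ; apply: conv_integrand_bl bf (bmeasurable_integrable bg).
rewrite -(preserving_cintegral (preserving_mulgr sndG haar_mu ((x : G)^-1)%g) ik).
by apply: cintegral_ext => y; rewrite /k /adj !invgM !invgK mulKg rmorphM mulrC.
Qed.

End Convolution.

(** * Eigenfunctions by power iteration *)

Section LogConvex.
Context (R : realType).

(* Meant for c n = |F^(n+1)|^2, whence the shift in the indices. Submultipli-  *)
(* cativity gives c k >= c (m + k + 1) / c m >= r m ^ (k + 1) for the ratios   *)
(* r m = c (m + 1) / c m, which increase to the limit l.                      *)
Lemma logconvex_limit (c : nat -> R) : (forall n, 0 < c n) ->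
  (forall n, c n.+1 ^+ 2 <= c n * c n.+2) ->
  (forall m k, c (m + k).+1 <= c m * c k) ->
  exists2 l, 0 < l & (forall n, l ^+ n.+1 <= c n) /\
    (forall n, c n.+1 / l ^+ n.+2 <= c n / l ^+ n.+1).
Proof.
move=> c0 clc csub.
pose r n := c n.+1 / c n.
have r0 n : 0 < r n by rewrite divr_gt0.
have rS n : c n.+1 = r n * c n by rewrite divfK// gt_eqF.
have rinc : {homo r : n m / (n <= m)%N >-> n <= m}.
  apply/nondecreasing_seqP => n; rewrite /r ler_pdivrMr// mulrAC ler_pdivlMr//.
  by rewrite -expr2 mulrC.
have rb n : r n <= c 0%N.
  by rewrite /r ler_pdivrMr//; have := csub 0%N n; rewrite add0n.
have rcvg : cvgn r.
  apply: nondecreasing_is_cvgn => //; exists (c 0%N) => _ [n _ <-]; exact: rb.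
pose l := limn r.
have rl n : r n <= l by apply: nondecreasing_cvgn_le.
have l0 : 0 < l by rewrite (lt_le_trans (r0 0%N)).
exists l => //; split=> n.
  have rn m : r m ^+ n.+1 <= c n.
    have cm k : r m ^+ k * c m <= c (m + k)%N.
      elim: k => [|k IH]; first by rewrite addn0 mul1r.
      rewrite addnS rS exprS -mulrA ler_pM ?mulr_ge0 ?invr_ge0 ?exprn_ge0 ?(ltW (r0 _)) ?(ltW (c0 _))//.
      by apply: rinc; rewrite leq_addr.
    have := le_trans (cm n.+1) _; rewrite addnS => /(_ _ (csub m n)).
    by rewrite mulrC ler_pM2l.
  have : (fun m => r m ^+ n.+1) @ \oo --> l ^+ n.+1.
    by apply: (@cvg_comp _ _ _ r (fun x => x ^+ n.+1) _ _ _ rcvg); exact: exprn_continuous.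
  by move=> h; apply: (cvgr_to_le h); apply: nearW.
rewrite ler_pdivrMr ?exprn_gt0// [l ^+ n.+2]exprS mulrCA mulfVK ?gt_eqF ?exprn_gt0//.
by rewrite rS ler_pM2r.
Qed.

Lemma uniform_cauchy_limit (T : Type) (p : nat -> T -> R[i]) :
  (forall e : R, 0 < e -> exists N, forall n m x, (N <= n)%N -> (n <= m)%N ->
     `|Re (p n x - p m x)| <= e /\ `|Im (p n x - p m x)| <= e) ->
  exists q, forall e : R, 0 < e -> exists N, forall n x, (N <= n)%N ->
     `|Re (p n x - q x)| <= e /\ `|Im (p n x - q x)| <= e.
Proof.
move=> pc.
have lims (s : nat -> R) : (forall e : R, 0 < e -> exists N, forall n m,
    (N <= n)%N -> (n <= m)%N -> `|s n - s m| <= e) -> s @ \oo --> limn s.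
  move=> sc; apply: cauchy_cvg; apply/cauchy_exP => e e0.
  have [N hN] := sc (e / 2) (divr_gt0 e0 (ltr0Sn _ 1)).
  exists (s N); exists N => // n /= Nn.
  rewrite /ball /= (le_lt_trans (hN _ _ (leqnn _) Nn))//.
  by rewrite ltr_pdivrMr// ltr_pMr// ltr1n.
have bnd (s : nat -> R) e N : s @ \oo --> limn s ->
    (forall n m, (N <= n)%N -> (n <= m)%N -> `|s n - s m| <= e) ->
    forall n, (N <= n)%N -> `|s n - limn s| <= e.
  move=> scv h n Nn.
  have hc : (fun m => `|s n - s m|) @ \oo --> `|s n - limn s|.
    by apply: cvg_norm; apply: cvgB => //; exact: cvg_cst.
  apply: (cvgr_to_le hc); exists n => // m /= nm; exact: h.
pose q x := Complex (limn (fun n => Re (p n x))) (limn (fun n => Im (p n x))).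
exists q => e e0; have [N hN] := pc e e0; exists N => n x Nn.
rewrite !ReD !ImD !ReN !ImN /=; split.
- apply: (bnd (fun n => Re (p n x)) e N) => //.
    apply: lims => d d0; have [M hM] := pc d d0; exists M => a b Ma ab.
    by have [+ _] := hM a b x Ma ab; rewrite ReD ReN.
  by move=> a b Na ab; have [+ _] := hN a b x Na ab; rewrite ReD ReN.
- apply: (bnd (fun n => Im (p n x)) e N) => //.
    apply: lims => d d0; have [M hM] := pc d d0; exists M => a b Ma ab.
    by have [_ +] := hM a b x Ma ab; rewrite ImD ImN.
  by move=> a b Na ab; have [_ +] := hN a b x Na ab; rewrite ImD ImN.
Qed.

Lemma uniform_limit_ccontinuous (T : topologicalType) (p : nat -> T -> R[i]) q :
  (forall n, ccontinuous (p n)) ->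
  (forall e : R, 0 < e -> exists N, forall n x, (N <= n)%N ->
     `|Re (p n x - q x)| <= e /\ `|Im (p n x - q x)| <= e) ->
  ccontinuous q.
Proof.
move=> cp pq.
have key (s : nat -> T -> R) t : (forall n, continuous (s n)) ->
    (forall e : R, 0 < e -> exists N, forall n x, (N <= n)%N ->
       `|s n x - t x| <= e) -> continuous t.
  move=> cs st x; apply/cvgrPdist_le => e e0.
  have e3 : 0 < e / 3 by rewrite divr_gt0.
  have [N hN] := st _ e3.
  have /cvgrPdist_le /(_ _ e3) := cs N x; apply: filterS => y hy.
  have h1 := hN N x (leqnn _); have h2 := hN N y (leqnn _).
  move: hy h1 h2; rewrite !ler_norml => /andP[? ?] /andP[? ?] /andP[? ?].
  by apply/andP; split; lra.
split.
- apply: (key (fun n x => Re (p n x))) => [n|e e0]; first by case: (cp n).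
  have [N hN] := pq e e0; exists N => n x Nn.
  by have [+ _] := hN n x Nn; rewrite ReD ReN.
- apply: (key (fun n x => Im (p n x))) => [n|e e0]; first by case: (cp n).
  have [N hN] := pq e e0; exists N => n x Nn.
  by have [_ +] := hN n x Nn; rewrite ImD ImN.
Qed.

Lemma normc_sqr_le (z : R[i]) (e : R) : 0 <= e -> `|z| ^+ 2 <= (e ^+ 2)%:C%C ->
  `|Re z| <= e /\ `|Im z| <= e.
Proof.
move=> e0; rewrite -add_Re2_Im2 lecR => h.
have := sqr_ge0 (Re z); have := sqr_ge0 (Im z) => hi hr.
by split; rewrite -(ler_pXn2r (n := 2)) ?nnegrE// real_normK ?num_real//; lra.
Qed.

Lemma normc_sqr_ge (z : R[i]) (e : R) : `|Re z| <= e -> `|Im z| <= e ->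
  `|z| ^+ 2 <= (2 * e ^+ 2)%:C%C.
Proof.
move=> r i; rewrite -add_Re2_Im2 lecR mulr2n mulrDl mul1r.
have e0 := le_trans (normr_ge0 _) r.
by rewrite lerD// -[leLHS]real_normK ?num_real// ler_pXn2r ?nnegrE.
Qed.

Lemma lecRM (a b c : R) : (a%:C%C <= b%:C%C * c%:C%C :> R[i]) = (a <= b * c).
Proof. by rewrite -rmorphM lecR. Qed.

Lemma real_complexX (a : R) n : (a ^+ n)%:C%C = a%:C%C ^+ n :> R[i].
Proof. exact: rmorphXn. Qed.

Lemma real_complexM (a b : R) : (a * b)%:C%C = a%:C%C * b%:C%C :> R[i].
Proof. exact: rmorphM. Qed.

Lemma real_complexJ (a : R) : (a%:C%C : R[i])^* = a%:C%C.
Proof. by apply: complex_eqP; rewrite ?ReJ ?ImJ //= oppr0. Qed.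

End LogConvex.

(** * Convolution powers of a continuous hermitian function *)

Section PowerIteration.
Context (R : realType) (G : topologicalGroupType) (mu : probability (borel G) R).
Hypotheses (compactG : compact [set: G]) (sndG : @second_countable G)
  (haar_mu : is_haar mu).
Implicit Types (f g h : borel G -> R[i]).

Let L2c f (cf : ccontinuous (f : G -> R[i])) :=
  bmeasurable_square_integrable mu (ccontinuous_bmeasurable compactG cf).

(** Finitely many translates of V cover G by compactness, and all have the measure of V; if it were
    0, so would be the measure of G. *)
Lemma open_not_negligible (V : set G) (x0 : G) : open V -> V x0 ->
  ~ mu.-negligible (V : set (borel G)).
Proof.
move=> oV Vx0 /(negligibleP _ (open_borel_measurable oV)) V0.
pose W (a : G) := (fun y => (a * y)%g) @^-1` V.
have oW a : open (W a).
  apply: open_comp => // y _; apply: continuous_mulg_comp => // z.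
  - exact: cvg_cst.
  - exact: cvg_id.
have W0 a : mu (W a : set (borel G)) = 0%E.
  by rewrite (preserving_mulgl haar_mu a).2//; exact: open_borel_measurable.
have : cover_compact [set: G] by rewrite -compact_cover.
move=> /(_ G [set: G] W (fun a _ => oW a)) [].
  by move=> y _; exists (x0 * y^-1)%g => //=; rewrite /W /= mulgVK.
move=> D _ cov.
have null (s : seq G) : mu.-negligible (\bigcup_(a in [set` s]) W a : set (borel G)).
  elim: s => [|a s IH].
    by rewrite bigcup0//; exact: negligible_set0.
  rewrite (_ : \bigcup_(b in _) _ = W a `|` \bigcup_(b in [set` s]) W b); last first.
    apply/seteqP; split=> [y [b /=]|y []].
    - by rewrite in_cons => /predU1P[->|bs] Wy; [left|right; exists b].
    - by move=> Wy; exists a => //=; rewrite mem_head.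
    - by move=> [b /= bs Wy]; exists b => //=; rewrite in_cons bs orbT.
  apply: negligibleU => //.
  by apply/(negligibleP _ (open_borel_measurable (oW a))); exact: W0.
have : mu.-negligible [set: borel G].
  by apply: negligibleS (null (enum_fset D)); apply: subset_trans cov _ => y [a Da Wy]; exists a.
move=> /(negligibleP _ measurableT) muT0; have := probability_setT mu.
by rewrite [X in X = _ -> _]muT0 => /eqP; rewrite eq_sym onee_eq0.
Qed.

(** The set where f does not vanish is open, so it is empty as soon as it is negligible. *)
Lemma ccontinuous_ae_eq0 f : ccontinuous (f : G -> R[i]) ->
  f = (fun=> 0) %[ae mu] -> forall x, f x = 0.
Proof.
move=> cf f0 x; apply: contrapT => fx0.
pose V := [set y : G | f y != 0].
have VE : V = (fun y => Re (f y)) @^-1` [set~ 0] `|` (fun y => Im (f y)) @^-1` [set~ 0].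
  apply/seteqP; split=> y /=.
    move=> /eqP fy; have [r0|] := eqVneq (Re (f y)) 0; last by move/eqP; left.
    by right => i0; apply: fy; apply: complex_eqP.
  by case=> h; apply/eqP => fy; apply: h; rewrite fy.
have oV : open V.
  have o0 : open [set~ (0 : R)] by rewrite openC; exact: closed_eq.
  by case: cf => cr ci; rewrite VE; apply: openU; apply: open_comp => // y _.
apply: (@open_not_negligible V x oV); first exact/eqP.
apply: negligibleS f0 => y /= /eqP fy h; exact/fy/h.
Qed.

(** Inner products of convolution powers thus become values at 1 of a single power. *)
Lemma ip_conv f g : ip mu f g = conv mu (adj g) f 1%g.
Proof. by apply: cintegral_ext => y; rewrite /adj mul1g invgK mulrC. Qed.

(** The uniform bound [conv_bound], integrated over a space of measure 1. It makes the squared norms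
    of the powers submultiplicative. *)
Lemma conv_norm f g : bmeasurable f -> square_integrable mu g ->
  ip mu (conv mu f g) (conv mu f g) <= ip mu f f * ip mu g g.
Proof.
move=> bf g2; have f2 := bmeasurable_square_integrable mu bf.
have := conv_bound sndG haar_mu _ f2 g2.
have [b1 [M b2]] := bmeasurable_conv sndG haar_mu bf g2.
have fg2 := square_integrable_bounded mu b1 (ex_intro _ M b2).
have /complexR_ge0 -> : 0 <= ip mu f f * ip mu g g by rewrite mulr_ge0 ?ip_ge0.
move: (complex.Re _) => C hC; rewrite ipE lecR.
have C0 : 0 <= C by have := le_trans (exprn_ge0 2 (normr_ge0 _)) (hC 1%g); rewrite ler0c.
have -> : C = \int[mu]_x C by rewrite Rintegral_cst// [X in fine X]probability_setT mulr1.
have /square_integrableP[_ i2] := fg2.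
apply: le_Rintegral => //; first exact: finite_measure_integrable_cst.
by move=> x _; have := hC x; rewrite -add_Re2_Im2 lecR.
Qed.

Lemma convBr f g h (x : G) : bmeasurable f -> cintegrable mu g -> cintegrable mu h ->
  conv mu f (fun y => g y - h y) x = conv mu f g x - conv mu f h x.
Proof.
move=> bf ig ih; rewrite /conv -cintegralB; try exact: conv_integrand_bl.
by apply: cintegral_ext => y; rewrite mulrBr.
Qed.

Lemma convZr f g c (x : G) : bmeasurable f -> cintegrable mu g ->
  conv mu f (fun y => c * g y) x = c * conv mu f g x.
Proof.
move=> bf ig; rewrite /conv -cintegralZ; last exact: conv_integrand_bl.
by apply: cintegral_ext => y; rewrite mulrCA.
Qed.

Lemma ccontinuous_conv f g : ccontinuous (f : G -> R[i]) -> cintegrable mu g ->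
  ccontinuous (conv mu f g : G -> R[i]).
Proof.
move=> cf ig.
apply: (ccontinuous_integral (k := fun z : G * G => f (z.1 * z.2^-1)%g)) => //.
apply: (ccontinuous_comp (phi := fun z : G * G => (z.1 * z.2^-1)%g)) cf.
apply: continuous_mulg_comp; first by move=> z; exact: cvg_fst.
by apply: continuous_invg_comp => z; exact: cvg_snd.
Qed.

Variable F : borel G -> R[i].
Hypotheses (cF : ccontinuous (F : G -> R[i])) (adjF : adj F = F)
  (F0 : exists x, F x <> 0).

(** [pw n] is the power F^(n+1): convolution has no unit function in general. Hence the successor in
    all index formulas below. *)
Let pw := fix pw n : borel G -> R[i] := if n is n'.+1 then conv mu F (pw n') else F.

Let cpw n : ccontinuous (pw n : G -> R[i]).
Proof.
elim: n => //= n IH; apply: ccontinuous_conv => //.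
by apply: bmeasurable_integrable; exact: ccontinuous_bmeasurable.
Qed.

Let bpw n : bmeasurable (pw n).
Proof. exact: ccontinuous_bmeasurable. Qed.

Let ipw n : cintegrable mu (pw n).
Proof. exact: bmeasurable_integrable. Qed.

Let pw2 n : square_integrable mu (pw n).
Proof. exact: L2c. Qed.

Let pwD m n : conv mu (pw m) (pw n) = pw (m + n).+1.
Proof.
elim: m => //= m IH; rewrite -conv_assoc ?IH//.
exact: (bpw 0).
Qed.

Let adj_pw n : adj (pw n) = pw n.
Proof.
elim: n => //= n IH; rewrite adj_conv//; last exact: (bpw 0).
by rewrite IH adjF (pwD n 0) addn0.
Qed.

Let ip_pw m n : ip mu (pw m) (pw n) = pw (m + n).+1 1%g.
Proof. by rewrite ip_conv adj_pw pwD addnC. Qed.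

Let c n : R := Re (ip mu (pw n) (pw n)).

(** [c k] is the value at 1 of [pw (2k+1)], which is obtained from [pw (k+1)] by further
    convolutions. If [pw (k+1)] vanished, so would [c k], hence [pw k]: no power of a nonzero
    hermitian function is zero. *)
Let c_gt0 n : 0 < c n.
Proof.
have cge k : 0 <= c k by have := ip_ge0 mu (pw k); rewrite lecE => /andP[].
have cn0 k x : pw k x <> 0 -> c k != 0.
  move=> kx; apply/eqP => ck0; apply: kx; apply: ccontinuous_ae_eq0 => //.
  by apply: ip_eq0 => //; rewrite [LHS]complexR_ge0 ?ip_ge0// -/(c k) ck0.
have pw_eq0 k j : (forall x, pw k x = 0) -> forall x, pw (j + k) x = 0.
  move=> k0; elim: j => //= j IH x; rewrite /conv -[RHS](cintegral_cst mu).
  by apply: cintegral_ext => y; rewrite IH mulr0.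
have pwn0 k : exists x, pw k x <> 0.
  elim: k => // k [x kx].
  have := cn0 k x kx; apply: contra_neqP => /forallNP k0.
  rewrite /c ip_pw -addnS addnC (_ : pw _ _ = 0)//.
  by rewrite addSn -addnS; apply: pw_eq0 => y; apply: contrapT; exact: k0.
by have [x kx] := pwn0 n; rewrite lt_def cge (cn0 n x).
Qed.

Lemma power_sequence : exists p : nat -> borel G -> R[i], exists a : nat -> R,
  [/\ forall n, ccontinuous (p n : G -> R[i]), p 1%N = conv mu F F,
      forall m n, conv mu (p m) (p n) = p (m + n).+1,
      forall m n, ip mu (p m) (p n) = p (m + n).+1 1%g &
      (forall n, (a n)%:C%C = p (n + n).+1 1%g) /\ forall n, 0 < a n].
Proof.
exists pw, c; split => //; split => // n.
by rewrite /c -complexR_ge0 ?ip_ge0// ip_pw.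
Qed.

End PowerIteration.

Section Eigenfunction.
Context (R : realType) (G : topologicalGroupType) (mu : probability (borel G) R).
Hypotheses (compactG : compact [set: G]) (sndG : @second_countable G)
  (haar_mu : is_haar mu).

Lemma conv_eigenfunction (F : borel G -> R[i]) : ccontinuous (F : G -> R[i]) ->
  adj F = F -> (exists x, F x <> 0) -> exists l : R, exists u : borel G -> R[i],
  [/\ 0 < l, ccontinuous (u : G -> R[i]), u 1%g <> 0 &
      forall x, conv mu (conv mu F F) u x = l%:C%C * u x].
Proof.
move=> cF adjF F0.
have L2c f (cf : ccontinuous (f : G -> R[i])) : square_integrable mu f.
  by apply: bmeasurable_square_integrable; exact: ccontinuous_bmeasurable.
have [pw [c [cpw pw1 pwD ip_pw [cE c_gt0]]]] :=
  power_sequence compactG sndG haar_mu cF adjF F0.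
have bpw n : bmeasurable (pw n) by exact: ccontinuous_bmeasurable.
have ipw n : cintegrable mu (pw n) by exact: bmeasurable_integrable.
have pw2 n : square_integrable mu (pw n) by exact: L2c.
have ipc n : ip mu (pw n) (pw n) = (c n)%:C%C by rewrite ip_pw cE.
have clc n : c n.+1 ^+ 2 <= c n * c n.+2.
  rewrite -lecRM real_complexX -!ipc.
  have <- : `|ip mu (pw n) (pw n.+2)| = ip mu (pw n.+1) (pw n.+1).
    have -> : ip mu (pw n) (pw n.+2) = ip mu (pw n.+1) (pw n.+1).
      by rewrite !ip_pw !addnS !addSn.
    by rewrite ger0_norm ?ip_ge0.
  exact: cauchy_schwarz.
have csub m k : c (m + k).+1 <= c m * c k.
  by rewrite -lecRM -!ipc -pwD; exact: conv_norm.
have [l l0 [cge cdec]] := logconvex_limit c_gt0 clc csub.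
pose b n := c n / l ^+ n.+1.
have bdec : {homo b : n m / (n <= m)%N >-> m <= n}.
  by apply/nonincreasing_seqP => n; exact: cdec.
have b1 n : 1 <= b n by rewrite /b ler_pdivlMr ?exprn_gt0// mul1r.
have bcvg : cvgn b.
  by apply: nonincreasing_is_cvgn => //; exists 1 => _ [n _ <-]; exact: b1.
(* Only the even powers F^(2n+2) are used: convolution by F may have both sqrt l and - sqrt l as
   eigenvalues, and its own normalised powers would then oscillate. *)
pose p n (x : borel G) : R[i] := (l ^- n.+1)%:C%C * pw (n + n).+1 x.
have cp n : ccontinuous (p n : G -> R[i]) by apply: ccontinuousZ; exact: cpw.
have p2 n : square_integrable mu (p n) by exact: L2c.
have ipp n m : ip mu (p n) (p m) = (b (n + m).+1)%:C%C.
  rewrite /p ipZl ?ipZr//; last exact: square_integrableZ.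
  rewrite real_complexJ ip_pw /b real_complexM cE mulrA -real_complexM -invfM -exprD.
  rewrite mulrC; congr (pw _ _ * (_ ^- _)%:C%C); last by rewrite addnS addSn.
  by rewrite !addnS !addSn addnACA.
(* The expansion is b(2n+1) - 2 b(n+m+1) + b(2m+1), and b(n+m+1) >= b(2m+1) because b decreases. *)
have ipB n m : (n <= m)%N -> ip mu (fun x => p n x - p m x) (fun x => p n x - p m x) <=
    (b (n + n).+1 - b (m + m).+1)%:C%C.
  move=> nm; rewrite ipBl ?ipBr//; last exact: square_integrableB.
  rewrite !ipp -!rmorphB /= lecR [(m + n)%N]addnC.
  have : b (m + m).+1 <= b (n + m).+1 by apply: bdec; rewrite ltnS leq_add2r.
  lra.
have F2p n x : conv mu (pw 1) (p n) x = l%:C%C * p n.+1 x.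
  have el : l * l ^- n.+2 = l ^- n.+1 by rewrite exprS invfM mulVKf ?gt_eqF.
  by rewrite convZr// pwD /p mulrA -real_complexM el !addnS !addSn.
have [K K0 KE] : exists2 K, 0 < K & ip mu (pw 1) (pw 1) = K%:C%C.
  by exists (c 1%N).
(* The function l (p(n+1) - p(m+1)) is the convolution of F * F with p(n) - p(m): one more
   convolution makes the L^2 Cauchy estimate uniform. *)
have pS n m x : (n <= m)%N -> `|p n.+1 x - p m.+1 x| ^+ 2 <=
    (K / l ^+ 2 * (b (n + n).+1 - b (m + m).+1))%:C%C.
  move=> nm.
  have := conv_bound sndG haar_mu x (pw2 1) (square_integrableB (p2 n) (p2 m)).
  rewrite convBr//; try exact: square_integrable_integrable.
  rewrite !F2p -mulrBr normrM exprMn KE ger0_norm ?ler0c ?(ltW l0)// => h.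
  have {}h := le_trans h (ler_wpM2l _ (ipB n m nm)).
  have l20 : 0 < (l ^+ 2)%:C%C :> R[i] by rewrite ltcR exprn_gt0.
  rewrite mulrAC [X in (X / _)%:C%C]mulrC -(ler_pM2l l20) -real_complexM mulrC.
  rewrite [l ^+ 2 * _]mulrC divfK ?gt_eqF ?exprn_gt0// mulrC real_complexX real_complexM.
  by rewrite [(_ - _)%:C%C * _]mulrC; apply: h; rewrite ler0c ltW.
have pC (e : R) : 0 < e -> exists N, forall n m x, (N <= n)%N -> (n <= m)%N ->
     `|Re (p n x - p m x)| <= e /\ `|Im (p n x - p m x)| <= e.
  move=> e0.
  have d0 : 0 < e ^+ 2 * (l ^+ 2 / K) by rewrite mulr_gt0 ?divr_gt0 ?exprn_gt0.
  have /cvgrPdist_le /(_ _ d0) [N _ hN] := bcvg.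
  (* The uniform estimate [pS] concerns successors only, whence the shift of N. *)
  exists N.+1 => -[|n] [|m] x //; rewrite !ltnS => Nn nm.
  apply: normc_sqr_le; first exact: ltW.
  apply: le_trans (pS n m x nm) _; rewrite lecR.
  have bm : limn b <= b (m + m).+1 by apply: nonincreasing_cvgn_ge.
  have /= := hN (n + n).+1 (leq_trans Nn (leqW (leq_addr _ _))).
  rewrite distrC ler_norml => /andP[_ bn].
  rewrite mulrC -ler_pdivlMr ?divr_gt0 ?exprn_gt0// invf_div.
  by apply: le_trans bn; rewrite lerD2l lerN2.
have [q pq] := uniform_cauchy_limit pC.
have cq : ccontinuous (q : G -> R[i]) by exact: uniform_limit_ccontinuous pq.
have q2 : square_integrable mu q by exact: L2c.
rewrite -pw1; exists l, q; split => //.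
  (* The values p n 1 = b n >= 1 keep the limit away from 0 at the unit. *)
  have [N hN] := pq (1 / 2) (divr_gt0 ltr01 (ltr0Sn _ 1)).
  have [+ _] := hN N 1%g (leqnn _); rewrite ReD ReN ler_norml => /andP[_].
  rewrite {1}/p -cE -real_complexM mulrC -/(b N) => h q1.
  by have := b1 N; rewrite q1 /= in h; lra.
move=> x.
have small (a C : R) : 0 <= C -> (forall e, 0 < e -> `|a| <= C * e) -> a = 0.
  move=> C0 h; apply/eqP; rewrite -normr_le0; apply/ler_addgt0Pr => e e0.
  rewrite add0r (le_trans (h (e / (C + 1)) _)) ?divr_gt0 ?ltr_wpDl//.
  by rewrite mulrCA ler_piMr ?(ltW e0)// ler_pdivrMr ?ltr_wpDl// mul1r lerDl.
pose D := conv mu (pw 1) q x - l%:C%C * q x.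
(* D splits into the convolution with q - p N and l (p(N+1) - q). The first has squared modulus at
   most 2 K e^2 <= ((K + 2) e)^2, the second accounts for l. *)
have hD (e : R) : 0 < e ->
    `|Re D| <= (K + 2 + l) * e /\ `|Im D| <= (K + 2 + l) * e.
  move=> e0; have [N hN] := pq e e0.
  have qp2 : square_integrable mu (fun y => q y - p N y) by apply: square_integrableB.
  have B : `|conv mu (pw 1) (fun y => q y - p N y) x| ^+ 2 <=
      (((K + 2) * e) ^+ 2)%:C%C.
    apply: le_trans (conv_bound sndG haar_mu x (pw2 1) qp2) _.
    rewrite KE ipE -real_complexM lecR.
    apply: (@le_trans _ _ (K * (2 * e ^+ 2))).
      rewrite ler_wpM2l ?(ltW K0)//.
      have -> : 2 * e ^+ 2 = \int[mu]_y (2 * e ^+ 2).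
        by rewrite Rintegral_cst// [X in fine X]probability_setT mulr1.
      apply: le_Rintegral => //.
      - by have /square_integrableP[] := qp2.
      - exact: finite_measure_integrable_cst.
      move=> y _; have [hr hi] := hN N y (leqnn _).
      by rewrite -opprB ReN ImN !sqrrN -lecR add_Re2_Im2; exact: normc_sqr_ge.
    have := ltW K0; have := ltW e0; have := sqr_ge0 e; nra.
  have Ke0 : 0 <= (K + 2) * e by rewrite mulr_ge0 ?addr_ge0 ?ltW.
  move: B; rewrite convBr//; try exact: square_integrable_integrable.
  rewrite F2p => /(normc_sqr_le Ke0)[Ar Ai]; have [Br Bi] := hN N.+1 x (leqnSn _).
  have -> : D = (conv mu (pw 1) q x - l%:C%C * p N.+1 x) +
                l%:C%C * (p N.+1 x - q x) by rewrite /D; ring.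
  rewrite ReD ImD [Re (l%:C%C * _)]ReM [Im (l%:C%C * _)]ImM /= !mul0r subr0 addr0.
  rewrite [(_ + l) * e]mulrDl.
  by split; rewrite (le_trans (ler_normD _ _))// lerD// normrM gtr0_norm// ler_pM2l.
have C0 : 0 <= K + 2 + l by rewrite !addr_ge0 ?ltW.
suff : D = 0 by move/eqP; rewrite subr_eq0 => /eqP.
apply: complex_eqP; apply: small C0 _ => e e0; by have [] := hD e e0.
Qed.

End Eigenfunction.

(** * Irreducible representations inside eigenspaces *)

Local Open Scope sesquilinear_scope.

Lemma ccontinuous_mxP (R : realType) (T : topologicalType) n
    (f : T -> 'M[R[i]]_n) :
  continuous f <-> forall i j, ccontinuous (fun x => f x i j).
Proof.
split=> [cf i j|cf x].
  have key x (e : R) : 0 < e -> \forall y \near x, `|f x i j - f y i j| < e%:C%C.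
    move=> e0; have /cvg_ballP/(_ e%:C%C) := cf x; rewrite ltcR => /(_ e0).
    by apply: filterS => y -[_ /(_ i j)].
  split=> x; apply/cvgrPdist_lt => e e0; apply: filterS (key x e e0) => y.
  - move=> h; have := le_lt_trans (normc_ge_Re _) h.
    by rewrite ltcR ReD ReN.
  - rewrite normc_def ltcR ReD ImD ReN ImN; apply: le_lt_trans.
    by rewrite -[leLHS]sqrtr_sqr ler_wsqrtr// lerDr sqr_ge0.
apply/cvg_ballP => e e0.
suff H : \forall y \near x, ball (f x) e (f y) by exact: H.
have eE : e = (Re e)%:C%C by apply: complexR_ge0; exact: ltW.
have r0 : 0 < Re e by rewrite -ltcR -eE.
have e2 : 0 < Re e / 2 by rewrite divr_gt0.
have key i j : \forall y \near x, `|f x i j - f y i j| < e.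
  have [cr ci] := cf i j.
  have /cvgrPdist_lt/(_ _ e2) hr := cr x; have /cvgrPdist_lt/(_ _ e2) hi := ci x.
  apply: filterS2 hr hi => y hr hi.
  rewrite [f x i j - f y i j]complexE (le_lt_trans (ler_normD _ _))//.
  rewrite normrM !normc_def /= !expr0n /= !addr0 add0r expr1n sqrtr1 mul1r.
  rewrite !sqrtr_sqr -rmorphD /= eE ltcR ReD ImD ReN ImN [Re e]splitr.
  by rewrite ltrD.
have H := filter_forall _ (fun i => filter_forall _ (key i)).
by apply: filterS (H _ _) => y h; split.
Qed.

(** * Eigenspaces of a convolution operator: translation invariance and finite dimension *)

Section Eigenspace.
Context (R : realType) (G : topologicalGroupType) (mu : probability (borel G) R).
Hypotheses (compactG : compact [set: G]) (sndG : @second_countable G)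
  (haar_mu : is_haar mu).
Variables (K : borel G -> R[i]) (l : R).
Hypotheses (bK : bmeasurable K) (l0 : l != 0).
Implicit Types (u v : borel G -> R[i]).

(** The equation holds at every point, so identities in the eigenspace are identities of functions.
    The kernel is only bounded and measurable because gamma itself takes this role in
    [finite_dual_at]. *)
Definition conv_eigen u := ccontinuous (u : G -> R[i]) /\
  forall x, conv mu K u x = l%:C%C * u x.

Definition orthonormal (I : finType) (u : I -> borel G -> R[i]) :=
  forall i j, ip mu (u i) (u j) = (i == j)%:R.

Let eL2 u : conv_eigen u -> square_integrable mu u.
Proof.
by move=> [cu _]; apply: bmeasurable_square_integrable; exact: ccontinuous_bmeasurable.
Qed.

Let eL1 u : conv_eigen u -> cintegrable mu u.
Proof. by move=> /eL2; exact: square_integrable_integrable. Qed.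

Lemma conv_eigenZ c u : conv_eigen u -> conv_eigen (fun x => c * u x).
Proof.
move=> eu; have [cu hu] := eu; split=> [|x]; first exact: ccontinuousZ.
by rewrite convZr//; [rewrite hu mulrCA|exact: eL1].
Qed.

Lemma conv_eigenD u v : conv_eigen u -> conv_eigen v ->
  conv_eigen (fun x => u x + v x).
Proof.
move=> eu ev; have [cu hu] := eu; have [cv hv] := ev; split=> [|x].
  exact: ccontinuousD.
rewrite mulrDr -hu -hv /conv -cintegralD; first last.
- by apply: conv_integrand_bl => //; exact: eL1.
- by apply: conv_integrand_bl => //; exact: eL1.
by apply: cintegral_ext => y; rewrite mulrDr.
Qed.

Lemma conv_eigen_sum (I : Type) (s : seq I) (F : I -> borel G -> R[i]) :
  (forall i, conv_eigen (F i)) -> conv_eigen (fun x => \sum_(i <- s) F i x).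
Proof.
move=> eF; elim: s => [|i s IH]; last first.
  by under eq_fun do rewrite big_cons; apply: conv_eigenD.
under eq_fun do rewrite big_nil.
split=> [|x]; first exact: ccontinuous_cst.
rewrite mulr0 -[RHS](cintegral_cst mu); apply: cintegral_ext => y.
by rewrite mulr0.
Qed.

(** The kernel K(x y^-1) does not change when x and y are both multiplied by z on the right. *)
Lemma conv_eigen_mulgr u (z : G) : conv_eigen u ->
  conv_eigen (fun y : borel G => u ((y : G) * z)%g).
Proof.
move=> eu; have [cu hu] := eu; split=> [|x].
  apply: (ccontinuous_comp (phi := fun y => (y * z)%g)) cu.
  by apply: continuous_mulg_comp => y; [exact: cvg_id|exact: cvg_cst].
rewrite -hu /conv.
rewrite -[RHS](preserving_cintegral (preserving_mulgr sndG haar_mu z)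
  (conv_integrand_bl sndG haar_mu _ bK (eL1 eu))).
by apply: cintegral_ext => y; rewrite invgM mulgA mulgK.
Qed.

(* Bessel for the functions y |-> conj (K (x y^-1)), integrated over x. *)
Lemma orthonormal_eigen_bound (I : finType) (u : I -> borel G -> R[i]) :
  (forall i, conv_eigen (u i)) -> orthonormal u ->
  (#|I|)%:R <= Re (ip mu K K) / l ^+ 2.
Proof.
move=> eu ou; have u2 i := eL2 (eu i).
have K2 : square_integrable mu K by exact: bmeasurable_square_integrable.
pose S x : R := \sum_i (Re (u i x) ^+ 2 + Im (u i x) ^+ 2).
have Sx x : S x <= Re (ip mu K K) / l ^+ 2.
  pose h (y : borel G) := (K ((x : G) * (y : G)^-1)%g)^*.
  have Kx2 := preserving_square_integrable (preserving_divg sndG haar_mu x) K2.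
  have h2 : square_integrable mu h by apply: square_integrableJ.
  have := bessel u2 h2 ou.
  have -> : ip mu h h = ip mu K K.
    rewrite -[RHS](preserving_cintegral (preserving_divg sndG haar_mu x) (ip_integrable K2 K2)).
    by apply: cintegral_ext => y; rewrite /h conjCK mulrC.
  have -> : \sum_i `|ip mu h (u i)| ^+ 2 = (l ^+ 2 * S x)%:C%C.
    rewrite real_complexM /S rmorph_sum mulr_sumr; apply: eq_bigr => i _.
    rewrite -ip_conj// norm_conjC.
    have -> : ip mu (u i) h = l%:C%C * u i x.
      by rewrite -(eu i).2; apply: cintegral_ext => y; rewrite /h conjCK mulrC.
    rewrite normrM exprMn -[(`|u i x|) ^+ 2]add_Re2_Im2 normc_def /= expr0n addr0.
    by rewrite sqrtr_sqr -real_complexX real_normK ?num_real.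
  rewrite [ip mu K K]complexR_ge0 ?ip_ge0// lecR /= => hS.
  by rewrite ler_pdivlMr ?exprn_even_gt0// mulrC.
have iS : cintegrable mu (fun x => \sum_i u i x * (u i x)^*).
  by apply: cintegrable_sum => i; exact: ip_integrable.
have SE x : Re (\sum_i u i x * (u i x)^*) = S x.
  by rewrite Re_sum; apply: eq_bigr => i _; rewrite mulcJE.
have : cintegral mu (fun x => \sum_i u i x * (u i x)^*) = (#|I|)%:R.
  rewrite cintegral_sum => [|i]; last exact: ip_integrable.
  rewrite (eq_bigr (fun=> 1)) ?sumr_const// => i _.
  by rewrite -[LHS]/(ip mu (u i) (u i)) ou eqxx.
move/(congr1 (@complex.Re R)); rewrite (_ : Re (#|I|)%:R = (#|I|)%:R); last first.
  by elim: (#|I|) => // n IH; rewrite !mulrS ReD IH.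
move=> <- /=; set C := _ / _.
have -> : C = \int[mu]_y C.
  by rewrite Rintegral_cst// [X in fine X]probability_setT mulr1.
apply: le_Rintegral => //; [exact: iS.1|exact: finite_measure_integrable_cst|].
by move=> x _; rewrite SE; exact: Sx.
Qed.

End Eigenspace.

Section InvariantFamily.
Context (R : realType) (G : topologicalGroupType) (mu : probability (borel G) R).
Hypotheses (compactG : compact [set: G]) (sndG : @second_countable G)
  (haar_mu : is_haar mu).
Variables (K : borel G -> R[i]) (l : R).
Hypotheses (cK : ccontinuous (K : G -> R[i])) (l0 : 0 < l).
Local Notation E := (conv_eigen mu K l).

Let bK : bmeasurable K. Proof. exact: ccontinuous_bmeasurable. Qed.

Definition invariant_family n (u : 'I_n -> borel G -> R[i]) :=
  [/\ forall i, E (u i), orthonormal mu u &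
      forall (z : G) j, exists a : 'I_n -> R[i],
        forall y : G, u j (y * z)%g = \sum_i a i * u i y].

Lemma conv_eigen_L2 u : E u -> square_integrable mu u.
Proof.
by move=> [cu _]; apply: bmeasurable_square_integrable; exact: ccontinuous_bmeasurable.
Qed.

Lemma orthonormal_coef (I : finType) (u : I -> borel G -> R[i]) (a : I -> R[i]) f :
  (forall i, square_integrable mu (u i)) -> orthonormal mu u ->
  (forall y, f y = \sum_i a i * u i y) -> forall i, ip mu f (u i) = a i.
Proof.
move=> u2 ou /funext -> i; rewrite ip_suml//; last first.
  by move=> j; apply: square_integrableZ.
rewrite (bigD1 i)//= ipZl// ou eqxx mulr1 big1 ?addr0// => j ji.
by rewrite ipZl// ou (negbTE ji) mulr0.
Qed.

Lemma orthonormal_extend n (u : 'I_n -> borel G -> R[i]) w :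
  (forall i, E (u i)) -> orthonormal mu u -> E w ->
  (forall i, ip mu w (u i) = 0) -> ip mu w w != 0 ->
  exists u' : 'I_n.+1 -> borel G -> R[i],
    (forall i, E (u' i)) /\ orthonormal mu u'.
Proof.
move=> eu ou ew wu wn0.
have u2 i := conv_eigen_L2 (eu i); have w2 := conv_eigen_L2 ew.
pose s := (sqrtC (ip mu w w))^-1.
have s2 : s * s * ip mu w w = 1.
  by rewrite -expr2 exprVn sqrtCK mulVf.
have sJ : s^* = s.
  by rewrite conj_Creal// realE invr_ge0 sqrtC_ge0 ip_ge0.
pose w' x := s * w x.
have w'2 : square_integrable mu w' by exact: square_integrableZ.
have w'u i : ip mu w' (u i) = 0 by rewrite ipZl// wu mulr0.
have w'w' : ip mu w' w' = 1 by rewrite ipZl// ipZr// sJ mulrA.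
exists (fun i => if unlift ord0 i is Some j then u j else w'); split=> [i|i j].
  by case: unliftP => [k _|_]; [exact: eu|exact: conv_eigenZ].
case: (unliftP ord0 i) => [i' ->|->]; case: (unliftP ord0 j) => [j' ->|->].
- by rewrite ou (inj_eq lift_inj).
- by rewrite -ip_conj// w'u conjC0 eq_sym (negbTE (neq_lift _ _)).
- by rewrite w'u (negbTE (neq_lift _ _)).
- by rewrite w'w' eqxx.
Qed.

(** By [orthonormal_eigen_bound] some orthonormal family of E has maximal size. It spans E, since
    otherwise [orthonormal_extend] would enlarge it, and E is stable under right translations. The
    function v excludes the empty family. *)
Lemma exists_invariant_family v x : E v -> v x <> 0 ->
  exists n, exists u : 'I_n.+1 -> borel G -> R[i], invariant_family u.
Proof.
move=> ev vx0.
pose P n := `[< exists u : 'I_n -> borel G -> R[i],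
  (forall i, E (u i)) /\ orthonormal mu u >].
have P0 : P 0%N by apply/asboolP; exists (fun _ _ => 0); split=> -[].
have nonnull w y : E w -> w y <> 0 -> ip mu w w != 0.
  move=> ew wy; apply/eqP => w0; apply: wy.
  have [cw _] := ew; apply: (ccontinuous_ae_eq0 compactG haar_mu cw).
  by apply: ip_eq0 => //; exact: conv_eigen_L2.
pose C := Re (ip mu K K) / l ^+ 2.
have Pb n : P n -> (n <= Num.bound C)%N.
  move=> /asboolP[u [eu ou]].
  have := orthonormal_eigen_bound compactG sndG haar_mu bK (lt0r_neq0 l0) eu ou.
  rewrite card_ord -/C => nC; rewrite -(ler_nat R) (le_trans nC)// ltW//.
  by apply: archi_boundP; rewrite (le_trans _ nC).
have exP : exists n, P n by exists 0%N.
case: (ex_maxnP exP Pb) => n /asboolP[u [eu ou]] nmax.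
have u2 i := conv_eigen_L2 (eu i).
have span w : E w -> forall y, w y = \sum_i ip mu w (u i) * u i y.
  move=> ew y; apply: contrapT => wy.
  pose p y := -1 * \sum_i ip mu w (u i) * u i y.
  have ep : E p.
    by apply: conv_eigenZ => //; apply: conv_eigen_sum => // i; apply: conv_eigenZ.
  have ewp : E (fun y => w y + p y) by exact: conv_eigenD.
  have w2 := conv_eigen_L2 ew.
  have pu i : ip mu p (u i) = - ip mu w (u i).
    apply: (@orthonormal_coef _ u (fun i => - ip mu w (u i)) p) => // z.
    by rewrite /p mulN1r -sumrN; apply: eq_bigr => j _; rewrite mulNr.
  have [] := orthonormal_extend eu ou ewp.
  - by move=> i; rewrite ipDl//; [rewrite pu subrr|exact: conv_eigen_L2].
  - apply: nonnull ewp _ => /eqP; rewrite /p mulN1r subr_eq0 => /eqP; exact: wy.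
  move=> u' u'P; have /nmax : P n.+1 by apply/asboolP; exists u'.
  by rewrite ltnn.
case: n => [|n] in u eu ou nmax u2 span *.
  by case: vx0; rewrite (span v ev) big_ord0.
exists n, u; split => // z j; exists (fun i => ip mu (fun y : borel G => u j ((y : G) * z)%g) (u i)).
by move=> y; apply: (span (fun y : borel G => u j ((y : G) * z)%g)); exact: conv_eigen_mulgr.
Qed.

Lemma exists_minimal_invariant_family v x : E v -> v x <> 0 ->
  exists n, (exists u : 'I_n.+1 -> borel G -> R[i], invariant_family u) /\
    forall m (u : 'I_m.+1 -> borel G -> R[i]), invariant_family u -> (n <= m)%N.
Proof.
move=> ev vx; have [n [u iu]] := exists_invariant_family ev vx.
have exP : exists n, `[< exists u : 'I_n.+1 -> borel G -> R[i], invariant_family u >].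
  by exists n; apply/asboolP; exists u.
case: (ex_minnP exP) => m /asboolP[w iw] mmin.
by exists m; split=> [|k h ih]; [exists w|apply: mmin; apply/asboolP; exists h].
Qed.

Section Representation.
Variables (n : nat) (u : 'I_n.+1 -> borel G -> R[i]).
Hypotheses (iu : invariant_family u)
  (nmin : forall m (w : 'I_m.+1 -> borel G -> R[i]), invariant_family w -> (n <= m)%N).

(** The matrix of right translation by z on the span of u: column j holds the coordinates of y |-> u
    j (y z). Right translations compose in the order of the product, so this is a homomorphism. *)
Definition family_mx (z : G) : 'M[R[i]]_n.+1 :=
  \matrix_(i, j) ip mu (fun y : borel G => u j ((y : G) * z)%g) (u i).

Let u2 i : square_integrable mu (u i).
Proof. by case: iu => eu _ _; exact: conv_eigen_L2. Qed.

Let ou : orthonormal mu u. Proof. by case: iu. Qed.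

Let uz2 j (z : G) : square_integrable mu (fun y : borel G => u j ((y : G) * z)%g).
Proof. exact: (preserving_square_integrable (preserving_mulgr sndG haar_mu z) (u2 j)). Qed.

Lemma family_mxE (z y : G) j : u j (y * z)%g = \sum_i family_mx z i j * u i y.
Proof.
have [_ _ /(_ z j)[a ua]] := iu.
rewrite ua; apply: eq_bigr => i _; congr (_ * _).
by rewrite mxE (orthonormal_coef u2 ou ua).
Qed.

Lemma family_mxM (x z : G) : family_mx (x * z)%g = family_mx x *m family_mx z.
Proof.
apply/matrixP => i j; rewrite [LHS]mxE [RHS]mxE.
apply: (orthonormal_coef (a := fun i => \sum_k family_mx x i k * family_mx z k j) u2 ou) => y.
rewrite mulgA family_mxE.
under eq_bigr do rewrite family_mxE mulr_sumr.
rewrite exchange_big; apply: eq_bigr => k _; rewrite mulr_suml.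
by apply: eq_bigr => k' _; rewrite mulrA [_ * family_mx x _ _]mulrC.
Qed.

Lemma family_mx_unitary (x : G) : family_mx x \is unitarymx.
Proof.
apply/unitarymxP; apply: mulmx1C; apply/matrixP => j k; rewrite !mxE.
transitivity (ip mu (fun y : borel G => u k ((y : G) * x)%g)
                    (fun y : borel G => u j ((y : G) * x)%g)).
  have -> : (fun y : borel G => u j ((y : G) * x)%g) =
      (fun y => \sum_i family_mx x i j * u i y).
    by apply/funext => y; rewrite family_mxE.
  rewrite ip_sumr//; last by move=> i; exact: square_integrableZ.
  by apply: eq_bigr => i _; rewrite ipZr// !mxE.
rewrite -[RHS]/((j == k)%:R) eq_sym -ou.
by rewrite -[RHS](preserving_cintegral (preserving_mulgr sndG haar_mu x)
  (ip_integrable (u2 k) (u2 j))).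
Qed.

Lemma family_mx_continuous : continuous family_mx.
Proof.
apply/ccontinuous_mxP => i j; rewrite /family_mx.
under eq_fun do rewrite mxE.
have [eu _ _] := iu.
apply: (ccontinuous_integral (k := fun z : G * G => u j (z.2 * z.1)%g)) => //.
  apply: (ccontinuous_comp (phi := fun z : G * G => (z.2 * z.1)%g)) (eu j).1.
  by apply: continuous_mulg_comp => z; [exact: cvg_snd|exact: cvg_fst].
by apply: square_integrable_integrable; exact: square_integrableJ.
Qed.

(** A nonzero invariant subspace of rank r < n+1, orthonormalised by [schmidt], gives the
    coefficients of an invariant family of r functions, against the minimality of n. *)
Lemma family_mx_irreducible : mx_irreducible family_mx.
Proof.
split => // U stU.
have [->|U0] := eqVneq U 0; first by left.
right; rewrite -col_leq_rank leqNgt; apply/negP => rU.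
set r := \rank U in rU.
pose B : 'M[R[i]]_(r, n.+1) := schmidt (row_base U).
have rn : (r <= n.+1)%N by exact: ltnW.
have BU : (B :=: U)%MS.
  apply: eqmx_trans (eq_row_base U); apply: eqmx_schmidt_free => //.
  exact: row_base_free.
have oB : B *m B^t* = 1%:M by apply/unitarymxP; exact: schmidt_unitarymx.
have r0 : (0 < r)%N by rewrite lt0n mxrank_eq0.
pose w (k : 'I_r) (y : borel G) := \sum_j B k j * u j y.
have [eu _ _] := iu.
have iw : [/\ forall i, E (w i), orthonormal mu w &
      forall (z : G) j, exists a : 'I_r -> R[i],
        forall y : G, w j (y * z)%g = \sum_i a i * w i y].
  split=> [k|k k'|z k].
  - by apply: conv_eigen_sum => // j; apply: conv_eigenZ.
  - have -> : (k == k')%:R = (B *m B^t*) k k' by rewrite oB mxE.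
    rewrite !mxE ip_suml//; last 2 first.
      by move=> j; exact: square_integrableZ.
      by apply: square_integrable_sum => j; exact: square_integrableZ.
    apply: eq_bigr => j _; rewrite ipZl//; last first.
      by apply: square_integrable_sum => j'; exact: square_integrableZ.
    rewrite !mxE; congr (_ * _); rewrite -ip_conj//; last first.
      by apply: square_integrable_sum => j'; exact: square_integrableZ.
    by congr (_^*); apply: (orthonormal_coef (a := B k') u2 ou).
  have : (row k B *m (family_mx z)^T <= B)%MS.
    apply: (submx_trans (submxMr _ (row_sub k B))).
    by rewrite (eqmxMr _ BU) BU; exact: stU.
  move=> /submxP[D hD]; exists (fun i => D 0 i) => y.
  transitivity (\sum_i (row k B *m (family_mx z)^T) 0 i * u i y).
    rewrite /w; under eq_bigr do rewrite family_mxE mulr_sumr.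
    rewrite exchange_big; apply: eq_bigr => i _; rewrite !mxE mulr_suml.
    by apply: eq_bigr => j _; rewrite !mxE mulrA.
  rewrite hD /w; under [RHS]eq_bigr do rewrite mulr_sumr.
  rewrite [RHS]exchange_big; apply: eq_bigr => i _; rewrite !mxE mulr_suml.
  by apply: eq_bigr => j _; rewrite mulrA.
have nmin' m (h : 'I_m -> borel G -> R[i]) : (0 < m)%N -> invariant_family h ->
    (n < m)%N by case: m h => // m h _ /nmin.
by have := nmin' _ w r0 iw; rewrite ltnNge -ltnS rU.
Qed.

Definition family_rep : unirrep R G :=
  Unirrep family_mx_continuous family_mx_unitary family_mxM family_mx_irreducible.

End Representation.

(** With the first factor y equal to 1, the last relation writes each u j as a combination of
    coefficients of rho, so u j cannot be orthogonal to all of them. *)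
Lemma exists_irreducible v x : E v -> v x <> 0 ->
  exists rho : unirrep R G, exists u : 'I_(udim rho) -> borel G -> R[i],
  [/\ forall i, E (u i), orthonormal mu u &
     forall (z y : G) j, u j (y * z)%g = \sum_i rho z i j * u i y].
Proof.
move=> ev vx; have [n [[u iu] nmin]] := exists_minimal_invariant_family ev vx.
exists (family_rep iu nmin), u; split; [by case: iu|by case: iu|] => z y j.
exact: family_mxE.
Qed.

End InvariantFamily.

(** * Completeness of the matrix coefficients *)

Section OpenTranslates.
Context (R : realType) (G : topologicalGroupType) (mu : probability (borel G) R).
Hypotheses (compactG : compact [set: G]) (sndG : @second_countable G)
  (haar_mu : is_haar mu).

(** Open sets are stable under intersection and generate the Borel sets, so the pi-lambda theorem
    extends the vanishing to all Borel sets. *)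
Lemma integral_open_eq0 (g : borel G -> R) :
  mu.-integrable setT (EFin \o g) ->
  (forall U : set G, open U -> (\int[mu]_(x in (U : set (borel G))) (g x)%:E = 0)%E) ->
  g = (fun=> 0) %[ae mu].
Proof.
move=> ig gU.
have mg := measurable_int mu ig.
have gE (S : set (borel G)) : measurable S -> (\int[mu]_(x in S) (g x)%:E = 0)%E.
  apply: (@dynkin_induction _ (borel G) (@open G)
    (fun S => \int[mu]_(x in S) (g x)%:E = 0)%E) => //.
  - by move=> A B oA oB; exact: openI.
  - exact/gU/openT.
  - move=> {}S mS S0.
    have := gU setT openT; rewrite -(setUv S) integral_setU_EFin//.
    + by rewrite S0 add0e.
    + exact: measurableC.
    + by rewrite setUv; exact/measurable_EFinP.
    + by apply/disj_setPCl.
  - move=> F mF tF F0; rewrite integral_bigcup//.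
      by apply: eseries0 => n _ _; exact: F0.
    apply: integrableS ig => //; exact: bigcupT_measurable.
have /(integral_ae_eq measurableT ig (measurable_cst 0%E)) h :
    forall S, S `<=` setT -> measurable S ->
    (\int[mu]_(x in S) (EFin \o g) x = \int[mu]_(x in S) (cst 0%E) x)%E.
  by move=> S _ mS; rewrite integral0; exact: gE.
by apply: filterS h => x /= h t; have [] := h t.
Qed.

Lemma nbhs_sequence (x : G) : exists W : nat -> set G,
  [/\ forall n, nbhs x (W n), forall n m, (n <= m)%N -> W m `<=` W n &
      forall P, nbhs x P -> exists n, W n `<=` P].
Proof.
have [B /pcard_leP[e] [Bo Bx]] := sndG.
(* [D i] is the basic set of code i if there is one and it contains x, and the whole space
   otherwise. *)
pose D i := [set y : G | forall V, B V -> V x -> e V = i -> V y].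
have nD i : nbhs x (D i).
  have [[V [BV Vx eV]]|noV] := pselect (exists V, [/\ B V, V x & e V = i]).
    have nV : nbhs x V by apply: open_nbhs_nbhs; split => //; exact: Bo.
    apply: filterS nV => y Vy V' BV' V'x eV'.
    rewrite (_ : V' = V)//; apply: (@inj _ _ _ e); [exact/mem_set|exact/mem_set|].
    exact: (etrans eV' (esym eV)).
  by apply: filterS filterT => y _ V BV Vx eV; exfalso; apply: noV; exists V.
exists (fun n => [set y | forall i : 'I_n.+1, D i y]); split.
- by move=> n; have := filter_forall _ (fun i : 'I_n.+1 => nD i); apply.
- move=> n m nm y h i; have lt : (i < m.+1)%N by rewrite (leq_trans (ltn_ord i)).
  exact: (h (Ordinal lt)).
- move=> P /Bx[V [BV Vx] VP]; exists (e V) => y h; apply: VP.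
  exact: (h ord_max).
Qed.

(* The open sets A n of the y with W_n y well inside U exhaust U, because the  *)
(* multiplication is continuous at (1, y): no regularity of mu is needed.     *)
Lemma open_translate_measure (U : set G) (eps : R) : open U -> 0 < eps ->
  \forall z \near (1%g : G), (mu (U `\` [set y | U (z * y)%g]) <= eps%:E)%E.
Proof.
move=> oU e0; have [W [nW Wle Wb]] := nbhs_sequence 1%g.
pose A n := (interior [set y : G | forall z, W n z -> U (z * y)%g]).
have oA n : open (A n) by exact: open_interior.
have mA n : measurable (A n : set (borel G)) by exact: open_borel_measurable.
have AU : \bigcup_n A n = U.
  apply/seteqP; split=> [y [n _ /interior_subset/= h]|y Uy].
    by rewrite -[y]mul1g; apply: h; apply: nbhs_singleton.
  have : nbhs ((1%g, y) : G * G) [set z : G * G | U (z.1 * z.2)%g].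
    apply: (mulg_continuous (1%g, y)); apply: open_nbhs_nbhs; split => //=.
    by rewrite mul1g.
  move=> [[P Q] /= [nP nQ] PQ]; have [n Wn] := Wb P nP.
  exists n => //; rewrite /A /interior /=; apply: filterS nQ => y' Qy' z Wz.
  by apply: (PQ (z, y')); split => //=; apply: Wn.
have Acvg : mu \o A @ \oo --> mu (U : set (borel G)).
  rewrite -AU; apply: nondecreasing_cvg_mu => //.
    by rewrite AU; exact: open_borel_measurable.
  move=> n m nm; apply/subsetPset => y; rewrite /A /interior /=.
  by apply: filterS => y' h z Wz; apply: h; apply: Wle Wz.
have muUfin : mu (U : set (borel G)) \is a fin_num.
  by apply: fin_num_measure; exact: open_borel_measurable.
have [n hn] : exists n, (mu ((U : set (borel G)) `\` A n) <= eps%:E)%E.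
  move: Acvg; rewrite -(fineK muUfin) => /fine_cvg/cvgrPdist_le/(_ _ e0)[n _ hn].
  exists n; have := hn n (leqnn n); rewrite ler_norml => /andP[_ h].
  rewrite [X in (X <= _)%E](_ : _ =
    (fine (mu (U : set (borel G))) - fine (mu (A n)))%:E) ?lee_fin//.
  rewrite EFinB !fineK//; last exact: fin_num_measure.
  have mU := open_borel_measurable oU.
  have Ufin : (mu (U : set (borel G)) < +oo)%E by rewrite ltey_eq muUfin.
  have := measureD mU (mA n) Ufin; rewrite setIidr//.
  by rewrite -AU; exact: bigcup_sup.
apply: filterS (nW n) => z Wz; apply: le_trans hn; apply: le_measure.
- rewrite inE; apply: measurableD; first exact: open_borel_measurable.
  by apply: open_borel_measurable; apply: open_comp => // y _;
    apply: continuous_mulg_comp => // ?; [exact: cvg_cst|exact: cvg_id].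
- by rewrite inE; apply: measurableD => //; exact: open_borel_measurable.
by move=> y [Uy nzy]; split => // /interior_subset/= h; apply: nzy; exact: h.
Qed.

End OpenTranslates.

(** * Averages over the translates of an open set *)

Section Translates.
Context (R : realType) (G : topologicalGroupType) (mu : probability (borel G) R).
Hypotheses (compactG : compact [set: G]) (sndG : @second_countable G)
  (haar_mu : is_haar mu).
Implicit Types (U : set G).

Definition translate_indic U (x : G) (y : borel G) : R[i] :=
  (\1_U (x^-1 * (y : G))%g)%:C%C.

Lemma measurable_translate U (x : G) : open U ->
  measurable ([set y | U (x * y)%g] : set (borel G)).
Proof.
move=> oU; rewrite -[X in measurable X]setTI.
exact: (preserving_mulgl haar_mu x).1 (open_borel_measurable oU).
Qed.

Lemma bmeasurable_translate_indic U x : open U -> bmeasurable (translate_indic U x).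
Proof.
move=> oU; split.
  apply: cmeasurable_real.
  have -> : (fun y : borel G => \1_U (x^-1 * (y : G))%g : R) =
     \1_([set y : borel G | U (x^-1 * (y : G))%g]).
    by apply/funext => y; rewrite !indicE; congr (_%:R); apply: congr1;
      apply/idP/idP; rewrite !inE.
  by apply: measurable_indic; exact: measurable_translate.
exists 1 => y; rewrite /translate_indic /= normr0; split => //.
by rewrite indicE; case: (_ \in _); rewrite ?normr1 ?normr0.
Qed.

(** The squared modulus of d is the indicator of the symmetric difference of x U and x0 U. Left
    translation brings each half back into U, in the form estimated by [open_translate_measure]. *)
Lemma translate_indic_dist U (x x0 : G) : open U ->
  let d y := translate_indic U x y - translate_indic U x0 y in
  ip mu d d = (fine (mu (U `\` [set y | U (x^-1 * x0 * y)%g])) +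
               fine (mu (U `\` [set y | U (x0^-1 * x * y)%g])))%:C%C.
Proof.
move=> oU d; rewrite ipE; congr (_%:C%C).
pose A (z : G) : set (borel G) := [set y | U (z^-1 * y)%g].
have mA z : measurable (A z) by exact: measurable_translate.
have AE (z y : G) : \1_U (z^-1 * y)%g = \1_(A z) (y : borel G) :> R.
  by rewrite !indicE; congr (_%:R); apply: congr1; apply/idP/idP; rewrite !inE.
have muD (z z0 : G) : \int[mu]_y \1_(A z0 `\` A z) y =
    fine (mu (U `\` [set y | U (z^-1 * z0 * y)%g])).
  rewrite /Rintegral; congr fine; rewrite integral_indic ?setIT//; last exact: measurableD.
  apply: etrans (esym ((preserving_mulgl haar_mu z0).2 _ (measurableD (mA z0) (mA z)))) _.
  congr (mu _); apply/seteqP; split=> y; rewrite /A /preimage /= mulKg mulgA//.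
rewrite -!muD addrC -RintegralD//; first last.
- by apply: integrable_indic => //; exact: measurableD.
- by apply: integrable_indic => //; exact: measurableD.
apply: eq_Rintegral => y _; rewrite /d /translate_indic ReD ImD ReN ImN /= subr0 expr0n addr0.
rewrite !AE !indicE !in_setD.
by case: (y \in A x); case: (y \in A x0); rewrite /= ?subrr ?subr0 ?sub0r ?sqrrN ?expr1n ?expr0n ?addr0 ?add0r.
Qed.

Lemma ccontinuous_translate U f : open U -> square_integrable mu f ->
  ccontinuous (fun x : G => ip mu f (translate_indic U x)).
Proof.
move=> oU f2.
have J2 x : square_integrable mu (translate_indic U x).
  by apply: bmeasurable_square_integrable; exact: bmeasurable_translate_indic.
have key x0 (e : R) : 0 < e -> \forall x \near x0,
   `|Re (ip mu f (translate_indic U x0) - ip mu f (translate_indic U x))| <= e /\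
   `|Im (ip mu f (translate_indic U x0) - ip mu f (translate_indic U x))| <= e.
  move=> e0; have /complexR_ge0 fE := ip_ge0 mu f.
  have C0 : 0 <= Re (ip mu f f) by have := ip_ge0 mu f; rewrite lecE => /andP[].
  move: (Re _) fE C0 => C fE C0.
  (* Chosen so that C (2 d) <= e^2, where C is the squared norm of f and 2 d bounds the squared
     distance between the indicators; the added 1 covers C = 0. *)
  pose d := e ^+ 2 / (2 * (C + 1)).
  have C1 : 0 < C + 1 by rewrite ltr_wpDl.
  have d0 : 0 < d by rewrite divr_gt0 ?exprn_gt0 ?mulr_gt0.
  have hz := open_translate_measure mu sndG oU d0.
  have c1 : continuous (fun x : G => (x^-1 * x0)%g).
    by apply: continuous_mulg_comp => x; [exact: invg_continuous|exact: cvg_cst].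
  have c2 : continuous (fun x : G => (x0^-1 * x)%g).
    by apply: continuous_mulg_comp => x; [exact: cvg_cst|exact: cvg_id].
  have cz1 : (fun x : G => (x^-1 * x0)%g) @ x0 --> (x0^-1 * x0)%g := c1 x0.
  have cz2 : (fun x : G => (x0^-1 * x)%g) @ x0 --> (x0^-1 * x0)%g := c2 x0.
  rewrite mulVg in cz1; rewrite mulVg in cz2.
  have n1 : \forall x \near x0,
    (mu (U `\` [set y | U (x^-1 * x0 * y)%g]) <= d%:E)%E := cz1 _ hz.
  have n2 : \forall x \near x0,
    (mu (U `\` [set y | U (x0^-1 * x * y)%g]) <= d%:E)%E := cz2 _ hz.
  apply: filterS2 n1 n2 => x h1 h2.
  apply: normc_sqr_le; first exact: ltW.
  rewrite -ipBr//; apply: le_trans (cauchy_schwarz f2 (square_integrableB (J2 x0) (J2 x))) _.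
  rewrite translate_indic_dist// fE -real_complexM lecR.
  have fin (S : set (borel G)) : measurable S -> (mu S <= d%:E)%E -> fine (mu S) <= d.
    by move=> mS h; rewrite -lee_fin fineK// fin_num_measure.
  have mS (z : G) : measurable ((U `\` [set y | U (z * y)%g]) : set (borel G)).
    by apply: measurableD; [exact: open_borel_measurable|exact: measurable_translate].
  apply: (@le_trans _ _ (C * (d + d))).
    by rewrite ler_wpM2l// lerD//; exact: fin.
  have -> : d + d = e ^+ 2 / (C + 1) by rewrite /d; field; rewrite gt_eqF.
  by rewrite mulrCA ler_piMr ?sqr_ge0// ler_pdivrMr// mul1r lerDl.
split=> x0; apply/cvgrPdist_le => e e0; apply: filterS (key x0 e e0) => x [].
- by move=> + _; rewrite ReD ReN.
- by move=> _; rewrite ImD ImN.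
Qed.

End Translates.

(** * Matrix-valued Fourier coefficients *)

Section FourierCoefficients.
Context (R : realType) (G : topologicalGroupType) (mu : probability (borel G) R).
Hypotheses (compactG : compact [set: G]) (sndG : @second_countable G)
  (haar_mu : is_haar mu).
Implicit Types (f g : borel G -> R[i]) (pi rho : unirrep R G).

(** The entrywise conjugate of pi applied to the conjugate of f. Conjugation without transposition
    keeps the order of the factors in [fourier_conv]. *)
Definition fourier pi f : 'M[R[i]]_(udim pi) :=
  \matrix_(i, j) ip mu f (fun y : borel G => pi y i j).

Lemma unirrep_ccontinuous pi i j : ccontinuous (fun x : G => pi x i j).
Proof. exact: ((ccontinuous_mxP _).1 (@umx_continuous _ _ pi)). Qed.

Lemma unirrep_bmeasurable pi i j : bmeasurable (fun x : borel G => pi x i j).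
Proof. by apply: ccontinuous_bmeasurable => //; exact: unirrep_ccontinuous. Qed.

Lemma unirrep_L2 pi i j : square_integrable mu (fun x : borel G => pi x i j).
Proof. by apply: bmeasurable_square_integrable; exact: unirrep_bmeasurable. Qed.

Lemma bmeasurableJ f : bmeasurable f -> bmeasurable (fun x => (f x)^*).
Proof.
move=> [mf [M fM]]; split; first exact: cmeasurableJ.
by exists M => x; rewrite ReJ ImJ normrN.
Qed.

Lemma fourier_conv pi f g : cintegrable mu f -> cintegrable mu g ->
  (forall x : G, cintegrable mu (fun y => f (x * (y : G)^-1)%g * g y)) ->
  fourier pi (conv mu f g) = fourier pi f *m fourier pi g.
Proof.
move=> If Ig fg; apply/matrixP => i j; rewrite !mxE /ip.
have bJ (k k' : 'I_(udim pi)) := bmeasurableJ (unirrep_bmeasurable k k').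
have ifJ h k k' : cintegrable mu h -> cintegrable mu (fun y => h y * (pi y k k')^*).
  move=> Ih; have [b1 b2] := bJ k k'.
  by have := cintegrableMb Ih b1 b2; under eq_fun do rewrite mulrC.
under cintegral_ext do rewrite mulrC.
rewrite (conv_fubini sndG haar_mu If Ig (bJ i j) fg).
transitivity (cintegral mu (fun y => \sum_k
   (cintegral mu (fun x => f x * (pi x i k)^*)) * (g y * (pi y k j)^*))).
  apply: cintegral_ext => y; rewrite -[RHS]mul1r.
  transitivity (cintegral mu (fun x : borel G => \sum_k (pi y k j)^* * (f x * (pi x i k)^*)) * g y).
    congr (_ * _); apply: cintegral_ext => x; rewrite umxM mxE rmorph_sum mulr_suml.
    by apply: eq_bigr => k _; rewrite rmorphM /=; ring.
  rewrite cintegral_sum => [|k]; last by apply: cintegrableZ; exact: ifJ.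
  rewrite mul1r mulr_suml; apply: eq_bigr => k _; rewrite cintegralZ ?ifJ//; first by ring.
  exact: ifJ.
rewrite cintegral_sum => [|k]; last by apply: cintegrableZ; exact: ifJ.
by apply: eq_bigr => k _; rewrite !mxE cintegralZ//; exact: ifJ.
Qed.

End FourierCoefficients.

Section Completeness.
Context (R : realType) (G : topologicalGroupType) (mu : probability (borel G) R).
Hypotheses (compactG : compact [set: G]) (sndG : @second_countable G)
  (haar_mu : is_haar mu).
Implicit Types (f g : borel G -> R[i]) (pi rho : unirrep R G).

Lemma continuous_completeness g : ccontinuous (g : G -> R[i]) ->
  (forall rho, fourier mu rho g = 0) -> forall x, g x = 0.
Proof.
move=> cg hg x; apply: contrapT => gx.
have bg := ccontinuous_bmeasurable compactG cg.
have ig := bmeasurable_integrable mu bg.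
have bag := bmeasurable_adj bg; have iag := bmeasurable_integrable mu bag.
have g2 := bmeasurable_square_integrable mu bg.
pose F := conv mu g (adj g).
have cF : ccontinuous (F : G -> R[i]) by apply: ccontinuous_conv.
have bF := ccontinuous_bmeasurable compactG cF.
have iF := bmeasurable_integrable mu bF.
have aF : adj F = F by rewrite /F (adj_conv sndG haar_mu bg bag) adjK.
have F0 : exists x, F x <> 0.
  (* By [ip_conv], F 1 is the squared norm of [adj g], equal to that of g by invariance under
     inversion. *)
  exists 1%g; have -> : F 1%g = ip mu g g.
    rewrite -(ip_adj sndG haar_mu g2) ip_conv adjK.
    by congr (conv mu _ _ _).
  move=> gg0; apply: gx; apply: (ccontinuous_ae_eq0 compactG haar_mu cg).
  exact: ip_eq0.
have [l [u [l0 cu u1 hu]]] := conv_eigenfunction compactG sndG haar_mu cF aF F0.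
have cK : ccontinuous (conv mu F F : G -> R[i]) by apply: ccontinuous_conv.
have bK := ccontinuous_bmeasurable compactG cK.
have iK := bmeasurable_integrable mu bK.
have [rho [v [ev ov vE]]] := exists_irreducible compactG sndG haar_mu cK l0 (conj cu hu) u1.
have FF : fourier mu rho F = 0.
  rewrite (fourier_conv compactG sndG haar_mu rho ig iag) ?hg ?mul0mx// => y.
  exact: conv_integrand_bl.
have KF : fourier mu rho (conv mu F F) = 0.
  rewrite (fourier_conv compactG sndG haar_mu rho iF iF) ?FF ?mul0mx// => y.
  exact: conv_integrand_bl.
have v2 i : square_integrable mu (v i) by exact: conv_eigen_L2 (ev i).
(* The coefficients of F * F vanish and [fourier] is multiplicative, so l times those of v i vanish
   too. *)
have vF i : fourier mu rho (v i) = 0.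
  have iv := square_integrable_integrable (v2 i).
  have : fourier mu rho (conv mu (conv mu F F) (v i)) = 0.
    rewrite (fourier_conv compactG sndG haar_mu rho iK iv) ?KF ?mul0mx// => y.
    exact: conv_integrand_bl.
  have -> : conv mu (conv mu F F) (v i) = (fun y => l%:C%C * v i y).
    by apply/funext => y; exact: (ev i).2.
  move=> h; apply/matrixP => a b; move/matrixP/(_ a b): h; rewrite !mxE.
  rewrite ipZl//; last exact: unirrep_L2.
  have lC : l%:C%C != 0 :> R[i] by rewrite gt_eqF// ltcR.
  by move/eqP; rewrite mulf_eq0 (negbTE lC) => /eqP.
have [n0 _] := umx_irr rho; pose j := Ordinal n0.
have := ov j j; rewrite eqxx.
have -> : ip mu (v j) (v j) = ip mu (v j) (fun y => \sum_i v i 1%g * rho y i j).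
  congr (ip mu _ _); apply/funext => y; rewrite -{1}[y]mul1g vE.
  by apply: eq_bigr => i _; rewrite mulrC.
rewrite ip_sumr// => [|i]; last by apply: square_integrableZ; exact: unirrep_L2.
rewrite big1 => [/eqP|i _]; first by rewrite eq_sym oner_eq0.
rewrite ipZr//; last exact: unirrep_L2.
by have /matrixP/(_ i j) := vF j; rewrite !mxE => ->; rewrite mulr0.
Qed.

Lemma completeness f : square_integrable mu f ->
  (forall rho, fourier mu rho f = 0) -> f = (fun=> 0) %[ae mu].
Proof.
move=> f2 hf; have If := square_integrable_integrable f2.
have hU (U : set G) : open U -> ip mu f (translate_indic R U 1%g) = 0.
  (* With h(y) = 1_U(y^-1), the averages of f over the translates x U form the convolution of f and
     h, and so inherit the vanishing coefficients. Their value at 1 is the integral of f over U. *)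
  move=> oU; pose h (y : borel G) := translate_indic R U 1%g ((y : G)^-1)%g : R[i].
  have bh : bmeasurable h.
    apply: (bmeasurable_comp (phi := fun y : G => y^-1%g)).
      exact: measurable_invg.
    exact: (bmeasurable_translate_indic haar_mu).

  have kE : (fun x : G => ip mu f (translate_indic R U x)) = conv mu f h.
    apply/funext => x.
    have b0 := bmeasurable_translate_indic haar_mu x oU.
    have i0 := ip_integrable f2 (bmeasurable_square_integrable mu b0).
    rewrite /ip -(preserving_cintegral (preserving_divg sndG haar_mu x) i0).
    apply: cintegral_ext => y; congr (_ * _).
    by rewrite /h /translate_indic real_complexJ mulKg invg1 mul1g.
  have k0 := continuous_completeness (ccontinuous_translate sndG haar_mu oU f2).
  apply: (k0 _ 1%g) => rho; rewrite kE (fourier_conv compactG sndG haar_mu) ?hf ?mul0mx//.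
    exact: bmeasurable_integrable.
  by move=> x; exact: conv_integrand_br.
have [ir ii] := If.
have part (U : set G) (oU : open U) :
    (\int[mu]_(x in (U : set (borel G))) (Re (f x))%:E = 0)%E /\
    (\int[mu]_(x in (U : set (borel G))) (Im (f x))%:E = 0)%E.
  have mU := open_borel_measurable oU.
  have JE y : translate_indic R U 1%g y = (\1_U (y : G))%:C%C :> R[i].
    by rewrite /translate_indic invg1 mul1g.
  have fin (g : borel G -> R) : mu.-integrable setT (EFin \o g) ->
     \int[mu]_x (g x * \1_U x) = 0 ->
     (\int[mu]_(x in (U : set (borel G))) (g x)%:E = 0)%E.
    move=> ig g0; rewrite -[LHS]fineK; last first.
      by apply: integrable_fin_num => //; exact: integrableS ig.
    congr (_%:E); rewrite -[RHS]g0 -[LHS]/(Rintegral mu U g) Rintegral_mkcond.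
    by congr (Rintegral _ _ _); apply/funext => x; rewrite patchE indicE;
      case: ifP => _; rewrite ?mulr1 ?mulr0.
  have h := hU U oU; split; apply: fin => //.
  - have /(congr1 (@complex.Re R)) /= := h; move=> <-; apply: eq_Rintegral => x _.
    by rewrite JE ReM ReJ ImJ /= oppr0 mulr0 subr0.
  - have /(congr1 (@complex.Im R)) /= := h; move=> <-; apply: eq_Rintegral => x _.
    by rewrite JE ImM ReJ ImJ /= oppr0 mulr0 add0r.
have r0 := integral_open_eq0 ir (fun U oU => (part U oU).1).
have i0 := integral_open_eq0 ii (fun U oU => (part U oU).2).
by apply: filterS2 r0 i0 => x /= h1 h2 t; apply: complex_eqP; [exact: h1|exact: h2].
Qed.

Lemma fourier_equiv pi rho f : square_integrable mu f -> urep_equiv pi rho ->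
  fourier mu pi f = 0 -> fourier mu rho f = 0.
Proof.
move=> f2 [U [/unitarymxP UU _ hU]] pf.
have rhoE x : rho x = U *m pi x *m U^t* by rewrite hU -mulmxA UU mulmx1.
apply/matrixP => i j; rewrite !mxE.
have -> : (fun y : borel G => rho y i j) =
    (fun y => \sum_k \sum_m (U i m * U^t* k j) * pi y m k).
  apply/funext => y; rewrite rhoE mxE; apply: eq_bigr => k _.
  rewrite mxE mulr_suml; apply: eq_bigr => m _; by ring.
have p2 m k c : square_integrable mu (fun y => c * pi y m k).
  by apply: square_integrableZ; exact: unirrep_L2.
rewrite ip_sumr// => [|k]; last exact: square_integrable_sum.
rewrite big1// => k _; rewrite ip_sumr// big1// => m _.
rewrite ipZr//; last exact: unirrep_L2.
by have /matrixP/(_ m k) := pf; rewrite !mxE => ->; rewrite mulr0.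
Qed.

Lemma dual_completeness (Ghat : set (unirrep R G)) f : unitary_dual Ghat ->
  square_integrable mu f -> (forall pi, Ghat pi -> fourier mu pi f = 0) ->
  f = (fun=> 0) %[ae mu].
Proof.
move=> dualG f2 hf; apply: completeness => // rho.
have [pi [[Gpi eq] _]] := dualG rho.
exact: fourier_equiv f2 eq (hf pi Gpi).
Qed.

End Completeness.

(** * Schur orthogonality *)

Section Schur.
Context (R : realType) (G : topologicalGroupType).
Implicit Types (pi rho : unirrep R G).

Lemma umx_mulV pi (x : G) : pi x *m (pi x)^t* = 1%:M.
Proof. exact/unitarymxP/umx_unitary. Qed.

Lemma umx_Vmul pi (x : G) : (pi x)^t* *m pi x = 1%:M.
Proof. by apply: mulmx1C; exact: umx_mulV. Qed.

Lemma umx1 pi : pi 1%g = 1%:M.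
Proof.
have := umxM pi 1%g 1%g; rewrite mulg1 => h.
by rewrite -(umx_mulV pi 1%g) {2}h -mulmxA umx_mulV mulmx1.
Qed.

Lemma umxV pi (x : G) : pi (x^-1)%g = (pi x)^t*.
Proof. by rewrite -[LHS]mulmx1 -(umx_mulV pi x) mulmxA -umxM mulVg umx1 mul1mx. Qed.

(** Schur's lemma: X has an eigenvalue, and the corresponding eigenspace is invariant, hence
    everything. *)
Lemma commutant_scalar pi (X : 'M[R[i]]_(udim pi)) :
  (forall x, pi x *m X = X *m pi x) -> exists a, X = a%:M.
Proof.
move=> comm; have [d0 irr] := umx_irr pi.
have [a ev] := eigenvalue_closed X^T d0.
have [x|/eqP U0|full] := irr (eigenspace X^T a).
- apply/eigenspaceP.
  have /eigenspaceP h := submx_refl (eigenspace X^T a).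
  by rewrite -mulmxA -trmx_mul -comm trmx_mul mulmxA h scalemxAl.
- by have := ev; rewrite /eigenvalue U0.
exists a; apply/trmx_inj; rewrite tr_scalar_mx.
have /eigenspaceP : (1%:M <= eigenspace X^T a)%MS by rewrite sub1mx.
by rewrite mul1mx scalemx1.
Qed.

(** The kernel of X^T is invariant, so X^T is free. The product of X with its adjoint commutes with
    pi, so it is a scalar a, positive as a sum of squared moduli. The adjoint divided by sqrt a is
    unitary on both sides, since it can be cancelled on the right. *)
Lemma schur_intertwiner pi rho (X : 'M[R[i]]_(udim pi, udim rho)) :
  (forall x, pi x *m X = X *m rho x) -> X != 0 -> urep_equiv pi rho.
Proof.
move=> comm X0; have [_ irrp] := umx_irr pi; have [_ irrr] := umx_irr rho.
have freeX : row_free X^T.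
  rewrite -kermx_eq0; have [x| -> //|full] := irrr (kermx X^T).
    apply/sub_kermxP.
    by rewrite -mulmxA -trmx_mul -comm trmx_mul mulmxA mulmx_ker mul0mx.
  move: full; rewrite -sub1mx => /sub_kermxP; rewrite mul1mx => /eqP.
  by rewrite trmx_eq0 (negbTE X0).
have commJ x : X^t* *m pi x = rho x *m X^t*.
  have := congr1 (fun M => M^t*) (comm (x^-1)%g).
  by rewrite !trmx_mul !map_mxM /= !umxV !trmxCK.
have [x|a Za] := @commutant_scalar pi (X *m X^t*).
  by rewrite mulmxA comm -mulmxA -commJ mulmxA.
have aE i : a = \sum_k `|X i k| ^+ 2.
  have := congr1 (fun M : 'M[R[i]]_(udim pi) => M i i) Za; rewrite !mxE eqxx mulr1n => <-.
  by apply: eq_bigr => k _; rewrite !mxE normCK.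
have [i [k Xik]] : exists i, exists k, X i k != 0.
  apply: contrapT => h; move/eqP: X0; apply; apply/matrixP => i k; rewrite mxE.
  by apply/eqP; apply: contrapT => /negP Xik; apply: h; exists i, k.
have a0 : 0 < a.
  rewrite (aE i) (bigD1 k)//= ltr_wpDr// ?exprn_gt0 ?normr_gt0//.
  by apply: sumr_ge0 => j _; rewrite exprn_ge0.
pose s := (sqrtC a)^-1.
have s2 : s * s * a = 1 by rewrite -expr2 exprVn sqrtCK mulVf// gt_eqF.
have sJ : s^* = s by rewrite conj_Creal// realE invr_ge0 sqrtC_ge0 ltW.
pose U : 'M[R[i]]_(udim rho, udim pi) := s *: X^t*.
have UJ : U^t* = s *: X.
  by apply/matrixP => b c; rewrite !mxE rmorphM /= sJ conjCK.
exists U; split.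
- apply/unitarymxP; rewrite UJ -scalemxAl -scalemxAr scalerA.
  have free' : row_free (X^t*) by rewrite row_free_map.
  move/row_free_inj: free'; apply; rewrite mul1mx -scalemxAl -mulmxA Za.
  by rewrite mul_mx_scalar scalerA s2 scale1r.
- apply/unitarymxP; rewrite trmxCK UJ -scalemxAl -scalemxAr scalerA Za.
  by rewrite scale_scalar_mx s2.
- by move=> x; rewrite -scalemxAl commJ scalemxAr.
Qed.

Lemma urep_equiv_refl pi : urep_equiv pi pi.
Proof.
exists 1%:M; split=> [||x]; try by apply/unitarymxP; rewrite ?trmx1 ?map_mx1 ?trmx1 ?map_mx1 mulmx1.
by rewrite mulmx1 mul1mx.
Qed.

Variable (mu : probability (borel G) R).
Hypotheses (compactG : compact [set: G]) (haar_mu : is_haar mu).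

(** Y is the average over y of [pi y *m delta_mx j l *m (rho y)^t*], which left invariance makes an
    intertwiner. *)
Lemma coef_intertwine pi rho j l (x : G) :
  let Y := \matrix_(i, k) ip mu (fun y : borel G => pi y i j)
                                (fun y : borel G => rho y k l) in
  pi x *m Y = Y *m rho x.
Proof.
move=> Y.
have p2 i k : square_integrable mu (fun y : borel G => pi y i k) by exact: unirrep_L2.
have r2 i k : square_integrable mu (fun y : borel G => rho y i k) by exact: unirrep_L2.
suff YE : pi x *m Y *m (rho x)^t* = Y.
  by rewrite -[in RHS]YE -mulmxA umx_Vmul mulmx1.
apply/matrixP => i k; rewrite [RHS]mxE.
apply: etrans (preserving_cintegral (preserving_mulgl haar_mu x) (ip_integrable (p2 i j) (r2 k l))).
transitivity (ip mu (fun y => \sum_a pi x i a * pi y a j) (fun y => \sum_b rho x k b * rho y b l)).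
  rewrite ip_suml//; first last.
  - by apply: square_integrable_sum => b; exact: square_integrableZ.
  - by move=> a; exact: square_integrableZ.
  rewrite mxE; under eq_bigr do rewrite !mxE mulr_suml.
  rewrite exchange_big; apply: eq_bigr => a _; rewrite ipZl//; last first.
    by apply: square_integrable_sum => b; exact: square_integrableZ.
  rewrite ip_sumr// => [|b]; last exact: square_integrableZ.
  rewrite mulr_sumr; apply: eq_bigr => b _; rewrite ipZr// !mxE; ring.
by apply: cintegral_ext => y; rewrite !umxM !mxE.
Qed.

Lemma orthogonal_inequiv pi rho i j k l : ~ urep_equiv pi rho ->
  ip mu (fun y : borel G => pi y i j) (fun y : borel G => rho y k l) = 0.
Proof.
move=> neq; have := @coef_intertwine pi rho j l; set Y := \matrix_(_, _) _ => comm.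
have [Y0|Yn0] := eqVneq Y 0; last by case: neq; exact: schur_intertwiner comm Yn0.
by have /matrixP/(_ i k) := Y0; rewrite !mxE.
Qed.

Lemma orthogonal_equal pi i j k l :
  ip mu (fun y : borel G => pi y i j) (fun y : borel G => pi y k l) =
  ((i == k) && (j == l))%:R / (udim pi)%:R.
Proof.
have := @coef_intertwine pi pi j l; set Y := \matrix_(_, _) _ => /commutant_scalar[a Ya].
have p2 a' b : square_integrable mu (fun y : borel G => pi y a' b) by exact: unirrep_L2.
have [d0 _] := umx_irr pi.
have dn0 : (udim pi)%:R != 0 :> R[i] by rewrite pnatr_eq0 -lt0n.
(* The scalar is found from the trace: under the integral it is the entry (l, j) of
   [(pi y)^t* *m pi y], constant by unitarity. *)
have trY : a * (udim pi)%:R = (j == l)%:R.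
  have <- : \tr Y = a * (udim pi)%:R by rewrite Ya mxtrace_scalar mulr_natr.
  rewrite -(cintegral_cst mu (j == l)%:R) /mxtrace.
  under eq_bigr do rewrite mxE.
  rewrite -cintegral_sum => [|m]; last exact: ip_integrable.
  apply: cintegral_ext => y; have := congr1 (fun M : 'M[R[i]]_(udim pi) => M l j) (umx_Vmul pi y).
  rewrite !mxE eq_sym => <-; apply: eq_bigr => m _; rewrite !mxE mulrC //.
have /matrixP/(_ i k) := Ya; rewrite !mxE => ->.
have -> : a = (j == l)%:R / (udim pi)%:R by rewrite -trY mulfK.
by case: (i == k); rewrite ?mulr1n ?mulr0n ?mul0r.
Qed.

End Schur.

(** * Cayley operators *)

Section TrigonometricPolynomials.
Context (R : realType) (G : topologicalGroupType) (mu : probability (borel G) R).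
Hypotheses (compactG : compact [set: G]) (sndG : @second_countable G)
  (haar_mu : is_haar mu).
Implicit Types (pi rho : unirrep R G).

(** This is the trace of [B^T *m pi x]. For B equal to d_pi times the Fourier matrix of f, it is the
    component of f along the coefficients of pi. *)
Definition trig pi (B : 'M[R[i]]_(udim pi)) (x : borel G) : R[i] :=
  \sum_i \sum_j B i j * pi x i j.

Lemma trig_ccontinuous pi (B : 'M[R[i]]_(udim pi)) : ccontinuous (trig B : G -> R[i]).
Proof.
apply: ccontinuous_sum => i; apply: ccontinuous_sum => j; apply: ccontinuousZ.
exact: (unirrep_ccontinuous (pi := pi)).
Qed.

Lemma trig_L2 pi (B : 'M[R[i]]_(udim pi)) : square_integrable mu (trig B).
Proof.
apply: bmeasurable_square_integrable; apply: ccontinuous_bmeasurable => //.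
exact: trig_ccontinuous.
Qed.

Lemma fourier_trig_inequiv pi rho (B : 'M[R[i]]_(udim pi)) : ~ urep_equiv pi rho ->
  fourier mu rho (trig B) = 0.
Proof.
move=> neq; apply/matrixP => k l; rewrite !mxE.
have p2 i j c : square_integrable mu (fun y : borel G => c * pi y i j).
  by apply: square_integrableZ; exact: unirrep_L2.
have r2 : square_integrable mu (fun y : borel G => rho y k l) by exact: unirrep_L2.
rewrite ip_suml// => [|i]; last exact: square_integrable_sum.
rewrite big1// => i _; rewrite ip_suml// big1// => j _.
by rewrite ipZl ?orthogonal_inequiv ?mulr0//; exact: unirrep_L2.
Qed.

Lemma fourier_trig pi (B : 'M[R[i]]_(udim pi)) : fourier mu pi (trig B) = (udim pi)%:R^-1 *: B.
Proof.
apply/matrixP => k l; rewrite !mxE.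
have p2 i j c : square_integrable mu (fun y : borel G => c * pi y i j).
  by apply: square_integrableZ; exact: unirrep_L2.
have r2 : square_integrable mu (fun y : borel G => pi y k l) by exact: unirrep_L2.
rewrite ip_suml// => [|i]; last exact: square_integrable_sum.
have e i j : ip mu (fun y : borel G => B i j * pi y i j) (fun y : borel G => pi y k l) =
    ((i == k) && (j == l))%:R * (B i j / (udim pi)%:R).
  by rewrite ipZl ?orthogonal_equal//; [ring|exact: unirrep_L2].
rewrite (bigD1 k)//= [X in _ + X]big1 ?addr0 => [|i ik]; last first.
  by rewrite ip_suml// big1// => j _; rewrite e (negbTE ik) mul0r.
rewrite ip_suml// (bigD1 l)//= big1 ?addr0 => [|j jl]; last first.
  by rewrite e (negbTE jl) andbF mul0r.
by rewrite e !eqxx mul1r mulrC.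
Qed.

Variables (J : finType) (p : J -> unirrep R G).

Definition trig_sum (B : forall j, 'M[R[i]]_(udim (p j))) (x : borel G) : R[i] :=
  \sum_j trig (B j) x.

Lemma trig_sum_L2 B : square_integrable mu (trig_sum B).
Proof. by apply: square_integrable_sum => j; exact: trig_L2. Qed.

Lemma fourier_trig_sum_inequiv B rho : (forall j, ~ urep_equiv (p j) rho) ->
  fourier mu rho (trig_sum B) = 0.
Proof.
move=> neq; apply/matrixP => k l; rewrite !mxE ip_suml//; first last.
- exact: unirrep_L2.
- by move=> j; exact: trig_L2.
rewrite big1// => j _; have /matrixP/(_ k l) := fourier_trig_inequiv (B j) (neq j).
by rewrite !mxE.
Qed.

Lemma fourier_trig_sum B j : (forall j', j' != j -> ~ urep_equiv (p j') (p j)) ->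
  fourier mu (p j) (trig_sum B) = (udim (p j))%:R^-1 *: B j.
Proof.
move=> neq; rewrite -fourier_trig; apply/matrixP => k l; rewrite !mxE ip_suml//; first last.
- exact: unirrep_L2.
- by move=> j'; exact: trig_L2.
rewrite (bigD1 j)//= big1 ?addr0// => j' j'j.
have /matrixP/(_ k l) := fourier_trig_inequiv (B j') (neq j' j'j).
by rewrite !mxE.
Qed.

End TrigonometricPolynomials.

(** * The action of T_w on Fourier coefficients *)

Section CayleyOperator.
Context (R : realType) (G : topologicalGroupType) (mu : probability (borel G) R).
Hypotheses (compactG : compact [set: G]) (sndG : @second_countable G)
  (haar_mu : is_haar mu).
Variables (gamma : G -> R).
Hypothesis cayley_gamma : cayley_function gamma.
Implicit Types (pi rho : unirrep R G).

Let Tw := integral_op mu (cayley_graphon gamma).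
Let gC (x : borel G) : R[i] := (gamma x)%:C%C.
Let pg pi := urep_fun mu pi (fun x => (gamma x)%:C%C).

Lemma Tw_conv : Tw = conv mu gC. Proof. by []. Qed.

Lemma bmeasurable_gamma : bmeasurable gC.
Proof.
have [mg g01 _] := cayley_gamma; split; first exact: cmeasurable_real.
exists 1 => x; rewrite /gC /= normr0; split => //.
by have /andP[g0 g1] := g01 x; rewrite ger0_norm.
Qed.

(** Since gamma is real and symmetric, the substitution y |-> y^-1 exchanges pi(gamma) and its
    adjoint. *)
Lemma urep_fun_hermitian pi : (pg pi)^t* = pg pi.
Proof.
have [_ _ gV] := cayley_gamma.
apply/matrixP => i j; rewrite !mxE -cintegralJ; last first.
  have [b1 b2] := unirrep_bmeasurable compactG (pi := pi) j i.
  have := cintegrableMb (bmeasurable_integrable mu bmeasurable_gamma) b1 b2.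
  by under eq_fun do rewrite mulrC.
rewrite -[RHS](preserving_cintegral (preserving_invg sndG haar_mu)); last first.
  have [b1 b2] := unirrep_bmeasurable compactG (pi := pi) i j.
  have := cintegrableMb (bmeasurable_integrable mu bmeasurable_gamma) b1 b2.
  by under eq_fun do rewrite mulrC.
by apply: cintegral_ext => y; rewrite rmorphM /= real_complexJ -gV umxV !mxE.
Qed.

(** As gamma is real, its Fourier matrix is the conjugate of pi(gamma), and for a hermitian matrix
    this is the transpose. *)
Lemma fourier_gamma pi : fourier mu pi gC = (pg pi)^T.
Proof.
rewrite -urep_fun_hermitian; apply/matrixP => i j; rewrite !mxE -cintegralJ; last first.
  have [b1 b2] := unirrep_bmeasurable compactG (pi := pi) i j.
  have := cintegrableMb (bmeasurable_integrable mu bmeasurable_gamma) b1 b2.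
  by under eq_fun do rewrite mulrC.
by apply: cintegral_ext => y; rewrite rmorphM /= real_complexJ.
Qed.

Lemma conj_urep_fun pi : map_mx Num.conj (pg pi) = (pg pi)^T.
Proof. by rewrite -[in RHS]urep_fun_hermitian map_trmx trmxK. Qed.

Lemma hermitian_spec_real n (A : 'M[R[i]]_n) a : A^t* = A ->
  mx_spec A a -> a^* = a.
Proof.
move=> hA [v [v0 Av]]; pose N := (v^t* *m v) 0 0.
have NE : N = \sum_k `|v k 0| ^+ 2.
  by rewrite /N mxE; apply: eq_bigr => k _; rewrite !mxE mulrC normCK.
have N0 : N != 0.
  rewrite NE psumr_eq0 => [|k _]; last exact: exprn_ge0.
  apply: contra v0 => /allP h; apply/eqP/matrixP => k l; rewrite ord1 mxE.
  have /implyP/(_ isT) := h k (mem_index_enum _).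
  by rewrite expf_eq0 /= normr_eq0 => /eqP.
have h1 : v^t* *m A *m v = a *: (v^t* *m v) by rewrite -mulmxA Av scalemxAr.
have h2 : v^t* *m A *m v = a^* *: (v^t* *m v).
  have -> : v^t* *m A = (A *m v)^t* by rewrite trmx_mul map_mxM /= hA.
  by rewrite Av; apply/matrixP => i j; rewrite !mxE mulr_sumr; apply: eq_bigr => k _;
    rewrite !mxE rmorphM /= mulrA.
have := congr1 (fun M : 'M[R[i]]_1 => M 0 0) (etrans (esym h1) h2).
by rewrite mxE [RHS]mxE => /(mulIf N0).
Qed.

(** The substitution y |-> x y^-1 yields the integral of gamma(y) pi(y^-1 x), that is pi(gamma)
    pi(x). Moving this left factor onto B under the trace transposes it. *)
Lemma Tw_trig pi (B : 'M[R[i]]_(udim pi)) x : Tw (trig B) x = trig ((pg pi)^T *m B) x.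
Proof.
have bJ k k' := unirrep_bmeasurable compactG (pi := pi) k k'.
have ig : cintegrable mu gC := bmeasurable_integrable mu bmeasurable_gamma.
have coef i j : conv mu gC (fun y => pi y i j) x = \sum_k (pg pi) i k * pi x k j.
  have I1 (z : G) : bmeasurable (fun y : borel G => pi ((y : G)^-1 * z)%g i j).
    apply: (bmeasurable_comp (phi := fun y : G => (y^-1 * z)%g)) (bJ i j).
    apply: continuous_measurable_borel; apply: continuous_mulg_comp => y.
    + exact: invg_continuous.
    + exact: cvg_cst.
  have [m1 m2] := I1 x.
  have ik : cintegrable mu (fun y : borel G => gC y * pi ((y : G)^-1 * x)%g i j).
    by have := cintegrableMb ig m1 m2; under eq_fun do rewrite mulrC.
  transitivity (cintegral mu (fun y : borel G => gC y * pi ((y : G)^-1 * x)%g i j)).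
    rewrite -[RHS](preserving_cintegral (preserving_divg sndG haar_mu x) ik).
    by apply: cintegral_ext => y; rewrite invgM invgK mulgVK.
  have igJ k : cintegrable mu (fun y : borel G => gC y * (pi y k i)^*).
    have [n1 n2] := bmeasurableJ (bJ k i).
    by have := cintegrableMb ig n1 n2; under eq_fun do rewrite mulrC.
  transitivity (cintegral mu (fun y : borel G => \sum_k (gC y * (pi y k i)^*) * pi x k j)).
    apply: cintegral_ext => y; rewrite umxM mxE mulr_sumr; apply: eq_bigr => k _.
    by rewrite umxV !mxE mulrA.
  rewrite cintegral_sum => [|k]; last first.
    by have := cintegrableZ (pi x k j) (igJ k); under eq_fun do rewrite mulrC.
  apply: eq_bigr => k _; rewrite cintegralZr//; congr (_ * _).
  by have /matrixP/(_ k i) := fourier_gamma pi; rewrite !mxE.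
have ipi i j : cintegrable mu (fun y : borel G => pi y i j) := bmeasurable_integrable mu (bJ i j).
have iB i j : cintegrable mu (fun y : borel G => B i j * pi y i j) by exact: cintegrableZ.
have sum_conv (I : finType) (F : I -> borel G -> R[i]) :
    (forall i, cintegrable mu (F i)) ->
    conv mu gC (fun y => \sum_i F i y) x = \sum_i conv mu gC (F i) x.
  move=> iF; rewrite /conv -cintegral_sum => [|i]; last first.
    by apply: conv_integrand_bl => //; exact: bmeasurable_gamma.
  by apply: cintegral_ext => y; rewrite mulr_sumr.
rewrite Tw_conv /trig sum_conv => [|i]; last exact: cintegrable_sum.
transitivity (\sum_i \sum_j \sum_k B i j * ((pg pi) i k * pi x k j)).
  apply: eq_bigr => i _; rewrite sum_conv//; apply: eq_bigr => j _.
  by rewrite convZr ?coef ?mulr_sumr//; exact: bmeasurable_gamma.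
under eq_bigr do rewrite exchange_big.
rewrite exchange_big; apply: eq_bigr => k _; rewrite exchange_big.
apply: eq_bigr => j _; rewrite !mxE mulr_suml.
by apply: eq_bigr => i _; rewrite !mxE; ring.
Qed.

Lemma Tw_trig_sum (J : finType) (p : J -> unirrep R G) B x :
  Tw (trig_sum B) x = trig_sum (fun j => (pg (p j))^T *m B j) x.
Proof.
rewrite Tw_conv /trig_sum {1}/conv.
under cintegral_ext do rewrite mulr_sumr.
rewrite cintegral_sum => [|j].
  by apply: eq_bigr => j _; rewrite -Tw_trig.
apply: conv_integrand_bl => //; first exact: bmeasurable_gamma.
by apply: square_integrable_integrable; exact: trig_L2.
Qed.

Lemma Tw_L2 f : square_integrable mu f -> square_integrable mu (Tw f).
Proof.
move=> f2; apply: bmeasurable_square_integrable; rewrite Tw_conv.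
apply: bmeasurable_conv => //; exact: bmeasurable_gamma.
Qed.

Lemma fourier_eigen pi lambda f : op_eigenspace mu Tw lambda f ->
  (pg pi)^T *m fourier mu pi f = lambda *: fourier mu pi f.
Proof.
move=> [f2 Tf]; have If := square_integrable_integrable f2.
rewrite -fourier_gamma -fourier_conv//; first last.
- by move=> x; apply: conv_integrand_bl => //; exact: bmeasurable_gamma.
- exact: bmeasurable_integrable bmeasurable_gamma.
have p2 i j : square_integrable mu (fun y : borel G => pi y i j) by exact: unirrep_L2.
apply/matrixP => i j; rewrite !mxE -ipZl//.
by apply: (ip_ae (Tw_L2 f2) (p2 i j) (square_integrableZ lambda f2) (p2 i j) Tf); exact: aeW.
Qed.

(** The Fourier matrix satisfies the eigenvalue equation for the transpose of pi(gamma), which is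
    its conjugate; conjugating restores pi(gamma). The eigenvalue is also conjugated, its reality
    being deduced only in [fourier_eigen_spec]. *)
Lemma fourier_eigen_conj pi lambda f j : op_eigenspace mu Tw lambda f ->
  let A := map_mx Num.conj (fourier mu pi f) in
  col j A = 0 \/ mx_eigenvector (pg pi) lambda^* (col j A).
Proof.
move=> ef A; have [->|c0] := eqVneq (col j A) 0; first by left.
right; split => //; have hA : pg pi *m A = lambda^* *: A.
  have := congr1 (map_mx Num.conj) (fourier_eigen pi ef).
  rewrite map_mxM map_mxZ /= -/A => <-; congr (_ *m _).
  by rewrite -conj_urep_fun -map_mx_comp map_mx_id// => z /=; rewrite conjCK.
by rewrite colE mulmxA hA scalemxAl.
Qed.

Lemma fourier_eigen_spec pi lambda f : op_eigenspace mu Tw lambda f ->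
  fourier mu pi f != 0 -> mx_spec (pg pi) lambda.
Proof.
move=> ef f0; pose A := map_mx Num.conj (fourier mu pi f).
have [j Aj] : exists j, col j A <> 0.
  apply: contrapT => h; move/eqP: f0; apply; apply/matrixP => i j.
  have /contrapT/matrixP/(_ i 0) := (forallNP _).2 h j.
  by rewrite !mxE => /eqP; rewrite conjC_eq0 => /eqP.
have [//|ev] := fourier_eigen_conj j ef.
have sp : mx_spec (pg pi) lambda^* by exists (col j A).
have := hermitian_spec_real (urep_fun_hermitian pi) sp.
by move=> e; move: sp; rewrite -{1}e conjCK.
Qed.

End CayleyOperator.

(** Transfers to ordinals a basis indexed by a finite type, here the triples of
    [multiplicity_eigenspace]. *)
Lemma op_multiplicity_basis d (T : measurableType d) (R : realType)
    (mu : {measure set T -> \bar R}) K (lambda : R[i]) (I : finType)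
    (b : I -> T -> R[i]) :
  (forall i, op_eigenspace mu K lambda (b i)) ->
  (forall c : I -> R[i], (fun x => \sum_i c i * b i x) = (fun=> 0) %[ae mu] ->
     forall i, c i = 0) ->
  (forall f, op_eigenspace mu K lambda f ->
     exists c : I -> R[i], f = (fun x => \sum_i c i * b i x) %[ae mu]) ->
  op_multiplicity mu K lambda #|I|.
Proof.
move=> eb free span.
have re (F : I -> R[i]) : \sum_i F i = \sum_(k < #|I|) F (enum_val k).
  by rewrite (reindex (@enum_val I I)) //; apply: onW_bij; exact: enum_val_bij.
exists (fun k => b (enum_val k)); split=> [k|c c0 k|f /span[c fc]]; first exact: eb.
- have := free (fun i => c (enum_rank i)) _ (enum_val k); rewrite enum_valK; apply.
  apply: filterS c0 => x /= h t; rewrite -[RHS](h t) re.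
  by apply: eq_bigr => m _; rewrite enum_valK.
- exists (fun k => c (enum_val k)); apply: filterS fc => x /= h t.
  by rewrite h// re.
Qed.

(** * The eigenvalues of T_w and the finiteness of the classes attached to a nonzero one *)

Section Spectrum.
Context (R : realType) (G : topologicalGroupType) (mu : probability (borel G) R).
Hypotheses (compactG : compact [set: G]) (sndG : @second_countable G)
  (haar_mu : is_haar mu).
Variables (Ghat : set (unirrep R G)) (gamma : G -> R).
Hypotheses (dualG : unitary_dual Ghat) (cayley_gamma : cayley_function gamma).
Implicit Types (pi rho : unirrep R G).

Let Tw := integral_op mu (cayley_graphon gamma).
Let gC (x : borel G) : R[i] := (gamma x)%:C%C.
Let pg pi := urep_fun mu pi (fun x => (gamma x)%:C%C).
Let Ghat_at := dual_at mu Ghat gamma.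

Lemma dual_inequiv pi rho : Ghat pi -> Ghat rho -> rho <> pi -> ~ urep_equiv pi rho.
Proof.
move=> Gpi Grho neq eq; have [r [_ ru]] := dualG rho; apply: neq.
by rewrite -(ru rho (conj Grho (urep_equiv_refl rho))) (ru pi (conj Gpi eq)).
Qed.

Lemma ae_fourier pi f g : square_integrable mu f -> square_integrable mu g ->
  f = g %[ae mu] -> fourier mu pi f = fourier mu pi g.
Proof.
move=> f2 g2 fg; apply/matrixP => i j; rewrite !mxE.
have p2 := unirrep_L2 mu compactG (pi := pi) i j.
by apply: (ip_ae f2 p2 g2 p2 fg); exact: aeW.
Qed.

Lemma fourier0 pi : fourier mu pi (fun=> 0) = 0.
Proof.
apply/matrixP => i j; rewrite !mxE -[RHS](cintegral_cst mu).
by apply: cintegral_ext => y; rewrite mul0r.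
Qed.

Lemma ip_trig rho f (C : 'M[R[i]]_(udim rho)) : square_integrable mu f ->
  fourier mu rho f = 0 -> ip mu f (trig C) = 0.
Proof.
move=> f2 f0.
have r2 i j c : square_integrable mu (fun y : borel G => c * rho y i j).
  by apply: square_integrableZ; exact: unirrep_L2.
rewrite ip_sumr// => [|i]; last exact: square_integrable_sum.
rewrite big1// => i _; rewrite ip_sumr// big1// => j _.
rewrite ipZr//; last exact: unirrep_L2.
by have /matrixP/(_ i j) := f0; rewrite !mxE => ->; rewrite mulr0.
Qed.

Lemma spec_eigenfunction pi lambda : mx_spec (pg pi) lambda ->
  exists B : 'M[R[i]]_(udim pi), [/\ lambda^* = lambda, B != 0 &
    forall x, Tw (trig B) x = lambda * trig B x].
Proof.
move=> sp; have lJ := hermitian_spec_real (urep_fun_hermitian compactG sndG haar_mu cayley_gamma pi) sp.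
have [d0 _] := umx_irr pi; pose o := Ordinal d0.
have [v [v0 Av]] := sp.
(* The conjugate of v in the first column, zero elsewhere: T_w acts on B through the conjugate of
   pi(gamma). *)
pose B : 'M[R[i]]_(udim pi) := map_mx Num.conj v *m delta_mx 0 o.
have BE i : B i o = (v i 0)^*.
  by rewrite mxE big_ord1 !mxE !eqxx mulr1.
exists B; split => //.
  apply: contra v0 => /eqP B0; apply/eqP/matrixP => i j; rewrite ord1 mxE.
  have := BE i; rewrite B0 mxE => /esym/eqP.
  by rewrite conjC_eq0 => /eqP.
move=> x; rewrite /Tw Tw_trig// -(conj_urep_fun compactG sndG haar_mu cayley_gamma) mulmxA -map_mxM Av.
rewrite map_mxZ /= lJ -scalemxAl -/B /trig mulr_sumr; apply: eq_bigr => i _.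
by rewrite mulr_sumr; apply: eq_bigr => j _; rewrite mxE mulrA.
Qed.

Lemma trig_not_ae0 pi (B : 'M[R[i]]_(udim pi)) : B != 0 ->
  ~ (trig B = (fun=> 0) %[ae mu]).
Proof.
move=> B0 /(ae_fourier pi (trig_L2 mu compactG B) (square_integrable_cst mu 0)).
have [d0 _] := umx_irr pi.
rewrite fourier0 fourier_trig// => /eqP.
by rewrite scaler_eq0 (negbTE B0) invr_eq0 pnatr_eq0 eqn0Ngt d0.
Qed.

(** By completeness an eigenvector has a nonzero Fourier matrix at some class, and
    [fourier_eigen_spec] applies there. The eigenvalue 0 is covered as well. *)
Lemma op_eigenvalueE : op_eigenvalue mu Tw = \bigcup_(pi in Ghat) mx_spec (pg pi).
Proof.
apply/seteqP; split=> [lambda [f [ef f0]]|lambda [pi Gpi /spec_eigenfunction[B [_ B0 hB]]]].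
  have [pi [Gpi fpi]] : exists pi, Ghat pi /\ fourier mu pi f != 0.
    apply: contrapT => h; apply: f0.
    have [f2 _] := ef.
    apply: (dual_completeness compactG sndG haar_mu dualG f2) => pi Gpi.
    by apply/eqP; apply: contrapT => /negP pn; apply: h; exists pi.
  exists pi => //; exact: (fourier_eigen_spec compactG sndG haar_mu cayley_gamma ef fpi).
exists (trig B); split; last exact: trig_not_ae0.
split; first exact: trig_L2.
by apply: aeW => x _; exact: hB.
Qed.

Lemma op_eigenvalue_real lambda : op_eigenvalue mu Tw lambda -> lambda^* = lambda.
Proof.
by rewrite op_eigenvalueE => -[pi _ /spec_eigenfunction[B []]].
Qed.

(** Eigenfunctions from distinct classes are orthogonal, so infinitely many classes would give
    orthonormal families of unbounded size, against [orthonormal_eigen_bound] with kernel gamma. *)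
Lemma finite_dual_at lambda : lambda != 0 -> finite_set (Ghat_at lambda).
Proof.
move=> l0; apply: contrapT => inf.
have [p0 [_ p0l]] : exists pi, Ghat_at lambda pi.
  have [B BG B1] := infinite_set_fset 1 inf.
  have [pi Bpi] : exists pi, pi \in enum_fset B.
    by case: (enum_fset B) B1 => // pi s _; exists pi; rewrite mem_head.
  by exists pi; exact: BG.
have [_ [lJ _ _]] := spec_eigenfunction p0l.
pose l := Re lambda.
have lE : lambda = l%:C%C.
  apply: complex_eqP => //=; have /(congr1 (@complex.Im R)) := lJ; rewrite ImJ.
  by move/eqP; rewrite eq_sym -subr_eq0 opprK -mulr2n mulrn_eq0 => /eqP.
have ln0 : l != 0 by apply: contra l0 => /eqP l0; rewrite lE l0.
have [w hw] : {w : unirrep R G -> borel G -> R[i] & forall pi, Ghat_at lambda pi ->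
    [/\ conv_eigen mu gC l (w pi), ip mu (w pi) (w pi) = 1 & exists B : 'M[R[i]]_(udim pi), w pi = trig B]}.
  apply: (@choice _ _ (fun pi u => Ghat_at lambda pi -> [/\ conv_eigen mu gC l u,
    ip mu u u = 1 & exists B : 'M[R[i]]_(udim pi), u = trig B])) => pi.
  have [[Gpi sp]|] := pselect (Ghat_at lambda pi); last by exists (fun=> 0).
  have [B [_ B0 hB]] := spec_eigenfunction sp.
  have B2 := trig_L2 mu compactG B.
  pose s := (sqrtC (ip mu (trig B) (trig B)))^-1.
  have n0 : ip mu (trig B) (trig B) != 0.
    by apply/eqP => /(ip_eq0 B2); exact: trig_not_ae0.
  have s2 : s * s * ip mu (trig B) (trig B) = 1 by rewrite -expr2 exprVn sqrtCK mulVf.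
  have sJ : s^* = s by rewrite conj_Creal// realE invr_ge0 sqrtC_ge0 ip_ge0.
  exists (fun x => s * trig B x) => _; split.
  - apply: conv_eigenZ => //; first exact: bmeasurable_gamma.
    split; first exact: trig_ccontinuous.
    by move=> x; rewrite -lE; exact: hB.
  - by rewrite ipZl ?ipZr ?sJ ?mulrA//; exact: square_integrableZ.
  - exists (s *: B); apply/funext => x; rewrite /trig mulr_sumr; apply: eq_bigr => i _.
    by rewrite mulr_sumr; apply: eq_bigr => j _; rewrite mxE mulrA.
pose C := Re (ip mu gC gC) / l ^+ 2.
have [B BG Bn] := infinite_set_fset (Num.bound C).+1 inf.
have eu (b : B) : conv_eigen mu gC l (w (val b)) by have [] := hw _ (BG _ (valP b)).
have ou : orthonormal mu (fun b : B => w (val b)).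
  move=> a b; have Ga := BG _ (valP a); have Gb := BG _ (valP b).
  have [_ a1 [Ba wa]] := hw _ Ga; have [_ b1 [Bb wb]] := hw _ Gb.
  have [ab|ab] := eqVneq a b; first by rewrite ab b1.
  rewrite wb ip_trig// wa; first exact: trig_L2.
  apply: fourier_trig_inequiv => //; apply: dual_inequiv; [exact: Ga.1|exact: Gb.1|].
  by move=> /val_inj ba; rewrite ba eqxx in ab.
have := orthonormal_eigen_bound compactG sndG haar_mu
  (bmeasurable_gamma cayley_gamma) ln0 eu ou.
rewrite -/C => BC.
have C0 : 0 <= C by apply: le_trans BC; exact: ler0n.
have := le_lt_trans BC (archi_boundP C0).
by rewrite ltr_nat -cardfE ltnNge (ltnW Bn).
Qed.

End Spectrum.

(** * The eigenspace of a nonzero eigenvalue *)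

Section Eigenvectors.
Context (R : realType) (G : topologicalGroupType) (mu : probability (borel G) R).
Hypotheses (compactG : compact [set: G]) (sndG : @second_countable G)
  (haar_mu : is_haar mu).
Variables (Ghat : set (unirrep R G)) (gamma : G -> R).
Hypotheses (dualG : unitary_dual Ghat) (cayley_gamma : cayley_function gamma).
Implicit Types (pi rho : unirrep R G).

Let Tw := integral_op mu (cayley_graphon gamma).
Let pg pi := urep_fun mu pi (fun x => (gamma x)%:C%C).

Variable lambda : R[i].
Hypotheses (lambda0 : lambda != 0) (lambdaP : op_eigenvalue mu Tw lambda).

Let P := dual_at mu Ghat gamma lambda.
Let J := fset_set P.
Let p (j : J) : unirrep R G := val j.

Let lambdaJ : lambda^* = lambda.
Proof. exact: (op_eigenvalue_real compactG sndG haar_mu dualG cayley_gamma lambdaP). Qed.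

Let finite_P : finite_set P.
Proof. exact: finite_dual_at. Qed.

Let pP j : P (p j).
Proof.
have h : val j \in fset_set P := valP j.
by move: h; rewrite (in_fset_set finite_P) => /set_mem.
Qed.

Let P_p pi : P pi -> exists j, pi = p j.
Proof.
move=> Ppi; have h : pi \in fset_set P by rewrite (in_fset_set finite_P); exact/mem_set.
by exists (FSetSub h).
Qed.

Let p_inequiv j j' : j' != j -> ~ urep_equiv (p j') (p j).
Proof.
move=> jj; apply: (dual_inequiv dualG) (pP j').1 (pP j).1 _.
by move=> /val_inj e; rewrite e eqxx in jj.
Qed.

Lemma fourier_sum_trig A x : fourier_sum P A x =
  trig_sum (p := p) (fun j => (udim (p j))%:R *: map_mx Num.conj (A (p j))) x.
Proof.
rewrite /fourier_sum fsbig_finite; last exact: finite_P.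
rewrite big_seq_fsetE; apply: eq_bigr => j _ /=.
rewrite /mxtrace rmorph_sum mulr_sumr; apply: eq_bigr => i _.
rewrite mxE rmorph_sum mulr_sumr; apply: eq_bigr => k _.
by rewrite !mxE rmorphM /= conjCK mulrA.
Qed.

(** The difference has no Fourier coefficients: within P they cancel by Schur orthogonality, and
    outside P those of f vanish, since a nonzero one would put its class in P. *)
Lemma eigen_expansion f : op_eigenspace mu Tw lambda f ->
  f = trig_sum (p := p) (fun j => (udim (p j))%:R *: fourier mu (p j) f) %[ae mu].
Proof.
move=> ef; have [f2 _] := ef; pose B (j : J) := (udim (p j))%:R *: fourier mu (p j) f.
have B2 := trig_sum_L2 mu compactG B.
have : (fun x => f x - trig_sum B x) = (fun=> 0) %[ae mu].
  apply: (dual_completeness compactG sndG haar_mu dualG (square_integrableB f2 B2)) => pi Gpi.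
  have -> : fourier mu pi (fun x => f x - trig_sum B x) =
      fourier mu pi f - fourier mu pi (trig_sum B).
    by apply/matrixP => i j; rewrite !mxE ipBl//; exact: unirrep_L2.
  have [/P_p[j ->]|nP] := pselect (P pi).
    have [d0 _] := umx_irr (p j).
    rewrite fourier_trig_sum//; last by move=> j' jj; exact: p_inequiv.
    by rewrite scalerA mulVf ?scale1r ?subrr// pnatr_eq0 -lt0n.
  rewrite fourier_trig_sum_inequiv//; last first.
    move=> j; apply: (dual_inequiv dualG) => //; first exact: (pP j).1.
    by move=> e; apply: nP; rewrite e; exact: pP.
  rewrite subr0; apply/eqP; apply: contrapT => /negP fn0; apply: nP; split => //.
  exact: (fourier_eigen_spec compactG sndG haar_mu cayley_gamma ef fn0).
by apply: filterS => x /= h t; apply/eqP; rewrite -subr_eq0 h.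
Qed.

Lemma trig_sum_eigen (B : forall j : J, 'M[R[i]]_(udim (p j))) :
  (forall j, (pg (p j))^T *m B j = lambda *: B j) ->
  op_eigenspace mu Tw lambda (trig_sum B).
Proof.
move=> hB; split; first exact: trig_sum_L2.
apply: aeW => x _; rewrite /Tw Tw_trig_sum// /trig_sum mulr_sumr.
apply: eq_bigr => j _; rewrite hB /trig mulr_sumr; apply: eq_bigr => i _.
by rewrite mulr_sumr; apply: eq_bigr => k _; rewrite mxE mulrA.
Qed.

Lemma trig_sum_ae0 (B : forall j : J, 'M[R[i]]_(udim (p j))) :
  trig_sum B = (fun=> 0) %[ae mu] -> forall j, B j = 0.
Proof.
move=> B0 j.
have := ae_fourier compactG (p j) (trig_sum_L2 mu compactG B) (square_integrable_cst mu 0) B0.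
rewrite fourier0 fourier_trig_sum//; last by move=> j' jj; exact: p_inequiv.
have [d0 _] := umx_irr (p j).
move/eqP; rewrite scaler_eq0 invr_eq0 pnatr_eq0 -[_ == 0%N]negbK -lt0n d0 /=.
by move/eqP.
Qed.

Definition admissible (A : forall pi, 'M[R[i]]_(udim pi)) :=
  (forall pi, P pi -> forall j,
     col j (A pi) = 0 \/ mx_eigenvector (pg pi) lambda (col j (A pi))) /\
  (exists2 pi, P pi & A pi <> 0).

Lemma fourier_sum_L2 A : square_integrable mu (fourier_sum P A).
Proof.
rewrite (_ : fourier_sum P A = trig_sum (p := p)
  (fun j => (udim (p j))%:R *: map_mx Num.conj (A (p j)))); first exact: trig_sum_L2.
by apply/funext => x; exact: fourier_sum_trig.
Qed.

Lemma eigenvector_fourier_sum phi : square_integrable mu phi ->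
  op_eigenvector mu Tw lambda phi <->
  exists2 A, admissible A & phi = fourier_sum P A %[ae mu].
Proof.
move=> phi2; split=> [[ephi phi0]|[A [Aev [pi Ppi Api]] phiA]].
  pose A pi := map_mx Num.conj (fourier mu pi phi).
  have AE : trig_sum (p := p) (fun j => (udim (p j))%:R *: fourier mu (p j) phi) =
      fourier_sum P A.
    apply/funext => x; rewrite fourier_sum_trig; apply: eq_bigr => j _.
    by congr (trig (_ *: _) x); apply/matrixP => a b; rewrite !mxE conjCK.
  have phiE := eigen_expansion ephi; rewrite AE in phiE.
  exists A => //; split=> [pi Ppi j|].
    have := fourier_eigen_conj compactG sndG haar_mu cayley_gamma (pi := pi) j ephi.
    by rewrite lambdaJ.
  apply: contrapT => noA; apply: phi0.
  apply: filterS phiE => x /= h t; rewrite h// fourier_sum_trig /trig_sum big1// => j _.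
  have -> : A (p j) = 0.
    by apply: contrapT => Aj; apply: noA; exists (p j) => //; exact: pP.
  rewrite /trig big1// => i _; rewrite big1// => k _.
  by rewrite !mxE conjC0 mulr0 mul0r.
pose B (j : J) := (udim (p j))%:R *: map_mx Num.conj (A (p j)).
have AB : fourier_sum P A = trig_sum B by apply/funext => x; exact: fourier_sum_trig.
have AA pi' : P pi' -> pg pi' *m A pi' = lambda *: A pi'.
  move=> Ppi'; apply/matrixP => a b.
  have : pg pi' *m col b (A pi') = lambda *: col b (A pi').
    by have [->|[]//] := Aev pi' Ppi' b; rewrite mulmx0 scaler0.
  move/matrixP/(_ a 0); rewrite !mxE => <-.
  by apply: eq_bigr => k _; rewrite [col _ _ _ _]mxE.
have [B2 TB] : op_eigenspace mu Tw lambda (trig_sum B).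
  apply: trig_sum_eigen => j; rewrite /B -scalemxAr scalerA mulrC -scalerA; congr (_ *: _).
  rewrite -(conj_urep_fun compactG sndG haar_mu cayley_gamma) -map_mxM.
  by rewrite AA ?map_mxZ /= ?lambdaJ//; exact: pP.
rewrite AB in phiA.
(* Functions that agree almost everywhere have the same image under an integral operator, at every
   point. *)
have TE : Tw phi = Tw (trig_sum B).
  apply/funext => x; have mT f (f2 : square_integrable mu f) := cintegrable_measurable
    (conv_integrand_bl sndG haar_mu x (bmeasurable_gamma cayley_gamma)
      (square_integrable_integrable f2)).
  apply: (ae_eq_cintegral (mT _ phi2) (mT _ B2)).
  exact: ae_eq_cM.
split.
  split => //; rewrite TE; apply: filterS2 TB phiA => x /= h1 h2 t.
  by rewrite h1// h2.
move=> phi0; have B0 : trig_sum B = (fun=> 0) %[ae mu].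
  by apply: filterS2 phi0 phiA => x /= h1 h2 t; rewrite -h1// h2.
have [j pij] := P_p Ppi; rewrite pij in Api; apply: Api.
have := trig_sum_ae0 B0 j; have [d0 _] := umx_irr (p j).
move/eqP; rewrite scaler_eq0 pnatr_eq0 -[_ == 0%N]negbK -lt0n d0 /= => /eqP Aj.
apply/matrixP => a b; have /matrixP/(_ a b) := Aj; rewrite !mxE => /eqP.
by rewrite conjC_eq0 => /eqP.
Qed.

Let m pi := mx_multiplicity (pg pi) lambda.
Let E pi : 'M[R[i]]_(m pi, udim pi) := row_base (eigenspace (pg pi)^T lambda).

Let ET pi : E pi *m (pg pi)^T = lambda *: E pi.
Proof. by apply/eigenspaceP; rewrite eq_row_base. Qed.

(** One basis function for each class j, column s and row k of E, the rows of E being transposed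
    eigenvectors of pi(gamma). Its coefficient matrix has the conjugate of the k-th eigenvector in
    column s and zeros elsewhere. *)
Let I := {j : J & 'I_(udim (p j)) * 'I_(m (p j))}%type.

Let b (i : I) : borel G -> R[i] := trig
  ((map_mx Num.conj (row (tagged i).2 (E (p (tag i)))))^T *m
     delta_mx (0 : 'I_1) (tagged i).1).

Let coefs (c : I -> R[i]) (j : J) : 'M[R[i]]_(udim (p j)) :=
  \matrix_(a, s) \sum_k c (Tagged _ (s, k)) * (E (p j) k a)^*.

Lemma basis_eigen i : op_eigenspace mu Tw lambda (b i).
Proof.
split; first exact: trig_L2.
apply: aeW => x _; rewrite /Tw Tw_trig// mulmxA.
set v := row _ _.
have -> : (pg (p (tag i)))^T *m (map_mx Num.conj v)^T = lambda *: (map_mx Num.conj v)^T.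
  rewrite -trmx_mul -[pg _]trmxK -(conj_urep_fun compactG sndG haar_mu cayley_gamma).
  rewrite [(map_mx _ (urep_fun _ _ _))^T]map_trmx -map_mxM /v -row_mul ET linearZ /= map_mxZ linearZ /=.
  by rewrite lambdaJ.
rewrite -scalemxAl /b /trig mulr_sumr; apply: eq_bigr => a _.
by rewrite mulr_sumr; apply: eq_bigr => c _; rewrite mxE mulrA.
Qed.

Lemma sum_basis c x : \sum_i c i * b i x = trig_sum (coefs c) x.
Proof.
transitivity (\sum_j \sum_(sk : 'I_(udim (p j)) * 'I_(m (p j)))
  c (Tagged _ sk) * b (Tagged _ sk) x).
  by rewrite sig_big_dep; apply: eq_bigr => -[].
apply: eq_bigr => j _.
transitivity (\sum_s \sum_k \sum_a c (Tagged _ (s, k)) * ((E (p j) k a)^* * p j x a s)).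
  rewrite pair_big; apply: eq_bigr => -[s k] _ /=.
  rewrite /b /trig /= mulr_sumr; apply: eq_bigr => a _; congr (_ * _).
  rewrite (bigD1 s)//= big1 ?addr0 => [|s' ss']; rewrite mxE big_ord1 !mxE !eqxx.
    by rewrite mulr1.
  by rewrite (negbTE ss') mulr0 mul0r.
under eq_bigr do rewrite exchange_big.
rewrite exchange_big; apply: eq_bigr => a _; apply: eq_bigr => s _.
by rewrite mxE mulr_suml; apply: eq_bigr => k _; rewrite mulrA.
Qed.

Lemma multiplicity_eigenspace : op_multiplicity mu Tw lambda
  (\sum_(pi \in P) (udim pi * mx_multiplicity (pg pi) lambda)%N).
Proof.
have -> : \sum_(pi \in P) (udim pi * mx_multiplicity (pg pi) lambda)%N = #|{: I}|.
  rewrite fsbig_finite; last exact: finite_P.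
  rewrite big_seq_fsetE card_tagged sumnE big_map big_enum.
  by apply: eq_bigr => j _; rewrite card_prod !card_ord.
apply: (op_multiplicity_basis basis_eigen) => [c c0 [j [s k]]|f ef].
  have {}c0 : trig_sum (coefs c) = (fun=> 0) %[ae mu].
    by apply: filterS c0 => x /= h t; rewrite -sum_basis h.
  have /matrixP cj := trig_sum_ae0 c0 j.
  (* Conjugating column s of the vanishing matrix [coefs c j] gives a linear relation between the
     rows of E, which are free. *)
  pose d : 'rV_(m (p j)) := \row_k' (c (Tagged _ (s, k')))^*.
  have dE : d *m E (p j) = 0.
    apply/matrixP => o a; rewrite !mxE.
    have := cj a s; rewrite !mxE => /(congr1 Num.conj); rewrite conjC0 rmorph_sum => h.
    by apply: etrans h; apply: eq_bigr => k' _; rewrite !mxE rmorphM /= conjCK.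
  have : d = 0.
    have /row_free_inj fE : row_free (E (p j)) by exact: row_base_free.
    by apply: fE; rewrite mul0mx.
  move/matrixP/(_ 0 k); rewrite !mxE => /eqP.
  by rewrite conjC_eq0 => /eqP.
pose M (j : J) := (udim (p j))%:R *: fourier mu (p j) f.
(* The rows of the conjugate transpose of M j lie in the row space of E, so [pinvmx] returns their
   coordinates. *)
pose D (j : J) := (map_mx Num.conj (M j))^T *m pinvmx (E (p j)).
pose c (i : I) := (D (tag i) (tagged i).1 (tagged i).2)^*.
exists c; have fE := eigen_expansion ef.
have cM j : coefs c j = M j.
  have DE : D j *m E (p j) = (map_mx Num.conj (M j))^T.
    apply: mulmxKpV; rewrite eq_row_base; apply/eigenspaceP.
    have MT : (pg (p j))^T *m M j = lambda *: M j.
      rewrite /M -scalemxAr (fourier_eigen compactG sndG haar_mu cayley_gamma (p j) ef).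
      by rewrite scalerA mulrC -scalerA.
    rewrite -trmx_mul -[pg _]trmxK -(conj_urep_fun compactG sndG haar_mu cayley_gamma).
    by rewrite [(map_mx _ (urep_fun _ _ _))^T]map_trmx -map_mxM MT map_mxZ /= lambdaJ linearZ.
  apply/matrixP => a s; rewrite mxE.
  have /matrixP/(_ s a) := DE; rewrite [LHS]mxE [RHS]mxE [RHS]mxE => /(congr1 Num.conj).
  rewrite conjCK => <-; rewrite rmorph_sum; apply: eq_bigr => k _.
  by rewrite rmorphM.
apply: filterS fE => x /= h t; rewrite h// sum_basis.
by apply: eq_bigr => j _; rewrite cM.
Qed.

End Eigenvectors.

Local Close Scope sesquilinear_scope.

Theorem theorem4p3 (R : realType) (G : topologicalGroupType)
    (compactG : compact_group G) (sndG : @second_countable G)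
    (mu : probability (borel G) R) (haar_mu : is_haar mu)
    (Ghat : set (unirrep R G)) (dualG : unitary_dual Ghat)
    (gamma : G -> R) (cayley_gamma : cayley_function gamma) :
  let Tw := integral_op mu (cayley_graphon gamma) in
  let pi_gamma (pi : unirrep R G) := urep_fun mu pi (fun x => (gamma x)%:C%C) in
  let Ghat_at := dual_at mu Ghat gamma in
  [/\ op_eigenvalue mu Tw = \bigcup_(pi in Ghat) mx_spec (pi_gamma pi),
      forall lambda : R[i], lambda != 0 -> op_eigenvalue mu Tw lambda ->
        finite_set (Ghat_at lambda),
      forall lambda : R[i], lambda != 0 -> op_eigenvalue mu Tw lambda ->
        let admissible (A : forall pi : unirrep R G, 'M[R[i]]_(udim pi)) :=
          (forall pi, Ghat_at lambda pi -> forall j,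
             col j (A pi) = 0 \/
             mx_eigenvector (pi_gamma pi) lambda (col j (A pi))) /\
          (exists2 pi, Ghat_at lambda pi & A pi <> 0) in
        (forall A, admissible A ->
           square_integrable mu (fourier_sum (Ghat_at lambda) A)) /\
        (forall phi : borel G -> R[i], square_integrable mu phi ->
           op_eigenvector mu Tw lambda phi <->
           exists2 A, admissible A &
             phi = fourier_sum (Ghat_at lambda) A %[ae mu]) &
      forall lambda : R[i], lambda != 0 -> op_eigenvalue mu Tw lambda ->
        op_multiplicity mu Tw lambda
          (\sum_(pi \in Ghat_at lambda)
             (udim pi * mx_multiplicity (pi_gamma pi) lambda)%N)].
Proof.
have [cG _] := compactG; move=> Tw pi_gamma Ghat_at.
split.
- exact: op_eigenvalueE.
- by move=> lambda l0 _; exact: finite_dual_at.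
- move=> lambda l0 lP adm; split=> [A _|phi phi2]; first exact: fourier_sum_L2.
  exact: eigenvector_fourier_sum.
- by move=> lambda l0 lP; exact: multiplicity_eigenspace.
Qed.
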